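(* The \textsc{Linked Planar 3-SAT} problem remains NP-complete even if each clause contains exactly three different variables.
   Context: A CNF formula $\phi$ has variable set $V$ and clause set $C$. Its incidence graph $G_\phi$ has vertex set $C \cup V$ and an edge between a variable $v$ and a clause $c$ if and only if $v$ occurs in $c$ (negated or unnegated); there are no other edges. \textsc{Linked Planar 3-SAT}: the input is a CNF formula $\phi$ with at most three variables per clause, its incidence graph $G_\phi = (C\cup V, E)$, and a Hamiltonian cycle $\kappa$ on $C \cup V$ that first visits all elements of $C$ and then all elements of $V$, such that the union of $G_\phi$ and $\kappa$ is a planar graph. The question is whether $\phi$ is satisfiable. *)

(* Defs.v *)
From HB Require Import structures.
From mathcomp Require Import all_boot all_order all_algebra.
From mathcomp Require Import all_classical all_reals all_analysis.
Import numFieldNormedType.Exports.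

Set Implicit Arguments.
Unset Strict Implicit.
Unset Printing Implicit Defensive.

Inductive move := MoveL | MoveN | MoveR.

(* A machine has ntapes.+1 two-way infinite tapes.  A cell is blank (None), or
   holds an input/output bit (Some (inl b)) or an auxiliary symbol
   (Some (inr a)). *)
Record TM := MkTM {
  ntapes : nat;
  state : finType;
  aux : finType;
  start : state;
  final : pred state;
  delta : state -> {ffun 'I_ntapes.+1 -> option (bool + aux)} ->
          state * {ffun 'I_ntapes.+1 -> option (bool + aux) * move}
}.

Section Semantics.
Variable M : TM.

Definition cell := option (bool + aux M).

(* Cells beyond both lists are blank; [tleft] is listed from the head outwards. *)
Record tape := MkTape { tleft : seq cell; tcur : cell; tright : seq cell }.

Definition tape_of (s : seq cell) : tape :=
  MkTape [::] (head None s) (behead s).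

Definition tape_act (t : tape) (a : cell * move) : tape :=
  match a.2 with
  | MoveL => MkTape (behead (tleft t)) (head None (tleft t)) (a.1 :: tright t)
  | MoveN => MkTape (tleft t) a.1 (tright t)
  | MoveR => MkTape (a.1 :: tleft t) (head None (tright t)) (behead (tright t))
  end.

Record config := MkConfig {
  cstate : state M;
  ctapes : {ffun 'I_(ntapes M).+1 -> tape}
}.

Definition init (x : seq bool) : config :=
  MkConfig (start M)
    [ffun i => tape_of (if i == ord0 then [seq Some (inl b) | b <- x] else [::])].

Definition step (c : config) : config :=
  if final (cstate c) then c else
  let d := delta (cstate c) [ffun i => tcur (ctapes c i)] in
  MkConfig d.1 [ffun i => tape_act (ctapes c i) (d.2 i)].

Fixpoint leading_bits (s : seq cell) : seq bool :=
  if s is Some (inl b) :: s' then b :: leading_bits s' else [::].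

(* The output is written on tape 0, from the head up to the first non-bit. *)
Definition output (c : config) : seq bool :=
  let t := ctapes c ord0 in leading_bits (tcur t :: tright t).

Definition computes_within (x y : seq bool) (t : nat) : Prop :=
  let c := iter t step (init x) in final (cstate c) /\ output c = y.

End Semantics.

Definition polytime (f : seq bool -> seq bool) : Prop :=
  exists (M : TM) (a d : nat), forall x : seq bool,
    computes_within M x (f x) (a * (size x).+1 ^ d)%N.

Definition code_nat (k : nat) : seq bool := rcons (nseq k true) false.

Definition code_seq (T : Type) (f : T -> seq bool) (s : seq T) : seq bool :=
  code_nat (size s) ++ flatten (map f s).

Definition code_pair (x w : seq bool) : seq bool :=
  code_seq (fun b => [:: b]) x ++ w.

Definition language := seq bool -> Prop.

Definition in_NP (L : language) : Prop :=
  exists (V : seq bool -> bool) (a d : nat),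
    polytime (fun z => [:: V z]) /\
    forall x, L x <->
      exists w, (size w <= a * (size x).+1 ^ d)%N /\ V (code_pair x w).

Definition poly_reduces (L1 L2 : language) : Prop :=
  exists f : seq bool -> seq bool, polytime f /\ forall x, L1 x <-> L2 (f x).

Definition NP_hard (L : language) : Prop :=
  forall L', in_NP L' -> poly_reduces L' L.

Definition NP_complete (L : language) : Prop := in_NP L /\ NP_hard L.

Section Planarity.
Variable R : realType.
Local Open Scope classical_set_scope.
Local Open Scope ring_scope.

Definition is_arc (A : set (R * R)) (p q : R * R) : Prop :=
  exists g : R -> R * R,
    [/\ {within `[0, 1], continuous g},
        {in `[0, 1] &, injective g},
        g @` `[0, 1] = A,
        g 0 = p & g 1 = q].

(* A crossing-free drawing of the simple graph with edge relation e. *)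
Definition planar (T : finType) (e : rel T) : Prop :=
  exists (pos : T -> R * R) (arc : T -> T -> set (R * R)),
    [/\ injective pos,
        forall x y, e x y -> is_arc (arc x y) (pos x) (pos y),
        forall x y, e x y -> arc x y = arc y x,
        forall x y z, e x y -> arc x y (pos z) -> z = x \/ z = y &
        forall x y x' y' p, e x y -> e x' y' ->
          arc x y p -> arc x' y' p ->
          [\/ x = x' /\ y = y', x = y' /\ y = x' | exists z, p = pos z]].

End Planarity.

(* Variables are 'I_n; (v, true) is the literal v and (v, false) its negation. *)
Definition literal (n : nat) := ('I_n * bool)%type.
Definition clause (n : nat) := seq (literal n).
Definition cnf (n m : nat) := m.-tuple (clause n).

Section Formula.
Variables (n m : nat) (phi : cnf n m).

Definition satisfiable : Prop :=
  exists a : 'I_n -> bool,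
    forall c, c \in tval phi -> exists2 l, l \in c & a l.1 = l.2.

(* The clauses form a set: no two of them consist of the same literals. *)
Definition clauses_distinct : Prop :=
  forall i j : 'I_m, tnth phi i =i tnth phi j -> i = j.

Definition clause_vars (c : clause n) : seq 'I_n := undup (map fst c).

(* inl i is the i-th clause, inr v is the variable v. *)
Definition vertex := ('I_m + 'I_n)%type.

Definition occurs (v : 'I_n) (i : 'I_m) : bool := v \in clause_vars (tnth phi i).

Definition incidence : rel vertex := fun x y =>
  match x, y with
  | inl i, inr v | inr v, inl i => occurs v i
  | _, _ => false
  end.

Variable kappa : seq vertex.

Definition cycle_edge : rel vertex := fun x y =>
  (next kappa x == y) || (next kappa y == x).

Definition hamiltonian_cycle : Prop :=
  [/\ (2 < size kappa)%N, uniq kappa & forall x, x \in kappa].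

Definition clauses_then_variables : Prop :=
  exists (s : seq 'I_m) (t : seq 'I_n), kappa = map inl s ++ map inr t.

Definition union_graph : rel vertex := fun x y =>
  incidence x y || cycle_edge x y.

Definition LP3SAT_instance (R : realType) : Prop :=
  [/\ clauses_distinct,
      forall c, c \in tval phi -> (size c <= 3)%N,
      hamiltonian_cycle,
      clauses_then_variables &
      planar R union_graph].

Definition exactly_three_variables : Prop :=
  forall c, c \in tval phi -> size (clause_vars c) = 3.

Definition code_literal (l : literal n) : seq bool := code_nat l.1 ++ [:: l.2].

Definition code_vertex (x : vertex) : seq bool :=
  match x with inl i => true :: code_nat i | inr v => false :: code_nat v end.

(* Unary indices are harmless: all of them are bounded by size kappa. *)
Definition code_instance : seq bool :=
  code_nat n ++ code_seq (code_seq code_literal) phi ++ code_seq code_vertex kappa.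

End Formula.

Definition linked_planar_3SAT (R : realType)
    (restr : forall n m, cnf n m -> Prop) : language := fun x =>
  exists (n m : nat) (phi : cnf n m) (kappa : seq (vertex n m)),
    [/\ x = code_instance phi kappa,
        LP3SAT_instance phi kappa R,
        restr n m phi &
        satisfiable phi].

(* Main.v *)
Require Import Defs.
From mathcomp Require Import all_boot all_order all_algebra.
From mathcomp Require Import all_classical all_reals all_analysis.
From mathcomp Require Import zify lra ring.

Set Implicit Arguments.
Unset Strict Implicit.
Unset Printing Implicit Defensive.

(** Membership: an assignment together with the side of the cycle on which each
    incidence edge is drawn is a certificate.  Two edges on the same side must
    not interleave along the cycle; conversely a crossing-free drawing yields
    such sides, because the parity of the winding number of the cycle around
    the midpoint of an edge distinguishes interleaving edges.

    Hardness: the clauses come in a row, and each page is drawn monotonically,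
    so that the formula reads a queue of variables at two places that move only
    forward.  Short exactly-3 gadgets copy a row of bits [z, 0, 0] into the next
    one; a chain of gadgets that first split a bit into one-sided approximations
    and then merge them duplicates a bit, and with it a pass over the row can
    overwrite a bit by its neighbour or by the NAND of its two neighbours.  Such
    passes compute every Boolean function of a window, hence simulate a Turing
    machine whose stacks are swept back and forth by a moving control. *)

(** * Stack programs and Turing machines *)

(** The hardness half is shaped by a pigeonhole fact: a clause with three different variables has
    two of them on one page, so it moves the reading position of that page strictly forward. A bit
    can thus occur in few clauses only, and an implication between two bits must be padded with a
    third bit known to be false. Hence the zeros in [[z, 0, 0]], the invariant that consecutive
    gadgets meet in a false variable, and the detour through approximations when a bit is
    duplicated. The same fact shows that all clauses are different. The first constants come from
    [prelude].

    The cells that hold the certificate are free and may decode to nonsense, so decoding is total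
    and a first sweep erases everything from the first non-bit on.

    In the membership half, arcs that share a vertex are not disjoint; the winding argument
    therefore works with half edges, which are kept away from the edges that miss their vertex.

    Both halves have to exhibit a concrete Turing machine. It is compiled from a small language with
    bounded loops only, so a polynomial time bound follows by induction on the program. *)

Definition store := nat -> seq bool.
Definition upd (s : store) (i : nat) (v : seq bool) : store :=
  fun j => if j == i then v else s j.

Lemma updE (s : store) (i : nat) (v : seq bool) (j : nat) :
  upd s i v j = if j == i then v else s j.
Proof. by []. Qed.

Inductive cmd :=
| CPush of nat & bool
| CPop of nat
| CSkip
| CSeq of cmd & cmd
| CWhile of nat & cmd
| CCase of nat & cmd & cmd & cmd.

(* The last index counts steps of the Turing machine built below. *)
Inductive exec : cmd -> store -> store -> nat -> Prop :=
| XPush i b s : exec (CPush i b) s (upd s i (b :: s i)) 2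
| XPop i s : exec (CPop i) s (upd s i (behead (s i))) 1
| XSkip s : exec CSkip s s 0
| XSeq c d s s1 s2 t1 t2 : exec c s s1 t1 -> exec d s1 s2 t2 ->
    exec (CSeq c d) s s2 (t1 + t2)
| XWhile0 i c s : s i = [::] -> exec (CWhile i c) s s 1
| XWhileS i c s s1 s2 t1 t2 : s i <> [::] -> exec c s s1 t1 ->
    exec (CWhile i c) s1 s2 t2 -> exec (CWhile i c) s s2 (t1 + t2 + 2)
| XCase i ce ct cf s s1 t :
    exec (if s i is b :: _ then if b then ct else cf else ce) s s1 t ->
    exec (CCase i ce ct cf) s s1 (t + 2).

Inductive instr := IPush of nat & bool | IPop of nat | ICase of nat & nat & nat & nat.

Definition ijmp p := ICase 0 p p p.

Fixpoint csize c := match c with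
  | CPush _ _ | CPop _ => 1
  | CSkip => 0
  | CSeq a b => csize a + csize b
  | CWhile _ a => (csize a).+2
  | CCase _ a b d => csize a + csize b + csize d + 4
  end.

Fixpoint comp c p : seq instr := match c with
  | CPush i b => [:: IPush i b]
  | CPop i => [:: IPop i]
  | CSkip => [::]
  | CSeq a b => comp a p ++ comp b (p + csize a)
  | CWhile i a => ICase i (p + csize a + 2) p.+1 p.+1 :: comp a p.+1 ++ [:: ijmp p]
  | CCase i a b d =>
    let pb := (p.+1 + csize a).+1 in let pd := (pb + csize b).+1 in
    let pe := (pd + csize d).+1 in
    ICase i p.+1 pb pd :: comp a p.+1 ++ ijmp pe :: comp b pb ++ ijmp pe ::
      comp d pd ++ [:: ijmp pe]
  end.

Lemma size_comp c p : size (comp c p) = csize c.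
Proof.
elim: c p => //= [c IHc d IHd|i c IHc|i a IHa b IHb d IHd] p.
- by rewrite size_cat IHc IHd.
- by rewrite size_cat IHc /=; lia.
- by rewrite size_cat /= size_cat /= size_cat /= IHa IHb IHd; lia.
Qed.

Definition code_at (C : seq instr) p l :=
  forall i, i < size l -> nth (IPop 0) C (p + i) = nth (IPop 0) l i.

Lemma code_at_cat C p l1 l2 : code_at C p (l1 ++ l2) ->
  code_at C p l1 /\ code_at C (p + size l1) l2.
Proof.
move=> H; split=> i Hi.
  by rewrite H ?size_cat ?nth_cat ?Hi //; lia.
by rewrite -addnA H ?size_cat ?nth_cat; [rewrite ltnNge leq_addr addKn | lia].
Qed.

Lemma code_at_cons C p x l : code_at C p (x :: l) ->
  nth (IPop 0) C p = x /\ code_at C p.+1 l.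
Proof.
move=> H; split; first by have := H 0 isT; rewrite addn0.
by move=> i Hi; have := H i.+1 Hi; rewrite addnS addSn.
Qed.

Inductive frun (C : seq instr) : nat -> store -> nat -> store -> nat -> Prop :=
| FR0 p s : frun C p s p s 0
| FRPush p s i b q s' t : p < size C -> nth (IPop 0) C p = IPush i b ->
    frun C p.+1 (upd s i (b :: s i)) q s' t -> frun C p s q s' t.+2
| FRPop p s i q s' t : p < size C -> nth (IPop 0) C p = IPop i ->
    frun C p.+1 (upd s i (behead (s i))) q s' t -> frun C p s q s' t.+1
| FRCase p s i pe pt pf q s' t : p < size C -> nth (IPop 0) C p = ICase i pe pt pf ->
    frun C (if s i is b :: _ then if b then pt else pf else pe) s q s' t ->
    frun C p s q s' t.+1.

Lemma frun_trans C p s q s1 t1 r s2 t2 :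
  frun C p s q s1 t1 -> frun C q s1 r s2 t2 -> frun C p s r s2 (t1 + t2).
Proof.
elim=> {p s q s1 t1} //.
- move=> p s i b q s' t H1 H2 H3 IH H4; rewrite addSn addSn.
  exact: FRPush H1 H2 (IH H4).
- move=> p s i q s' t H1 H2 H3 IH H4; rewrite addSn.
  exact: FRPop H1 H2 (IH H4).
- move=> p s i pe pt pf q s' t H1 H2 H3 IH H4; rewrite addSn.
  exact: FRCase H1 H2 (IH H4).
Qed.

Lemma frun_jmp C p s q : p < size C -> nth (IPop 0) C p = ijmp q -> frun C p s q s 1.
Proof.
move=> H1 H2; apply: FRCase H1 H2 _.
have -> : (if s 0 is b :: _ then if b then q else q else q) = q
  by case: (s 0) => [|[]].
exact: FR0.
Qed.

Lemma comp_frun c s s' t : exec c s s' t -> forall C p,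
  p + csize c <= size C -> code_at C p (comp c p) -> frun C p s (p + csize c) s' t.
Proof.
elim=> {c s s' t} /=.
- move=> i b s C p H1 /code_at_cons[H2 _]; rewrite addn1.
  by apply: FRPush H2 _; [lia | exact: FR0].
- move=> i s C p H1 /code_at_cons[H2 _]; rewrite addn1.
  by apply: FRPop H2 _; [lia | exact: FR0].
- by move=> s C p _ _; rewrite addn0; exact: FR0.
- move=> c d s s1 s2 t1 t2 _ IH1 _ IH2 C p H /code_at_cat[]; rewrite size_comp => H1 H2.
  apply: frun_trans (IH1 _ _ _ H1) _; first lia.
  by rewrite addnA; apply: IH2 => //; lia.
- move=> i c s Hs C p H /code_at_cons[H1 _].
  apply: (FRCase _ H1); first lia.
  by rewrite Hs addn2 !addnS; exact: FR0.
- move=> i c s s1 s2 t1 t2 Hs _ IH1 _ IH2 C p H HC.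
  have /code_at_cons[H1 /code_at_cat[H2]] := HC.
  rewrite size_comp => /code_at_cons[H3 _].
  rewrite (_ : t1 + t2 + 2 = (t1 + (1 + t2)).+1); last lia.
  apply: (FRCase _ H1); first lia.
  have -> : (if s i is b :: _ then if b then p.+1 else p.+1 else p + csize c + 2) = p.+1.
    by case: (s i) Hs => [|[]].
  apply: frun_trans (IH1 _ _ _ H2) _; first lia.
  apply: frun_trans (frun_jmp _ _ H3) _; first lia.
  exact: IH2.
- move=> i a b d s s1 t _ IH C p H.
  move=> /code_at_cons[H1 /code_at_cat[Ha]]; rewrite size_comp => /code_at_cons[Hja].
  move=> /code_at_cat[Hb]; rewrite size_comp => /code_at_cons[Hjb /code_at_cat[Hd]].
  rewrite size_comp => /code_at_cons[Hjd _].
  have Epe : p + (csize a + csize b + csize d + 4) =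
    (((p.+1 + csize a).+1 + csize b).+1 + csize d).+1 by lia.
  rewrite addn2; apply: (FRCase _ H1); first lia.
  rewrite -[t.+1]addn1.
  case: (s i) IH => [|[] l] IH.
  + apply: frun_trans (IH _ _ _ Ha) _; first lia.
    by rewrite Epe; apply: frun_jmp Hja; lia.
  + apply: frun_trans (IH _ _ _ Hb) _; first lia.
    by rewrite Epe; apply: frun_jmp Hjb; lia.
  + apply: frun_trans (IH _ _ _ Hd) _; first lia.
    by rewrite Epe; apply: frun_jmp Hjd; lia.
Qed.

Definition index_of (I : instr) := match I with IPush i _ | IPop i | ICase i _ _ _ => i end.

Section Machine.
Variable C : seq instr.
Let k := \max_(i <- map index_of C) i.
Let mcell := option (bool + unit).

(** The Boolean in a state is set between the two steps of a push: the head first moves left off the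
    stack and then writes. A pop erases and moves right in one step, so the cells to the left of the
    head stay blank. *)
Definition mdelta (q : 'I_(size C).+1 * bool) (rd : {ffun 'I_k.+1 -> mcell}) :
    ('I_(size C).+1 * bool) * {ffun 'I_k.+1 -> mcell * move} :=
  match nth (IPop 0) C q.1 with
  | IPush i b =>
    if q.2 then ((inord q.1.+1, false),
      [ffun j => if val j == i then (Some (inl b), MoveN) else (rd j, MoveN)])
    else ((q.1, true), [ffun j => if val j == i then (rd j, MoveL) else (rd j, MoveN)])
  | IPop i => ((inord q.1.+1, false),
      [ffun j => if val j == i then (None, MoveR) else (rd j, MoveN)])
  | ICase i pe pt pf =>
    ((inord (if rd (inord i) is Some a then if a is inl true then pt else pf else pe), false),
      [ffun j => (rd j, MoveN)])
  end.

Definition stack_machine : TM :=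
  @MkTM k ('I_(size C).+1 * bool)%type unit (ord0, false)
    (fun q => nat_of_ord q.1 == size C) mdelta.

Let M := stack_machine.

Definition bits_of (v : seq bool) : seq (cell M) := [seq Some (inl b) | b <- v].

(** Tapes are compared cell by cell with blank as default, because head moves leave explicit blanks
    in the lists and equality of lists would be too strict. *)
Definition stack_tape (t : tape M) (v : seq bool) : Prop :=
  (forall j, nth None (tleft t) j = None) /\
  (forall j, nth None (tcur t :: tright t) j = nth None (bits_of v) j).

Definition represents (c : config M) p (s : store) : Prop :=
  cstate c = (inord p, false) /\ forall i : 'I_k.+1, stack_tape (ctapes c i) (s i).

Lemma stack_tape_stay t v : stack_tape t v -> stack_tape (tape_act t (tcur t, MoveN)) v.
Proof. by case: t. Qed.

Lemma stack_tape_pop t v : stack_tape t v -> stack_tape (tape_act t (None, MoveR)) (behead v).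
Proof.
case: t => l a r [/= Hl Hr]; split=> /= [[|j] //|j]; first exact: Hl.
have := Hr j.+1 => /= {}Hr; rewrite /bits_of -behead_map nth_behead -Hr.
by case: j {Hr} => [|j]; case: r => //=; rewrite nth_nil.
Qed.

Lemma stack_tape_push t v b : stack_tape t v ->
  stack_tape (tape_act (tape_act t (tcur t, MoveL)) (Some (inl b), MoveN)) (b :: v).
Proof.
case: t => l a r [/= Hl Hr]; split=> /= j; first by rewrite nth_behead.
by case: j => //= j; exact: Hr.
Qed.

Lemma stack_tape_top t v : stack_tape t v ->
  tcur t = if v is b :: _ then Some (inl b) else None.
Proof. by case=> _ /(_ 0) /= ->; case: v. Qed.

Lemma instr_index p : p < size C -> index_of (nth (IPop 0) C p) <= k.
Proof.
move=> Hp; have H : index_of (nth (IPop 0) C p) \in map index_of C.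
  by rewrite -(@nth_map _ (IPop 0) _ 0 index_of) //; apply: mem_nth; rewrite size_map.
exact: (@leq_bigmax_seq _ _ predT id _ H isT).
Qed.

Lemma frun_machine p s q s' t : frun C p s q s' t -> q <= size C ->
  forall c, represents c p s -> represents (iter t (@step M) c) q s'.
Proof.
elim=> {p s q s' t} //.
- move=> p s i b q s' t Hp Hi _ IH Hq c [Hc Ht]; rewrite iterSr iterSr; apply: IH => //.
  have ord_p : nat_of_ord (inord p : 'I_(size C).+1) = p by rewrite inordK // ltnS ltnW.
  have E1 : step c = @MkConfig M (inord p, true) [ffun j : 'I_k.+1 =>
      tape_act (ctapes c j) (tcur (ctapes c j), if val j == i then MoveL else MoveN)].
    rewrite /step Hc /= ord_p ltn_eqF //= /mdelta /= ord_p Hi /=; congr MkConfig.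
    by apply/ffunP=> j; rewrite !ffunE; case: ifP.
  rewrite E1 /step /= ord_p ltn_eqF //= /mdelta /= ord_p Hi /=.
  split=> //= j; rewrite !ffunE /=; case: ifP => [/eqP ji|ji].
    by rewrite updE ji eqxx -ji; apply: stack_tape_push.
  by rewrite updE ji; apply: stack_tape_stay; apply: stack_tape_stay.
- move=> p s i q s' t Hp Hi _ IH Hq c [Hc Ht]; rewrite iterSr; apply: IH => //.
  have ord_p : nat_of_ord (inord p : 'I_(size C).+1) = p by rewrite inordK // ltnS ltnW.
  rewrite /step Hc /= ord_p ltn_eqF //= /mdelta /= ord_p Hi /=.
  split=> //= j; rewrite !ffunE /=; case: ifP => [/eqP ji|ji].
    by rewrite updE ji eqxx -ji; apply: stack_tape_pop.
  by rewrite updE ji; apply: stack_tape_stay.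
- move=> p s i pe pt pf q s' t Hp Hi Hr IH Hq c [Hc Ht]; rewrite iterSr; apply: IH => //.
  have ord_p : nat_of_ord (inord p : 'I_(size C).+1) = p by rewrite inordK // ltnS ltnW.
  have Hik : nat_of_ord (inord i : 'I_k.+1) = i.
    by rewrite inordK // ltnS; have := instr_index Hp; rewrite Hi.
  rewrite /step Hc /= ord_p ltn_eqF //= /mdelta /= ord_p Hi /=.
  split=> /= [|j]; last by rewrite !ffunE; apply: stack_tape_stay.
  rewrite !ffunE (stack_tape_top (Ht (inord i))) Hik.
  by congr (inord _, _); case: (s i) => [|[]].
Qed.

Lemma leading_bits_nth (l : seq (cell M)) v :
  (forall j, nth None l j = nth None (bits_of v) j) -> leading_bits l = v.
Proof.
elim: v l => [|b v IH] [|a l] H //=; first by have /= -> := H 0.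
  by have := H 0.
by have /= -> := H 0; rewrite (IH l) // => j; have := H j.+1.
Qed.
End Machine.

Lemma step_final (M : TM) (c : config M) t : final (cstate c) -> iter t (@step M) c = c.
Proof. by move=> H; elim: t => //= t ->; rewrite /step H. Qed.

(* The program starts with the input on stack 0 and leaves the output there. *)
Lemma exec_polytime (f : seq bool -> seq bool) (c : cmd) (a d : nat) :
  (forall x, exists s t, [/\ exec c (upd (fun=> [::]) 0 x) s t, s 0 = f x &
     t <= a * (size x).+1 ^ d]) -> polytime f.
Proof.
move=> H; pose C := comp c 0; exists (stack_machine C), a, d => x.
have [s [t [Hc Hs Ht]]] := H x.
have HC : size C = csize c by rewrite size_comp.
have := comp_frun Hc (C := C) (p := 0); rewrite add0n -HC => /(_ (leqnn _)) Hr.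
have {}Hr := Hr (fun i _ => erefl).
have [] := frun_machine Hr (leqnn _) (c := init (stack_machine C) x).
  split=> /=; first by congr (_, _); apply/val_inj; rewrite /= inordK.
  move=> i; rewrite ffunE updE; case: eqP => [->|/eqP ni].
    by split=> /= j; [rewrite nth_nil | case: x {H Hs Ht Hc Hr} => [|b x]; case: j => //= j; rewrite nth_nil].
  have -> : (nat_of_ord i == 0) = false by apply: contraNF ni => /eqP i0; apply/eqP/val_inj.
  by split=> /= j; case: j => //= j; rewrite nth_nil.
move=> Hst Htp; rewrite /computes_within.
(* The program halts after exactly [t] steps; the remaining steps up to the bound change nothing,
   because the state is final. *)
rewrite -(subnK Ht) iterD.
have Hfin : final (cstate (iter t (@step _) (init (stack_machine C) x))).
  by rewrite Hst /= inordK.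
rewrite step_final //; split=> //.
have [_ H0] := Htp ord0; rewrite /output -Hs; exact: leading_bits_nth.
Qed.

(** * A language of string functions *)

(** Only positive arguments are considered, since at [M = 0] the monomial vanishes as soon as [d] is
    positive. *)
Definition polyb (f : nat -> nat) := exists c d, forall M, 0 < M -> f M <= c * M ^ d.

Lemma polyb_const c : polyb (fun=> c).
Proof. by exists c, 0 => M _; rewrite expn0 muln1. Qed.

Lemma polyb_id : polyb id.
Proof. by exists 1, 1 => M _; rewrite expn1 mul1n. Qed.

Lemma polybD f g : polyb f -> polyb g -> polyb (fun M => f M + g M).
Proof.
move=> [a [d Hf]] [b [e Hg]]; exists (a + b), (d + e) => M M0.
rewrite mulnDl; apply: leq_add.
  by apply: leq_trans (Hf _ M0) _; rewrite leq_mul2l leq_pexp2l ?leq_addr ?orbT.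
by apply: leq_trans (Hg _ M0) _; rewrite leq_mul2l leq_pexp2l ?leq_addl ?orbT.
Qed.

Lemma polybM f g : polyb f -> polyb g -> polyb (fun M => f M * g M).
Proof.
move=> [a [d Hf]] [b [e Hg]]; exists (a * b), (d + e) => M M0.
by rewrite expnD mulnACA; apply: leq_mul; [exact: Hf | exact: Hg].
Qed.

Lemma polybX f n : polyb f -> polyb (fun M => f M ^ n).
Proof.
move=> Hf; elim: n => [|n IH]; first exact: polyb_const.
have [a [d H]] := polybM Hf IH.
by exists a, d => M M0; rewrite expnS; exact: H.
Qed.

(** The argument [M + g M] arises under a loop: its index may be as large as the bound [g M] on the
    range. *)
Lemma polyb_comp f g : polyb f -> polyb g -> polyb (fun M => f (M + g M)).
Proof.
move=> [a [d Hf]] Hg.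
have [b [e H]] := polybX d (polybD polyb_id Hg).
exists (a * b), e => M M0; apply: leq_trans (Hf _ _) _; first by rewrite addn_gt0 M0.
by rewrite -mulnA leq_mul2l H ?orbT.
Qed.

Lemma exec_eq c s s1 s2 t : exec c s s1 t -> s1 = s2 -> exec c s s2 t.
Proof. by move=> H <-. Qed.

(** [F j] is the store when [j] rounds remain; the height of stack [i] is the loop counter. *)
Lemma exec_while k i T c (F : nat -> store) :
  (forall j, j <= k -> size (F j i) = j) ->
  (forall j, j < k -> exists2 t, t <= T & exec c (F j.+1) (F j) t) ->
  exists2 t, t <= k * (T + 2) + 1 & exec (CWhile i c) (F k) (F 0) t.
Proof.
elim: k => [|k IH] Hi Hc.
  by exists 1 => //; apply: XWhile0; apply: size0nil; apply: Hi.
have [t Ht Et] := IH (fun j Hj => Hi j (leqW Hj)) (fun j Hj => Hc j (ltnW Hj)).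
have [t1 Ht1 Et1] := Hc k (leqnn _).
exists (t1 + t + 2); first lia.
by apply: XWhileS Et1 Et; move=> E; have := Hi k.+1 (leqnn _); rewrite E.
Qed.

Ltac store_eq := apply/funext => ?; rewrite /upd;
  repeat (rewrite ?eqxx /=; match goal with |- context [?a == ?b] =>
    first [ (have -> : (a == b) = false by lia) | (let e := fresh "e" in case: (eqVneq a b) => [e|?]; [rewrite ?e|]) ] end);
  try done; try congruence.

(** Variables are de Bruijn indices and subtraction is truncated. The only loop is [ESum], whose
    range is evaluated before its body runs, so values and running times stay polynomial. *)
Inductive ex :=
| EVar of nat
| EOne
| EBit of ex
| EAdd of ex & ex
| ESub of ex & ex
| ESum of ex & ex.

Fixpoint evalx (y : seq bool) (env : seq nat) (e : ex) : nat := match e with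
  | EVar i => nth 0 env i
  | EOne => 1
  | EBit a => nth false y (evalx y env a)
  | EAdd a b => evalx y env a + evalx y env b
  | ESub a b => evalx y env a - evalx y env b
  | ESum a b => \sum_(i < evalx y env a) evalx y (nat_of_ord i :: env) b
  end.

(* Stack 1 holds the reversed input, stack 2 is a scratch stack, rho lists the
   stacks of the variables, stacks from t on are free; the value is added to acc. *)
Fixpoint cex (rho : seq nat) (t acc : nat) (e : ex) : cmd := match e with
  | EVar i => let r := nth 2 rho i in
    CSeq (CWhile r (CSeq (CPop r) (CSeq (CPush t true) (CPush acc true))))
         (CWhile t (CSeq (CPop t) (CPush r true)))
  | EOne => CPush acc true
  | EBit a => CSeq (cex rho t.+1 t a)
      (CSeq (CWhile t (CSeq (CPop t)
               (CCase 1 CSkip (CSeq (CPop 1) (CPush 2 true)) (CSeq (CPop 1) (CPush 2 false)))))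
      (CSeq (CCase 1 CSkip (CPush acc true) CSkip)
            (CWhile 2 (CCase 2 CSkip (CSeq (CPop 2) (CPush 1 true))
                                     (CSeq (CPop 2) (CPush 1 false))))))
  | EAdd a b => CSeq (cex rho t acc a) (cex rho t acc b)
  | ESub a b => CSeq (cex rho t.+1 t a) (CSeq (cex rho t.+2 t.+1 b)
      (CSeq (CWhile t.+1 (CSeq (CPop t.+1) (CPop t)))
            (CWhile t (CSeq (CPop t) (CPush acc true)))))
  | ESum a b => CSeq (cex rho t.+1 t a)
      (CWhile t (CSeq (CPop t) (cex (t :: rho) t.+1 acc b)))
  end.

(** A variable outside [rho] is looked up on stack 2; that scratch stack is empty, which agrees with
    the default value 0 in [env]. *)
Record good (rho : seq nat) (t : nat) (y : seq bool) (env : seq nat) (s : store) : Prop :=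
  Good {
    good_env : forall i, s (nth 2 rho i) = nseq (nth 0 env i) true;
    good_rho : forall r, r \in rho -> 2 < r < t;
    good_t : 2 < t;
    good_in : s 1 = y;
    good_tmp : s 2 = [::];
    good_free : forall j, t <= j -> s j = [::] }.

Definition good_acc (rho : seq nat) t acc := [&& acc < t, acc != 1, acc != 2 & acc \notin rho].

Lemma good_reg rho t y env s i : good rho t y env s -> 1 < nth 2 rho i < t.
Proof.
move=> G; case: (ltnP i (size rho)) => Hi; last by rewrite nth_default ?(good_t G).
by case/andP: (good_rho G (mem_nth 2 Hi)) => [/ltnW-> ->].
Qed.

Lemma good_acc_reg rho t acc i : good_acc rho t acc -> nth 2 rho i != acc.
Proof.
case/and4P=> _ _ n2 Hr; case: (ltnP i (size rho)) => Hi.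
  by apply: contraNneq Hr => <-; exact: mem_nth.
by rewrite nth_default // eq_sym.
Qed.

Lemma good_next rho t y env s v : good rho t y env s ->
  good rho t.+1 y env (upd s t v).
Proof.
move=> G; split.
- by move=> i; rewrite updE ltn_eqF ?(good_env G) //; have := good_reg i G; lia.
- by move=> r /(good_rho G); lia.
- by have := good_t G; lia.
- by rewrite updE ifN ?(good_in G) //; have := good_t G; lia.
- by rewrite updE ifN ?(good_tmp G) //; have := good_t G; lia.
- by move=> j Hj; rewrite updE ifN ?(good_free G) //; lia.
Qed.

Lemma good_acc_next rho t y env s : good rho t y env s -> good_acc rho t.+1 t.
Proof.
move=> G; apply/and4P; split; try by have := good_t G; lia.
by apply/negP => /(good_rho G); lia.
Qed.

Lemma good_upd rho t acc y env s v : good rho t y env s -> good_acc rho t acc ->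
  good rho t y env (upd s acc v).
Proof.
move=> G A; have /and4P[A1 A2 A3 A4] := A; split.
- by move=> i; rewrite updE ifN ?(good_env G) // (good_acc_reg _ A).
- exact: good_rho G.
- exact: good_t G.
- by rewrite updE eq_sym ifN ?(good_in G).
- by rewrite updE eq_sym ifN ?(good_tmp G).
- by move=> j Hj; rewrite updE ifN ?(good_free G) //; lia.
Qed.

Lemma good_bind rho t y env s i : good rho t y env s ->
  good (t :: rho) t.+1 y (i :: env) (upd s t (nseq i true)).
Proof.
move=> G; have [G1 G2 G3 G4 G5 G6] := good_next (nseq i true) G; split=> //.
- by case=> [|j] /=; [rewrite updE eqxx | exact: G1].
- by move=> r; rewrite inE => /orP[/eqP->|/G2] //; have := good_t G; lia.
Qed.

Lemma good_acc_bind rho t acc : good_acc rho t acc -> good_acc (t :: rho) t.+1 acc.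
Proof.
by case/and4P=> A1 A2 A3 A4; apply/and4P; split=> //; [lia | rewrite inE negb_or A4 andbT; lia].
Qed.

Definition ex_bound (e : ex) (f : nat -> nat) :=
  forall M y env, 0 < M -> size y <= M -> all (leq^~ M) env ->
    evalx y env e <= f M /\
    forall rho t acc s, good rho t y env s -> good_acc rho t acc ->
    exists2 tm, tm <= f M &
      exec (cex rho t acc e) s (upd s acc (nseq (evalx y env e) true ++ s acc)) tm.

(** Reading a unary counter destroys it. It is therefore drained onto stack [t] and the accumulator
    at the same time and then refilled from [t]. *)
Lemma ex_bound_var i : ex_bound (EVar i) (fun M => 12 * M + 2).
Proof.
move=> M y env M0 Hy He /=.
have Hv : nth 0 env i <= M.
  case: (ltnP i (size env)) => Hi; last by rewrite nth_default.
  by have /allP/(_ _ (mem_nth 0 Hi)) := He.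
split=> [|rho t acc s G A]; first lia.
set r := nth 2 rho i; set v := nth 0 env i in Hv *.
have Hr : 1 < r < t := good_reg i G.
have Hra : r != acc := good_acc_reg i A.
have /and4P[At A1 A2 _] := A.
have Hst : s t = [::] by apply: (good_free G).
have Hsr : s r = nseq v true := good_env G i.
pose F j := upd (upd (upd s r (nseq j true)) t (nseq (v - j) true))
  acc (nseq (v - j) true ++ s acc).
have [t1 Ht1 E1] : exists2 t1, t1 <= v * (5 + 2) + 1 &
    exec (CWhile r (CSeq (CPop r) (CSeq (CPush t true) (CPush acc true)))) (F v) (F 0) t1.
  apply: exec_while => [j Hj|j Hj].
    by rewrite /F !updE (negPf Hra) ifN ?eqxx ?size_nseq //; lia.
  exists 5 => //; apply: exec_eq.
    by apply: (XSeq (t1 := 1) (t2 := 4)); [exact: XPop |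
      apply: (XSeq (t1 := 2) (t2 := 2)); exact: XPush].
  have Hvj : v - j = (v - j.+1).+1 by lia.
  by rewrite /F Hvj; store_eq.
have EF : F v = s.
  rewrite /F subnn; store_eq.
pose H j := upd (upd (upd s r (nseq (v - j) true)) t (nseq j true))
  acc (nseq v true ++ s acc).
have [t2 Ht2 E2] : exists2 t2, t2 <= v * (3 + 2) + 1 &
    exec (CWhile t (CSeq (CPop t) (CPush r true))) (H v) (H 0) t2.
  apply: exec_while => [j Hj|j Hj].
    by rewrite /H !updE ifN ?eqxx ?size_nseq //; lia.
  exists 3 => //; apply: exec_eq.
    by apply: (XSeq (t1 := 1) (t2 := 2)); [exact: XPop | exact: XPush].
  have Hvj : v - j = (v - j.+1).+1 by lia.
  by rewrite /H Hvj; store_eq.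
have EFH : F 0 = H v by rewrite /F /H subn0 subnn; store_eq.
exists (t1 + t2); first lia.
rewrite EF in E1; rewrite -EFH in E2.
apply: exec_eq (XSeq E1 E2) _.
rewrite /H subn0; store_eq.
Qed.

Lemma ex_bound_one : ex_bound EOne (fun=> 2).
Proof.
move=> M y env M0 Hy He /=; split=> // rho t acc s G A.
by exists 2 => //; exact: XPush.
Qed.

Lemma ex_bound_add a b f g : ex_bound a f -> ex_bound b g ->
  ex_bound (EAdd a b) (fun M => f M + g M).
Proof.
move=> Ha Hb M y env M0 Hy He /=.
have [Va Ca] := Ha M y env M0 Hy He; have [Vb Cb] := Hb M y env M0 Hy He.
split=> [|rho t acc s G A]; first exact: leq_add.
have [t1 H1 E1] := Ca rho t acc s G A.
have [t2 H2 E2] := Cb rho t acc _ (good_upd (nseq (evalx y env a) true ++ s acc) G A) A.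
exists (t1 + t2); first exact: leq_add.
apply: exec_eq (XSeq E1 E2) _.
by rewrite updE eqxx catA -nseqD addnC; store_eq.
Qed.

Lemma good_weak rho t y env s : good rho t y env s -> good rho t.+1 y env s.
Proof.
move=> G; have := good_next (s t) G.
by rewrite (_ : upd s t (s t) = s) //; store_eq.
Qed.

(** The input is unwound onto the scratch stack up to the wanted position, its top is inspected, and
    everything is wound back. Past the end the stack is empty, which gives 0. *)
Lemma ex_bound_bit a f : ex_bound a f -> ex_bound (EBit a) (fun M => 9 * f M + 7 * M + 11).
Proof.
move=> Ha M y env M0 Hy He /=; have [Va Ca] := Ha M y env M0 Hy He.
split=> [|rho t acc s G A]; first by case: (nth false y _); lia.
have [t1 H1 E1] := Ca rho t.+1 t s (good_weak G) (good_acc_next G).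
set v := evalx y env a in Va E1 *.
have Hst : s t = [::] by apply: (good_free G).
have t2 := good_t G; have /and4P[At A1 A2 _] := A.
have s1 := good_in G; have s2 := good_tmp G.
pose F j := upd (upd (upd s 1 (drop (v - j) y)) 2 (rev (take (v - j) y))) t (nseq j true).
have EF : upd s t (nseq v true ++ s t) = F v.
  by rewrite /F subnn drop0 take0 Hst cats0; store_eq.
have [t3 H3 E3] : exists2 t3, t3 <= v * (6 + 2) + 1 & exec (CWhile t (CSeq (CPop t)
   (CCase 1 CSkip (CSeq (CPop 1) (CPush 2 true)) (CSeq (CPop 1) (CPush 2 false)))))
   (F v) (F 0) t3.
  apply: exec_while => [j _|j Hj]; first by rewrite /F updE eqxx size_nseq.
  have Hvj : v - j = (v - j.+1).+1 by lia.
  set k := v - j.+1 in Hvj.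
  have Ek : upd (F j.+1) t (behead (F j.+1 t)) 1 = drop k y.
    by rewrite /F !updE; do !(rewrite ifN; last lia); rewrite ?eqxx.
  case: (ltnP k (size y)) => Hk.
    exists 6 => //; case Eb : (nth false y k); apply: exec_eq;
      [apply: (XSeq (t1 := 1) (t2 := 5)); first exact: XPop;
       apply: (XCase (t := 3)); rewrite Ek (drop_nth false) // Eb;
       apply: (XSeq (t1 := 1) (t2 := 2)); [exact: XPop | exact: XPush]
      |rewrite /F Hvj (take_nth false) // rev_rcons (drop_nth false Hk) Eb; store_eq
      |apply: (XSeq (t1 := 1) (t2 := 5)); first exact: XPop;
       apply: (XCase (t := 3)); rewrite Ek (drop_nth false) // Eb;
       apply: (XSeq (t1 := 1) (t2 := 2)); [exact: XPop | exact: XPush]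
      |rewrite /F Hvj (take_nth false) // rev_rcons (drop_nth false Hk) Eb; store_eq].
  exists 3 => //; apply: exec_eq.
    apply: (XSeq (t1 := 1) (t2 := 2)); first exact: XPop.
    by apply: (XCase (t := 0)); rewrite Ek drop_oversize //; exact: XSkip.
  by rewrite /F Hvj !(take_oversize (leqW Hk)) ?(take_oversize Hk)
    ?(drop_oversize Hk) ?(drop_oversize (leqW Hk)); store_eq.
set w := nseq (nth false y v) true ++ s acc.
have F01 : F 0 1 = drop v y by rewrite /F !updE subn0; do !(rewrite ifN; last lia); rewrite ?eqxx.
have [t4 H4 E4] : exists2 t4, t4 <= 4 &
    exec (CCase 1 CSkip (CPush acc true) CSkip) (F 0) (upd (F 0) acc w) t4.
  have Fa : F 0 acc = s acc by rewrite /F !updE; do !(rewrite ifN; last lia).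
  case: (ltnP v (size y)) => Hv; last first.
    exists 2 => //; apply: exec_eq (XCase (t := 0) (s1 := F 0) _) _.
      by rewrite F01 drop_oversize //; exact: XSkip.
    by rewrite /w nth_default //= -Fa; store_eq.
  case Eb : (nth false y v).
    exists 4 => //; apply: exec_eq (XCase (t := 2) _) _; last by rewrite /w Eb -Fa.
    by rewrite F01 (drop_nth false) // Eb; exact: XPush.
  exists 2 => //; apply: exec_eq (XCase (t := 0) (s1 := F 0) _) _.
    by rewrite F01 (drop_nth false) // Eb; exact: XSkip.
  by rewrite /w Eb /= -Fa; store_eq.
pose K := size (take v y).
have Ky : K <= size y by rewrite /K size_take; case: ltnP => //; lia.
pose H j := upd (upd (upd (upd s t [::]) 1 (drop j y)) 2 (rev (take j y))) acc w.
have EH : upd (F 0) acc w = H K.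
  rewrite /F /H subn0.
  have -> : take v y = take K y.
    by rewrite /K size_take; case: ltnP => // Hv; rewrite take_size take_oversize.
  have -> : drop v y = drop K y.
    by rewrite /K size_take; case: ltnP => // Hv; rewrite drop_size drop_oversize.
  store_eq.
have [t5 H5 E5] : exists2 t5, t5 <= K * (5 + 2) + 1 & exec (CWhile 2 (CCase 2 CSkip
     (CSeq (CPop 2) (CPush 1 true)) (CSeq (CPop 2) (CPush 1 false)))) (H K) (H 0) t5.
  apply: exec_while => [j Hj|j Hj].
    rewrite /H !updE ifN; last by lia.
    by rewrite ?eqxx size_rev size_take; case: ltnP => //; lia.
  have Hjy : j < size y by lia.
  have Ej : H j.+1 2 = nth false y j :: rev (take j y).
    by rewrite /H !updE ifN; [rewrite ?eqxx (take_nth false) // rev_rcons | lia].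
  exists 5 => //; case Eb : (nth false y j); apply: exec_eq;
    [apply: (XCase (t := 3)); rewrite Ej Eb;
     apply: (XSeq (t1 := 1) (t2 := 2)); [exact: XPop | exact: XPush]
    |rewrite /H (take_nth false) // rev_rcons (drop_nth false Hjy) Eb; store_eq
    |apply: (XCase (t := 3)); rewrite Ej Eb;
     apply: (XSeq (t1 := 1) (t2 := 2)); [exact: XPop | exact: XPush]
    |rewrite /H (take_nth false) // rev_rcons (drop_nth false Hjy) Eb; store_eq].
rewrite EH in E4.
have HvM : K <= M by lia.
rewrite -EF in E3.
exists (t1 + (t3 + (t4 + t5))); first lia.
apply: exec_eq (XSeq E1 (XSeq E3 (XSeq E4 E5))) _.
rewrite /H drop0 take0 /=; store_eq.
Qed.

Lemma ex_bound_sub a b f g : ex_bound a f -> ex_bound b g ->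
  ex_bound (ESub a b) (fun M => 6 * f M + 5 * g M + 2).
Proof.
move=> Ha Hb M y env M0 Hy He /=.
have [Va Ca] := Ha M y env M0 Hy He; have [Vb Cb] := Hb M y env M0 Hy He.
split=> [|rho t acc s G A]; first lia.
set v := evalx y env a in Va Ca *; set w := evalx y env b in Vb Cb *.
have [t1 H1 E1] := Ca rho t.+1 t s (good_weak G) (good_acc_next G).
have G1 : good rho t.+1 y env (upd s t (nseq v true ++ s t)) by exact: good_next.
have [t2 H2 E2] := Cb rho t.+2 t.+1 _ (good_weak G1) (good_acc_next G1).
have Hst : s t = [::] by apply: (good_free G).
have Hst1 : s t.+1 = [::] by apply: (good_free G).
have t3 := good_t G; have /and4P[At A1 A2 _] := A.
pose F j := upd (upd s t (nseq (v - (w - j)) true)) t.+1 (nseq j true).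
have EF : upd (upd s t (nseq v true ++ s t)) t.+1
    (nseq w true ++ upd s t (nseq v true ++ s t) t.+1) = F w.
  rewrite /F subnn subn0 updE Hst !cats0 ifN ?Hst1 ?cats0 //; lia.
rewrite EF in E2.
have [t4 H4 E4] : exists2 t4, t4 <= w * (2 + 2) + 1 &
    exec (CWhile t.+1 (CSeq (CPop t.+1) (CPop t))) (F w) (F 0) t4.
  apply: exec_while => [j _|j Hj]; first by rewrite /F updE eqxx size_nseq.
  exists 2 => //; apply: exec_eq.
    by apply: (XSeq (t1 := 1) (t2 := 1)); exact: XPop.
  rewrite /F (_ : v - (w - j) = (v - (w - j.+1)).-1); last lia.
  have Eb n : behead (nseq n true) = nseq n.-1 true by case: n.
  rewrite !updE !eqxx /= ifN ?eqxx ?Eb; last lia.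
  by store_eq.
pose u := v - w.
pose H j := upd (upd s t (nseq j true)) acc (nseq (u - j) true ++ s acc).
have EH : F 0 = H u by rewrite /F /H subn0 subnn; store_eq.
have [t5 H5 E5] : exists2 t5, t5 <= u * (3 + 2) + 1 &
    exec (CWhile t (CSeq (CPop t) (CPush acc true))) (H u) (H 0) t5.
  apply: exec_while => [j _|j Hj].
    by rewrite /H !updE ifN ?eqxx ?size_nseq //; lia.
  exists 3 => //; apply: exec_eq.
    by apply: (XSeq (t1 := 1) (t2 := 2)); [exact: XPop | exact: XPush].
  have -> : H j = upd (upd s t (nseq j true)) acc (true :: nseq (u - j.+1) true ++ s acc).
    by rewrite /H (_ : u - j = (u - j.+1).+1) //; lia.
  rewrite /H; store_eq.
rewrite EH in E4.
exists (t1 + (t2 + (t4 + t5))); first by rewrite /u in H5; lia.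
apply: exec_eq (XSeq E1 (XSeq E2 (XSeq E4 E5))) _.
rewrite /H subn0; store_eq.
Qed.

(** The stack holding the range serves both as loop counter and as bound variable: after each pop it
    contains the current index, so the indices run downwards. *)
Lemma ex_bound_sum a b f g : ex_bound a f -> ex_bound b g ->
  ex_bound (ESum a b) (fun M => f M + f M * (g (M + f M) + 3) + 1).
Proof.
move=> Ha Hb M y env M0 Hy He /=; have [Va Ca] := Ha M y env M0 Hy He.
set v := evalx y env a in Va Ca *.
have Hbi i : i < v -> evalx y (i :: env) b <= g (M + f M) /\
   forall rho t acc s, good rho t y (i :: env) s -> good_acc rho t acc ->
    exists2 tm, tm <= g (M + f M) &
      exec (cex rho t acc b) s (upd s acc (nseq (evalx y (i :: env) b) true ++ s acc)) tm.
  move=> Hi; apply: Hb; [lia | lia | rewrite /= (leq_trans (ltnW Hi)) ?(leq_trans Va) ?leq_addl //=].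
  by apply/allP => z /(allP He) /=; lia.
split=> [|rho t acc s G A].
  apply: (@leq_trans (\sum_(i < v) g (M + f M))).
    by apply: leq_sum => i _; case: (Hbi i (ltn_ord i)).
  by rewrite sum_nat_const card_ord; nia.
have [t1 H1 E1] := Ca rho t.+1 t s (good_weak G) (good_acc_next G).
have Hst : s t = [::] by apply: (good_free G).
have t3 := good_t G; have /and4P[At A1 A2 _] := A.
pose S j := \sum_(j <= i < v) evalx y (i :: env) b.
pose F j := upd (upd s t (nseq j true)) acc (nseq (S j) true ++ s acc).
have EF : upd s t (nseq v true ++ s t) = F v.
  by rewrite /F /S big_geq // Hst cats0; store_eq.
have [t4 H4 E4] : exists2 t4, t4 <= v * ((g (M + f M) + 1) + 2) + 1 &
    exec (CWhile t (CSeq (CPop t) (cex (t :: rho) t.+1 acc b))) (F v) (F 0) t4.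
  apply: exec_while => [j _|j Hj].
    by rewrite /F !updE ifN ?eqxx ?size_nseq //; lia.
  have [_ /(_ (t :: rho) t.+1 acc (upd (upd s acc (nseq (S j.+1) true ++ s acc)) t (nseq j true)))] := Hbi j Hj.
  case; first by apply: good_bind; apply: good_upd.
    exact: good_acc_bind.
  move=> tm Htm Etm; exists (1 + tm); first lia.
  have EP : exec (CPop t) (F j.+1) (upd (upd s acc (nseq (S j.+1) true ++ s acc)) t (nseq j true)) 1.
    by apply: exec_eq (XPop _ _) _; rewrite /F; store_eq.
  apply: exec_eq (XSeq EP Etm) _.
  rewrite /F /S (big_ltn Hj) nseqD -catA -/(S j.+1).
  have -> : upd (upd s acc (nseq (S j.+1) true ++ s acc)) t (nseq j true) acc =
     nseq (S j.+1) true ++ s acc by rewrite !updE ifN ?eqxx //; lia.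
  by store_eq.
rewrite EF in E1.
exists (t1 + t4); first nia.
apply: exec_eq (XSeq E1 E4) _.
rewrite /F /S big_mkord; store_eq.
Qed.

Lemma ex_boundP e : exists2 f, polyb f & ex_bound e f.
Proof.
elim: e => [i||a [f Pf Hf]|a [f Pf Hf] b [g Pg Hg]|a [f Pf Hf] b [g Pg Hg]|a [f Pf Hf] b [g Pg Hg]].
- eexists; last exact: ex_bound_var.
  by apply: polybD (polyb_const _); apply: polybM (polyb_const _) polyb_id.
- eexists; last exact: ex_bound_one.
  exact: polyb_const.
- eexists; last exact: ex_bound_bit Hf.
  apply: polybD (polyb_const _).
  by apply: polybD; apply: polybM (polyb_const _) _ => //; exact: polyb_id.
- eexists; last exact: ex_bound_add Hf Hg.
  exact: polybD.
- eexists; last exact: ex_bound_sub Hf Hg.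
  apply: polybD (polyb_const _).
  by apply: polybD; apply: polybM (polyb_const _) _.
- eexists; last exact: ex_bound_sum Hf Hg.
  apply: polybD (polyb_const _).
  apply: polybD => //; apply: polybM => //; apply: polybD (polyb_const _).
  exact: polyb_comp.
Qed.

Inductive sx :=
| SNil
| SBit of bool
| SCat of sx & sx
| SFor of ex & sx
| SIf of ex & sx & sx.

Fixpoint sem (y : seq bool) (env : seq nat) (S : sx) : seq bool := match S with
  | SNil => [::]
  | SBit b => [:: b]
  | SCat a b => sem y env a ++ sem y env b
  | SFor e a => flatten [seq sem y (i :: env) a | i <- iota 0 (evalx y env e)]
  | SIf e a b => if 0 < evalx y env e then sem y env a else sem y env b
  end.

(** Output is pushed on top of stack 0, so a word is produced from its last part to its first. This
    fits the loops, whose indices decrease. *)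
Fixpoint csx (rho : seq nat) (t : nat) (S : sx) : cmd := match S with
  | SNil => CSkip
  | SBit b => CPush 0 b
  | SCat a b => CSeq (csx rho t b) (csx rho t a)
  | SFor e a => CSeq (cex rho t.+1 t e) (CWhile t (CSeq (CPop t) (csx (t :: rho) t.+1 a)))
  | SIf e a b => CSeq (cex rho t.+1 t e)
      (CCase t (csx rho t b) (CSeq (CWhile t (CPop t)) (csx rho t a)) CSkip)
  end.

Definition sx_bound (S : sx) (f : nat -> nat) :=
  forall M y env, 0 < M -> size y <= M -> all (leq^~ M) env ->
    forall rho t s, good rho t y env s ->
    exists2 tm, tm <= f M & exec (csx rho t S) s (upd s 0 (sem y env S ++ s 0)) tm.

Lemma good_acc0 rho t y env s : good rho t y env s -> good_acc rho t 0.
Proof.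
move=> G; have t2 := good_t G; apply/and4P; split=> //; first lia.
by apply/negP => /(good_rho G).
Qed.

Lemma sx_bound_for e S f g : ex_bound e f -> sx_bound S g ->
  sx_bound (SFor e S) (fun M => f M + f M * (g (M + f M) + 3) + 1).
Proof.
move=> Ha Hb M y env M0 Hy He /=; have [Va Ca] := Ha M y env M0 Hy He.
set v := evalx y env e in Va Ca *.
move=> rho t s G.
have [t1 H1 E1] := Ca rho t.+1 t s (good_weak G) (good_acc_next G).
have Hst : s t = [::] by apply: (good_free G).
have t3 := good_t G.
pose W j := flatten [seq sem y (i :: env) S | i <- iota j (v - j)].
pose F j := upd (upd s t (nseq j true)) 0 (W j ++ s 0).
have EF : upd s t (nseq v true ++ s t) = F v.
  by rewrite /F /W subnn Hst cats0 /=; store_eq.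
have [t4 H4 E4] : exists2 t4, t4 <= v * ((g (M + f M) + 1) + 2) + 1 &
    exec (CWhile t (CSeq (CPop t) (csx (t :: rho) t.+1 S))) (F v) (F 0) t4.
  apply: exec_while => [j _|j Hj].
    by rewrite /F !updE ifN ?eqxx ?size_nseq //; lia.
  have A1 : 0 < M + f M by lia.
  have A2 : size y <= M + f M by lia.
  have A3 : all (leq^~ (M + f M)) (j :: env).
    rewrite /= (leq_trans (ltnW Hj)) ?(leq_trans Va) ?leq_addl //=.
    by apply/allP => z /(allP He) /=; lia.
  have [|tm Htm Etm] := Hb _ y (j :: env) A1 A2 A3 (t :: rho) t.+1
    (upd (upd s 0 (W j.+1 ++ s 0)) t (nseq j true)).
    by apply: good_bind; apply: good_upd (good_acc0 G).
  exists (1 + tm); first lia.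
  have EP : exec (CPop t) (F j.+1) (upd (upd s 0 (W j.+1 ++ s 0)) t (nseq j true)) 1.
    by apply: exec_eq (XPop _ _) _; rewrite /F; store_eq.
  apply: exec_eq (XSeq EP Etm) _.
  have EW : W j = sem y (j :: env) S ++ W j.+1.
    by rewrite /W (_ : v - j = (v - j.+1).+1) //; lia.
  have -> : upd (upd s 0 (W j.+1 ++ s 0)) t (nseq j true) 0 = W j.+1 ++ s 0.
    by rewrite !updE ifN ?eqxx //; lia.
  by rewrite /F EW -catA; store_eq.
rewrite EF in E1.
exists (t1 + t4); first nia.
apply: exec_eq (XSeq E1 E4) _.
rewrite /F /W subn0; store_eq.
Qed.

Lemma sx_bound_if e a b f g h : ex_bound e f -> sx_bound a g -> sx_bound b h ->
  sx_bound (SIf e a b) (fun M => 4 * f M + g M + h M + 3).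
Proof.
move=> He Ha Hb M y env M0 Hy Hen rho t s G /=; have [Va Ca] := He M y env M0 Hy Hen.
have [t1 H1 E1] := Ca rho t.+1 t s (good_weak G) (good_acc_next G).
have Hst : s t = [::] by apply: (good_free G).
rewrite Hst cats0 in E1.
set v := evalx y env e in Va Ca E1 *.
have Est : upd s t [::] = s by store_eq.
case: posnP => Hv.
  have [t2 H2 E2] := Hb M y env M0 Hy Hen rho t s G.
  rewrite Hv Est in E1.
  exists (t1 + (t2 + 2)); first lia.
  by apply: XSeq E1 _; apply: XCase; rewrite Hst.
have [t2 H2 E2] := Ha M y env M0 Hy Hen rho t s G.
pose F j := upd s t (nseq j true).
have [t4 H4 E4] : exists2 t4, t4 <= v * (1 + 2) + 1 & exec (CWhile t (CPop t)) (F v) (F 0) t4.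
  apply: exec_while => [j _|j Hj]; first by rewrite /F updE eqxx size_nseq.
  by exists 1 => //; apply: exec_eq (XPop _ _) _; rewrite /F; store_eq.
exists (t1 + ((t4 + t2) + 2)); first lia.
apply: XSeq E1 _; apply: XCase.
rewrite updE eqxx; case: v Hv {Va Ca H4} E4 => // v _ E4 /=.
by apply: XSeq E4 _; rewrite /F Est.
Qed.

Lemma sx_boundP S : exists2 f, polyb f & sx_bound S f.
Proof.
elim: S => [|b|a [f Pf Hf] b [g Pg Hg]|e a [g Pg Hg]|e a [f Pf Hf] b [g Pg Hg]].
- exists (fun=> 0); first exact: polyb_const.
  move=> M y env _ _ _ rho t s G; exists 0 => //=; apply: exec_eq (XSkip _) _; store_eq.
- exists (fun=> 2); first exact: polyb_const.
  by move=> M y env _ _ _ rho t s G; exists 2 => //=; exact: XPush.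
- exists (fun M => f M + g M); first exact: polybD.
  move=> M y env M0 Hy He rho t s G /=.
  have [t2 H2 E2] := Hg M y env M0 Hy He rho t s G.
  have [t1 H1 E1] := Hf M y env M0 Hy He rho t _
    (good_upd (sem y env b ++ s 0) G (good_acc0 G)).
  exists (t2 + t1); first lia.
  apply: exec_eq (XSeq E2 E1) _; rewrite updE eqxx catA; store_eq.
- have [f Pf Hf] := ex_boundP e; eexists; last exact: sx_bound_for Hf Hg.
  apply: polybD (polyb_const _).
  apply: polybD => //; apply: polybM => //; apply: polybD (polyb_const _).
  exact: polyb_comp.
- have [h Ph Hh] := ex_boundP e; eexists; last exact: sx_bound_if Hh Hf Hg.
  apply: polybD (polyb_const _); apply: polybD => //; apply: polybD => //.
  exact: polybM (polyb_const _) Ph.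
Qed.

Definition move_stack i j (c : cmd) := CWhile i
  (CCase i CSkip (CSeq (CPop i) (CSeq (CPush j true) c)) (CSeq (CPop i) (CSeq (CPush j false) c))).

(** Stack 0 must be free for the output. The input goes to stack 1, through stack 2 to keep its
    order, while its length is counted in unary on stack 3, the stack of the only initial
    variable. *)
Lemma sx_polytime (S : sx) : polytime (fun x => sem x [:: size x] S).
Proof.
have [f [a [d Pf]] Hf] := sx_boundP S.
pose pre := CSeq (move_stack 0 2 CSkip) (move_stack 2 1 (CPush 3 true)).
have Hpre x : exists2 t, t <= 20 * (size x).+1 &
    exec pre (upd (fun=> [::]) 0 x)
      (upd (upd (fun=> [::]) 1 x) 3 (nseq (size x) true)) t.
  pose n := size x.
  pose F j := upd (upd (fun=> [::]) 0 (drop (n - j) x)) 2 (rev (take (n - j) x)).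
  have [t1 H1 E1] : exists2 t1, t1 <= n * (5 + 2) + 1 &
      exec (move_stack 0 2 CSkip) (F n) (F 0) t1.
    apply: exec_while => [j Hj|j Hj]; first by rewrite /F !updE /= size_drop -/n; lia.
    have Hk : n - j.+1 < size x by rewrite -/n; lia.
    have Hjn : n - j = (n - j.+1).+1 by lia.
    have Ek : F j.+1 0 = nth false x (n - j.+1) :: drop (n - j) x.
      by rewrite /F !updE /= (drop_nth false) // Hjn.
    exists 5 => //; case Eb : (nth false x (n - j.+1)); apply: exec_eq;
      [apply: (XCase (t := 3)); rewrite Ek Eb;
       apply: (XSeq (t1 := 1) (t2 := 2)); first exact: XPop;
       apply: (XSeq (t1 := 2) (t2 := 0)); [exact: XPush | exact: XSkip]
      |rewrite /F Hjn (take_nth false) // rev_rcons (drop_nth false Hk) Eb; store_eq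
      |apply: (XCase (t := 3)); rewrite Ek Eb;
       apply: (XSeq (t1 := 1) (t2 := 2)); first exact: XPop;
       apply: (XSeq (t1 := 2) (t2 := 0)); [exact: XPush | exact: XSkip]
      |rewrite /F Hjn (take_nth false) // rev_rcons (drop_nth false Hk) Eb; store_eq].
  pose H j := upd (upd (upd (fun=> [::]) 2 (rev (take j x))) 1 (drop j x)) 3
    (nseq (n - j) true).
  have [t2 H2 E2] : exists2 t2, t2 <= n * (7 + 2) + 1 &
      exec (move_stack 2 1 (CPush 3 true)) (H n) (H 0) t2.
    apply: exec_while => [j Hj|j Hj].
      by rewrite /H !updE /= size_rev size_take -/n; case: ltnP => //; lia.
    have Hjn : n - j = (n - j.+1).+1 by lia.
    have Ek : H j.+1 2 = nth false x j :: rev (take j x).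
      by rewrite /H !updE /= (take_nth false) // rev_rcons.
    exists 7 => //; case Eb : (nth false x j); apply: exec_eq;
      [apply: (XCase (t := 5)); rewrite Ek Eb;
       apply: (XSeq (t1 := 1) (t2 := 4)); first exact: XPop;
       apply: (XSeq (t1 := 2) (t2 := 2)); exact: XPush
      |rewrite /H Hjn (take_nth false) // rev_rcons (drop_nth false Hj) Eb; store_eq
      |apply: (XCase (t := 5)); rewrite Ek Eb;
       apply: (XSeq (t1 := 1) (t2 := 4)); first exact: XPop;
       apply: (XSeq (t1 := 2) (t2 := 2)); exact: XPush
      |rewrite /H Hjn (take_nth false) // rev_rcons (drop_nth false Hj) Eb; store_eq].
  have EF : F n = upd (fun=> [::]) 0 x.
    by rewrite /F subnn drop0 take0; store_eq.
  have EFH : F 0 = H n.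
    by rewrite /F /H subn0 subnn /n drop_size take_size; store_eq.
  rewrite EFH EF in E1; exists (t1 + t2); first lia.
  by apply: exec_eq (XSeq E1 E2) _; rewrite /H take0 drop0 subn0; store_eq.
apply: (@exec_polytime _ (CSeq pre (csx [:: 3] 4 S)) (20 + a) d.+1) => x.
have [t1 H1 E1] := Hpre x.
have [||||t2 H2 E2] := Hf (size x).+1 x [:: size x] _ _ _ [:: 3] 4
   (upd (upd (fun=> [::]) 1 x) 3 (nseq (size x) true)) => //=.
- by rewrite leqnSn.
- split=> //; first by case=> [|i] //=; rewrite !nth_nil.
  + by move=> r; rewrite inE => /eqP->.
  + by move=> j Hj; rewrite !updE !ifN //; lia.
exists (upd (upd (upd (fun=> [::]) 1 x) 3 (nseq (size x) true)) 0
  (sem x [:: size x] S ++ [::])), (t1 + t2); split.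
- exact: XSeq E1 E2.
- by rewrite updE eqxx cats0.
have := Pf (size x).+1 isT.
have : (size x).+1 <= (size x).+1 ^ d.+1 by rewrite -{1}[(size x).+1]expn1 leq_pexp2l.
have : (size x).+1 ^ d <= (size x).+1 ^ d.+1 by rewrite leq_pexp2l.
nia.
Qed.

(** * Definable functions *)

Definition def (F : seq bool -> seq nat -> nat) :=
  exists e, forall x env, evalx x env e = F x env.
Definition bdef (P : seq bool -> seq nat -> bool) := def (fun x env => nat_of_bool (P x env)).
Definition sdef (F : seq bool -> seq nat -> seq bool) :=
  exists S, forall x env, sem x env S = F x env.

Fixpoint ren (r : nat -> nat) (e : ex) : ex := match e with
  | EVar i => EVar (r i)
  | EOne => EOne
  | EBit a => EBit (ren r a)
  | EAdd a b => EAdd (ren r a) (ren r b)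
  | ESub a b => ESub (ren r a) (ren r b)
  | ESum a b => ESum (ren r a) (ren (fun i => if i is j.+1 then (r j).+1 else 0) b)
  end.

Lemma evalx_ren e r x env env' : (forall i, nth 0 env' i = nth 0 env (r i)) ->
  evalx x env (ren r e) = evalx x env' e.
Proof.
elim: e r env env' => //= [a IHa|a IHa b IHb|a IHa b IHb|a IHa b IHb] r env env' H.
- by rewrite (IHa _ _ _ H).
- by rewrite (IHa _ _ _ H) (IHb _ _ _ H).
- by rewrite (IHa _ _ _ H) (IHb _ _ _ H).
- rewrite (IHa _ _ _ H); apply: eq_bigr => i _.
  by rewrite (IHb _ _ (nat_of_ord i :: env')) // => -[].
Qed.

Lemma def_behead F : def F -> def (fun x e => F x (behead e)).
Proof.
case=> e He; exists (ren S e) => x env.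
by rewrite -He; apply: evalx_ren => i; rewrite nth_behead.
Qed.

(** Weakening below one binder. It serves the offsets inside a loop: a sum over the earlier indices
    binds a new index and forgets the current one. *)
Lemma def_skip F : def F -> def (fun x e => F x (head 0 e :: behead (behead e))).
Proof.
case=> e He; exists (ren (fun i => if i is j.+1 then j.+2 else 0) e) => x env.
rewrite -He; apply: evalx_ren => -[|i] /=; first by rewrite nth0.
by rewrite !nth_behead.
Qed.

Lemma def_head n : def (fun x e => head 0 (iter n behead e)).
Proof.
exists (EVar n) => x env; change (nth 0 env n = head 0 (iter n behead env)).
by elim: n env => [|n IH] env; [rewrite -nth0 | rewrite iterSr -IH nth_behead].
Qed.

Lemma def1 : def (fun _ _ => 1). Proof. by exists EOne. Qed.

Lemma defD F G : def F -> def G -> def (fun x e => F x e + G x e).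
Proof. by case=> a Ha [b Hb]; exists (EAdd a b) => x env /=; rewrite Ha Hb. Qed.

Lemma defB F G : def F -> def G -> def (fun x e => F x e - G x e).
Proof. by case=> a Ha [b Hb]; exists (ESub a b) => x env /=; rewrite Ha Hb. Qed.

Lemma def_sum F G : def F -> def (fun x e => G x (behead e) (head 0 e)) ->
  def (fun x e => \sum_(i < F x e) G x e i).
Proof.
by case=> a Ha [b Hb]; exists (ESum a b) => x env /=; rewrite Ha; apply: eq_bigr => i _; rewrite Hb.
Qed.

(** A plain function in place of the big operator, so that the pattern matching of [def_step]
    recognizes bounded sums. *)
Definition nsum (n : nat) (f : nat -> nat) := \sum_(i < n) f i.

Lemma def_nsum F G : def F -> def (fun x e => G x (behead e) (head 0 e)) ->
  def (fun x e => nsum (F x e) (G x e)).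
Proof. exact: def_sum. Qed.

Lemma def_const c : def (fun _ _ => c).
Proof.
elim: c => [|c IH]; last by have [e He] := defD def1 IH; exists e => x env; rewrite He add1n.
by have [e He] := defB def1 def1; exists e.
Qed.

Lemma defM F G : def F -> def G -> def (fun x e => F x e * G x e).
Proof.
move=> HF HG; have [e He] := def_sum (G := fun x e _ => G x e) HF (def_behead HG).
by exists e => x env; rewrite He sum_nat_const card_ord.
Qed.

Lemma defX F n : def F -> def (fun x e => F x e ^ n).
Proof.
move=> HF; elim: n => [|n IH]; first exact: def_const.
by have [e He] := defM HF IH; exists e => x env; rewrite He expnS.
Qed.

Lemma defS F : def F -> def (fun x e => (F x e).+1).
Proof. by move=> /(defD def1)[e He]; exists e => x env; rewrite He. Qed.

Lemma bdef_bit F : def F -> bdef (fun x e => nth false x (F x e)).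
Proof. by case=> e He; exists (EBit e) => x env /=; rewrite He. Qed.

Lemma bdef_neg P : bdef P -> bdef (fun x e => ~~ P x e).
Proof. by move=> /(defB def1)[e He]; exists e => x env; rewrite He; case: (P x env). Qed.

Lemma bdef_pos F : def F -> bdef (fun x e => 0 < F x e).
Proof.
move=> /(defB def1)/(defB def1)[e He]; exists e => x env; rewrite He.
by case: (F x env).
Qed.

Lemma bdef_and P Q : bdef P -> bdef Q -> bdef (fun x e => P x e && Q x e).
Proof. by move=> HP HQ; have [e He] := defM HP HQ; exists e => x env; rewrite He mulnb. Qed.

Lemma bdef_or P Q : bdef P -> bdef Q -> bdef (fun x e => P x e || Q x e).
Proof.
move=> HP HQ; have [e He] := bdef_neg (bdef_and (bdef_neg HP) (bdef_neg HQ)).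
by exists e => x env; rewrite He negb_and !negbK.
Qed.

Lemma bdef_imply P Q : bdef P -> bdef Q -> bdef (fun x e => P x e ==> Q x e).
Proof.
move=> HP HQ; have [e He] := bdef_or (bdef_neg HP) HQ.
by exists e => x env; rewrite He implybE.
Qed.

Lemma bdef_leq F G : def F -> def G -> bdef (fun x e => F x e <= G x e).
Proof.
move=> HF HG; have [e He] := bdef_neg (bdef_pos (defB HF HG)).
by exists e => x env; rewrite He subn_gt0 -leqNgt.
Qed.

Lemma bdef_eq F G : def F -> def G -> bdef (fun x e => F x e == G x e).
Proof.
move=> HF HG; have [e He] := bdef_and (bdef_leq HF HG) (bdef_leq HG HF).
by exists e => x env; rewrite He eqn_leq.
Qed.

Lemma bdef_eqb P Q : bdef P -> bdef Q -> bdef (fun x e => P x e == Q x e).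
Proof.
move=> HP HQ; have [e He] := bdef_eq HP HQ.
by exists e => x env; rewrite He; case: (P x env); case: (Q x env).
Qed.

Lemma def_if P F G : bdef P -> def F -> def G -> def (fun x e => if P x e then F x e else G x e).
Proof.
move=> HP HF HG; have [e He] := defD (defM HP HF) (defM (bdef_neg HP) HG).
by exists e => x env; rewrite He; case: (P x env); rewrite ?mul1n ?mul0n ?addn0.
Qed.

Lemma bdef_all F P : def F -> bdef (fun x e => P x (behead e) (head 0 e)) ->
  bdef (fun x e => all (P x e) (iota 0 (F x e))).
Proof.
move=> HF HP.
have [e He] := bdef_eq (def_sum (G := fun x e i => nat_of_bool (~~ P x e i)) HF (bdef_neg HP))
  (def_const 0).
exists e => x env; rewrite He; congr nat_of_bool.
apply/eqP/allP => [H i|H].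
  rewrite mem_iota add0n => /andP[_ Hi].
  by apply/negPn/negP => Pi; have := H; rewrite (bigD1 (Ordinal Hi)) //= Pi.
by apply: big1 => i _; rewrite H // mem_iota add0n leq0n ltn_ord.
Qed.

Lemma bdef_has F P : def F -> bdef (fun x e => P x (behead e) (head 0 e)) ->
  bdef (fun x e => has (P x e) (iota 0 (F x e))).
Proof.
move=> HF HP.
have [e He] := bdef_neg (bdef_all (P := fun x e i => ~~ P x e i) HF (bdef_neg HP)).
by exists e => x env; rewrite He -has_predC; congr nat_of_bool; apply: eq_has => i /=; rewrite negbK.
Qed.

Lemma sdef_nil : sdef (fun _ _ => [::]). Proof. by exists SNil. Qed.

Lemma sdef_bit P : bdef P -> sdef (fun x e => [:: P x e]).
Proof.
case=> e He; exists (SIf e (SBit true) (SBit false)) => x env /=.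
by rewrite He; case: (P x env).
Qed.

Lemma sdef_cat F G : sdef F -> sdef G -> sdef (fun x e => F x e ++ G x e).
Proof. by case=> a Ha [b Hb]; exists (SCat a b) => x env /=; rewrite Ha Hb. Qed.

Lemma sdef_if P F G : bdef P -> sdef F -> sdef G ->
  sdef (fun x e => if P x e then F x e else G x e).
Proof.
case=> e He [a Ha] [b Hb]; exists (SIf e a b) => x env /=.
by rewrite He Ha Hb; case: (P x env).
Qed.

Lemma sdef_for F G : def F -> sdef (fun x e => G x (behead e) (head 0 e)) ->
  sdef (fun x e => flatten [seq G x e i | i <- iota 0 (F x e)]).
Proof.
case=> a Ha [b Hb]; exists (SFor a b) => x env /=; rewrite Ha.
by congr flatten; apply: eq_map => i; rewrite Hb.
Qed.

Lemma sdef_ext F G : F =2 G -> sdef F -> sdef G.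
Proof. by move=> E [S HS]; exists S => x env; rewrite HS E. Qed.

Lemma def_ext F G : F =2 G -> def F -> def G.
Proof. by move=> E [S HS]; exists S => x env; rewrite HS E. Qed.

Lemma sdef_code_nat F : def F -> sdef (fun x e => code_nat (F x e)).
Proof.
move=> HF; have HG : sdef (fun (_ : seq bool) (e : seq nat) => [:: true]) by exists (SBit true).
apply: sdef_ext (sdef_cat (sdef_for (G := fun _ _ _ => [:: true]) HF HG)
  (ex_intro _ (SBit false) (fun _ _ => erefl))) => x env /=.
rewrite /code_nat -cats1; congr cat.
by elim: (F x env) 0 => //= n IH k; rewrite IH.
Qed.

Lemma sdef_polytime (F : seq bool -> nat -> seq bool) :
  sdef (fun x e => F x (head 0 e)) -> polytime (fun x => F x (size x)).
Proof.
case=> S HS; have [M [a [d H]]] := sx_polytime S.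
by exists M, a, d => x; have := H x; rewrite HS.
Qed.

Ltac def_head_tac := first [exact: (def_head 0) | exact: (def_head 1) | exact: (def_head 2)
  | exact: (def_head 3) | exact: (def_head 4) | exact: (def_head 5) | exact: (def_head 6)
  | exact: (def_head 7)].

Ltac def_step :=
  lazymatch goal with
  | |- def (fun x e => head 0 _) => def_head_tac
  | |- def (fun x e => @?A x e + @?B x e) => apply: (@defD A B)
  | |- def (fun x e => @?A x e - @?B x e) => apply: (@defB A B)
  | |- def (fun x e => @?A x e * @?B x e) => apply: (@defM A B)
  | |- def (fun x e => (@?A x e) ^ ?n) => apply: (@defX A n)
  | |- def (fun x e => nsum (@?A x e) (@?B x e)) => apply: (@def_nsum A B)
  | |- def (fun x e => (@?A x e).+1) => apply: (@defS A)
  | |- def (fun x e => nat_of_bool (@?A x e)) => change (bdef A)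

  | |- def (fun x e => ?c) => exact: (def_const c)
  | |- bdef (fun x e => ~~ @?A x e) => apply: (@bdef_neg A)
  | |- bdef (fun x e => @?A x e && @?B x e) => apply: (@bdef_and A B)
  | |- bdef (fun x e => @?A x e || @?B x e) => apply: (@bdef_or A B)
  | |- bdef (fun x e => @?A x e ==> @?B x e) => apply: (@bdef_imply A B)
  | |- bdef (fun x e => @?A x e <= @?B x e) => apply: (@bdef_leq A B)
  | |- bdef (fun x e => (@?A x e) == (@?B x e)) =>
    first [apply: (@bdef_eq A B) | apply: (@bdef_eqb A B)]
  | |- bdef (fun x e => all (@?P x e) (iota 0 (@?A x e))) => apply: (@bdef_all A P)
  | |- bdef (fun x e => has (@?P x e) (iota 0 (@?A x e))) => apply: (@bdef_has A P)
  | |- bdef (fun x e => nth false x (@?A x e)) => apply: (@bdef_bit A)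
  | |- bdef (fun x e => true) => exact: (def_const 1)
  | |- bdef (fun x e => false) => exact: (def_const 0)
  end.
Ltac def_tac := cbv beta; repeat (def_step; cbv beta).

(** * Crossing parity *)

(** Reflection for parity arguments: an expression is an affine form over the field with two
    elements, and it vanishes identically if its constant and all its coefficients do. *)
Inductive xexpr := XVar of nat | XTrue | XFalse | XAdd of xexpr & xexpr.

Fixpoint xden (v : nat -> bool) (e : xexpr) : bool := match e with
  | XVar n => v n
  | XTrue => true
  | XFalse => false
  | XAdd a b => xden v a (+) xden v b
  end.

Fixpoint xcoef (n : nat) (e : xexpr) : bool := match e with
  | XVar m => m == n
  | XTrue | XFalse => false
  | XAdd a b => xcoef n a (+) xcoef n b
  end.

Fixpoint xconst (e : xexpr) : bool := match e with
  | XVar _ | XFalse => false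
  | XTrue => true
  | XAdd a b => xconst a (+) xconst b
  end.

Fixpoint xvars (e : xexpr) : nat := match e with
  | XVar m => m.+1
  | XTrue | XFalse => 0
  | XAdd a b => maxn (xvars a) (xvars b)
  end.

Definition xsum (v : nat -> bool) (e : xexpr) N :=
  foldr (fun n b => (xcoef n e && v n) (+) b) (xconst e) (iota 0 N).

Lemma xden_sum v e N : xvars e <= N -> xden v e = xsum v e N.
Proof.
rewrite /xsum; elim: e => [m|||a IHa b IHb] /=.
- have G l : uniq l ->
      foldr (fun n b => ((m == n) && v n) (+) b) false l = (m \in l) && v m.
    elim: l => //= n l IH /andP[nl /IH->]; rewrite inE.
    by case: eqP => [->|_] //=; rewrite (negPf nl) addbF.
  by move=> Hm; rewrite G ?iota_uniq // mem_iota /= Hm.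
- by move=> _; elim: (iota 0 N) => //= n l <-.
- by move=> _; elim: (iota 0 N) => //= n l <-.
- rewrite geq_max => /andP[/IHa-> /IHb->].
  elim: (iota 0 N) => //= n l <-.
  by case: (xcoef n a); case: (xcoef n b); case: (v n);
    do 2!case: (foldr _ _ _).
Qed.

Lemma xor_zero v e : ~~ xconst e && all (fun n => ~~ xcoef n e) (iota 0 (xvars e)) ->
  xden v e = false.
Proof.
move=> /andP[/negPf Hc Ha]; rewrite (xden_sum _ (leqnn _)) /xsum Hc.
by elim: (iota _ _) Ha => //= n l IH /andP[/negPf-> /IH].
Qed.

(** Proves a parity equation by adding up known ones: the sum of goal and hypotheses has to vanish
    identically, which [xor_id] decides. *)
Lemma xor_from (a b p q : bool) : p = q -> a (+) b (+) (p (+) q) = false -> a = b.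
Proof. by move=> ->; rewrite addbb addbF; case: a; case: b. Qed.

Lemma xorD (a b p q : bool) : a = b -> p = q -> a (+) p = b (+) q.
Proof. by move=> -> ->. Qed.

Ltac xatoms e l :=
  let rec add x l := lazymatch l with
    | [::] => constr:([:: x]) | x :: _ => l
    | ?y :: ?l' => let t := add x l' in constr:(y :: t) end in
  lazymatch e with
  | ?a (+) ?b => let l1 := xatoms a l in xatoms b l1
  | ~~ ?a => xatoms a l
  | true => l | false => l
  | _ => add e l end.
Ltac xreify e l :=
  let rec find x l := lazymatch l with
    | x :: _ => constr:(0) | _ :: ?l' => let n := find x l' in constr:(S n) end in
  lazymatch e with
  | ?a (+) ?b => let p := xreify a l in let q := xreify b l in constr:(XAdd p q)
  | ~~ ?a => let p := xreify a l in constr:(XAdd XTrue p)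
  | true => constr:(XTrue) | false => constr:(XFalse)
  | _ => let n := find e l in constr:(XVar n) end.
(* Decides identities between sums in the field of two elements. *)
Ltac xor_id := lazymatch goal with |- ?e = false =>
  let l := xatoms e (@nil bool) in let r := xreify e l in
  exact: (@xor_zero (fun n => nth false l n) r isT) end.

(** * Winding parity of sampled curves *)

Section DiscreteCurves.
Import Order.TTheory GRing.Theory Num.Theory.
Variable R : realType.
Local Notation point := (R * R)%type.
Local Open Scope ring_scope.

Definition psub (p q : point) : point := (p.1 - q.1, p.2 - q.2).

(* The half plane of the points above the origin in the order by second, then
   first coordinate. *)
Definition upper (d : point) : bool := (0 < d.2) || ((d.2 == 0) && (0 < d.1)).

(* Crossings of the negative first axis; meaningful for short steps only. *)
Definition crosses (d e : point) : nat := (upper d (+) upper e) && (d.1 < 0).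

Definition one_sided (s : seq point) : bool :=
  [|| all (fun d => 0 < d.1) s, all (fun d => d.1 < 0) s, all (fun d => 0 < d.2) s |
      all (fun d => d.2 < 0) s].

(** While one point steps from [p] to [p'] and another from [q] to [q'], their difference stays in
    one open half plane bounded by an axis, so it cannot wind around the origin. *)
Definition safe_cell (p p' q q' : point) : bool :=
  one_sided [:: psub q p; psub q' p; psub q p'; psub q' p'].

Fixpoint turns (v p : point) (s : seq point) : nat :=
  if s is q :: s' then (crosses (psub p v) (psub q v) + turns v q s')%N else 0%N.

Lemma turns_cat v p s1 s2 :
  turns v p (s1 ++ s2) = (turns v p s1 + turns v (last p s1) s2)%N.
Proof. by elim: s1 p => //= q s1 IH p; rewrite IH addnA. Qed.

Lemma upper_gt0 d : 0 < d.2 -> upper d.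
Proof. by rewrite /upper => ->. Qed.

Lemma upper_lt0 d : d.2 < 0 -> upper d = false.
Proof. by rewrite /upper => H; rewrite ltNge ltW //= lt_eqF. Qed.

(** Discrete homotopy across one grid cell. To the right of the origin nothing is counted, to the
    left the counts telescope to a change of [upper], and above or below it [upper] is constant. *)
Lemma cell_turns a b c d : one_sided [:: a; b; c; d] ->
  odd (crosses a b + crosses b d) = odd (crosses a c + crosses c d).
Proof.
rewrite /one_sided /crosses => /or4P[] /and5P[Ha Hb Hc Hd _].
- by rewrite !ltNge !(ltW Ha, ltW Hb, ltW Hc) /= !andbF.
- by rewrite Ha Hb Hc !andbT; case: (upper a); case: (upper b); case: (upper c); case: (upper d).
- by rewrite !upper_gt0.
- by rewrite !upper_lt0.
Qed.

Lemma upperN d : (d.1 != 0) || (d.2 != 0) -> upper (- d.1, - d.2) = ~~ upper d.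
Proof.
rewrite /upper /= !oppr_gt0 oppr_eq0; case: (ltgtP d.2 0) => //= _.
by rewrite orbF; case: (ltgtP d.1 0).
Qed.

(** A step inside a half plane that changes [upper] crosses either the positive or the negative half
    of the first axis; negating both vectors swaps these two cases. *)
Lemma crossesN a b : one_sided [:: a; b] ->
  odd (crosses (- a.1, - a.2) (- b.1, - b.2)) = odd (crosses a b) (+) upper a (+) upper b.
Proof.
move=> H.
have Na : (a.1 != 0) || (a.2 != 0).
  by case/or4P: H => /and3P[H _ _]; rewrite ?(gt_eqF H) ?(lt_eqF H) ?orbT.
have Nb : (b.1 != 0) || (b.2 != 0).
  by case/or4P: H => /and3P[_ H _]; rewrite ?(gt_eqF H) ?(lt_eqF H) ?orbT.
rewrite /crosses !upperN //= oppr_lt0.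
case/or4P: H => /and3P[Ha Hb _].
- by rewrite Ha ltNge (ltW Ha) /= andbF; case: (upper a); case: (upper b).
- by rewrite Ha ltNge (ltW Ha) /=; case: (upper a); case: (upper b).
- by rewrite !upper_gt0.
- by rewrite !upper_lt0.
Qed.

Lemma psubN p q : psub p q = (- (psub q p).1, - (psub q p).2).
Proof. by rewrite /psub /= !opprB. Qed.

(* p :: s and q :: t are the sample points of two disjoint curves. *)
Definition apart (p : point) (s : seq point) (q : point) (t : seq point) : bool :=
  allrel (fun a b => safe_cell a.1 a.2 b.1 b.2) (zip (p :: s) s) (zip (q :: t) t).

Lemma one_sided_sub (s t : seq point) : {subset t <= s} -> one_sided s -> one_sided t.
Proof.
move=> st /or4P[] H; apply/or4P; [apply: Or41|apply: Or42|apply: Or43|apply: Or44];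
  by apply/allP => d /st /(allP H).
Qed.

(** [cell_turns] added up along one strip of the grid: the viewpoint makes a single step while the
    other curve is traversed completely. *)
Lemma strip_turns p p' q t : all (fun b => safe_cell p p' b.1 b.2) (zip (q :: t) t) ->
  odd (turns p q t + crosses (psub (last q t) p) (psub (last q t) p')) =
  odd (crosses (psub q p) (psub q p') + turns p' q t).
Proof.
elim: t q => [|q' t IH] q /=; first by rewrite addn0.
move=> /andP[/cell_turns Hc /IH]; rewrite -addnA !oddD in Hc * => ->.
move: Hc; rewrite !addbA => ->; rewrite -!addbA.
by do !congr addb.
Qed.

(** The difference of the two moving points has no zero on the parameter rectangle, so it winds
    evenly along the boundary. On two of the four sides the difference is taken with the opposite
    sign; by [crossesN] this costs the four [upper] terms. *)
Lemma grid_turns p s q t : (0 < size t)%N -> apart p s q t ->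
  odd (turns p q t + turns (last p s) q t + turns q p s + turns (last q t) p s) =
  upper (psub p q) (+) upper (psub (last p s) q) (+)
  upper (psub p (last q t)) (+) upper (psub (last p s) (last q t)).
Proof.
move=> t0; elim: s p => [|p' s IH] p /=.
  by rewrite !oddD; case: (odd _); case: (upper _); case: (upper _).
rewrite /apart /= => /andP[Hc /IH {IH}].
have Hside w : w \in q :: t -> one_sided [:: psub p w; psub p' w].
  move=> Hw.
  suff [b /(allP Hc) Hb Hwb] : exists2 b, b \in zip (q :: t) t & (w == b.1) || (w == b.2).
    have : one_sided [:: psub w p; psub w p'].
      apply: one_sided_sub Hb => d; rewrite !inE.
      by case/orP: Hwb => /eqP-> /orP[]/eqP->; rewrite eqxx ?orbT.
    rewrite (psubN w p) (psubN w p') /one_sided /= !oppr_gt0 !oppr_lt0.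
    by move=> /or4P[]H; apply/or4P; [apply: Or42|apply: Or41|apply: Or44|apply: Or43].
  case: t t0 Hw {Hc} => // q' t _; rewrite inE => /orP[/eqP->|].
    by exists (q, q'); rewrite /= ?inE ?eqxx.
  elim: t q q' => [|q2 t IH] q q' /=.
    by rewrite inE => /eqP->; exists (q, q'); rewrite /= ?inE ?eqxx ?orbT.
  rewrite inE => /orP[/eqP->|/(IH q')[b Hb1 Hb2]].
    by exists (q, q'); rewrite /= ?inE ?eqxx ?orbT.
  by exists b => //; rewrite inE Hb1 orbT.
have /crossesN := Hside q (mem_head _ _); rewrite -!psubN => E0.
have /crossesN := Hside (last q t) (mem_last _ _); rewrite -!psubN => En.
have := strip_turns Hc => /=; rewrite !oddD E0 En.
move=> H1 H2; apply: (xor_from (xorD H1 H2)); xor_id.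
Qed.
Lemma upper_anti p q : p != q -> upper (psub p q) = ~~ upper (psub q p).
Proof.
move=> Hpq; rewrite psubN upperN // /psub /= !subr_eq0 -negb_and.
by apply: contraNN Hpq => /andP[/eqP E1 /eqP E2]; case: p q E1 E2 => [? ?] [? ?] /= -> ->.
Qed.

(* Both sides count how often the four vertices of a drawing of K4 lie inside
   the triangle of the other three. *)
Lemma crossing_chords_sides (a u b w m m' : point) (J1 J2 J3 J4 c1 c2 d1 d2 : seq point) :
  last a J1 = u -> last u J2 = b -> last b J3 = w -> last w J4 = a ->
  last a c1 = m' -> last m' c2 = b -> last u d1 = m -> last m d2 = w ->
  all (fun s => 0 < size s)%N [:: J3; J4; c1; c2; d1; d2] ->
  a != b -> u != b -> a != u ->
  apart a J1 b J3 -> apart u J2 w J4 -> apart a (c1 ++ c2) u (d1 ++ d2) ->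
  apart a J1 m d2 -> apart u J2 m d2 -> apart a (c1 ++ c2) m d2 ->
  apart b J3 u d1 -> apart w J4 u d1 -> apart a (c1 ++ c2) u d1 ->
  apart w J4 m' c2 -> apart a J1 m' c2 -> apart u (d1 ++ d2) m' c2 ->
  apart u J2 a c1 -> apart b J3 a c1 -> apart u (d1 ++ d2) a c1 ->
  odd (turns m a (J1 ++ J2 ++ J3 ++ J4)) != odd (turns m' a (J1 ++ J2 ++ J3 ++ J4)).
Proof.
move=> E1 E2 E3 E4 Ec1 Ec2 Ed1 Ed2 /and5P[z3 z4 zc1 zc2 /and3P[zd1 zd2 _]] ab ub au.
have zd : (0 < size (d1 ++ d2))%N by rewrite size_cat; lia.
have Ec : last a (c1 ++ c2) = b by rewrite last_cat Ec1 Ec2.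
have Ed : last u (d1 ++ d2) = w by rewrite last_cat Ed1 Ed2.
move: (c1 ++ c2) (d1 ++ d2) Ec Ed zd => c d Ec Ed zd.
move=> /(grid_turns z3) + /(grid_turns z4) + /(grid_turns zd) + /(grid_turns zd2) +
  /(grid_turns zd2) + /(grid_turns zd2) + /(grid_turns zd1) + /(grid_turns zd1) +
  /(grid_turns zd1) + /(grid_turns zc2) + /(grid_turns zc2) + /(grid_turns zc2) +
  /(grid_turns zc1) + /(grid_turns zc1) + /(grid_turns zc1).
rewrite !turns_cat ?(E1, E2, E3, E4, Ec1, Ec2, Ed1, Ed2, Ec, Ed) !oddD.
rewrite (upper_anti ab) (upper_anti ub) (upper_anti au).
move=> H1 H2 H3 H4 H5 H6 H7 H8 H9 H10 H11 H12 H13 H14 H15.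
suff : odd (turns m a J1) (+) (odd (turns m u J2) (+) (odd (turns m b J3) (+) odd (turns m w J4))) =
   ~~ (odd (turns m' a J1) (+) (odd (turns m' u J2) (+) (odd (turns m' b J3) (+) odd (turns m' w J4)))).
  by move=> ->; case: (_ (+) _).
(* The goal is the sum of fifteen relations: one for each of the three pairs of opposite edges of
   K4, and one for each half of a chord with each of the three edges that miss its vertex. *)
apply: (xor_from (xorD H1 (xorD H2 (xorD H3 (xorD H4 (xorD H5 (xorD H6 (xorD H7 (xorD H8
  (xorD H9 (xorD H10 (xorD H11 (xorD H12 (xorD H13 (xorD H14 H15))))))))))))))).
xor_id.
Qed.
End DiscreteCurves.

(** * From disjoint continuous arcs to sampled curves *)

Section Sampling.
Import Order.TTheory GRing.Theory Num.Theory numFieldNormedType.Exports.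
Variable R : realType.
Local Open Scope ring_scope.
Local Open Scope classical_set_scope.

Lemma within_continuous_eps (g : R -> R * R) (s0 e : R) :
  {within `[0, 1], continuous g} -> 0 <= s0 <= 1 -> 0 < e ->
  exists2 d : R, 0 < d & forall s : R, 0 <= s <= 1 -> `|s0 - s| < d ->
    `|(g s0).1 - (g s).1| < e /\ `|(g s0).2 - (g s).2| < e.
Proof.
move=> /subspace_continuousP Hg Hs0 e0.
have Hs : (`[0, 1] : set R) s0 by rewrite /= in_itv.
have /cvg_ballP/(_ e e0) := Hg s0 Hs.
rewrite near_withinE => /nbhs_ballP[d /= d0 Hd]; exists d => // s Hs01 Hsd.
by have [] : ball (g s0) e (g s) by apply: Hd => //=; rewrite in_itv.
Qed.

(** Two different points differ in some coordinate, say by [2 * r] up to sign; as long as both move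
    by less than [r], the sign of that difference persists. *)
Lemma disjoint_local (g g' : R -> R * R) (s0 t0 : R) :
  {within `[0, 1], continuous g} -> {within `[0, 1], continuous g'} ->
  0 <= s0 <= 1 -> 0 <= t0 <= 1 -> g s0 <> g' t0 ->
  exists2 d : R, 0 < d & forall s s' t t' : R,
    all (fun s : R => (0 <= s <= 1) && (`|s0 - s| < d)) [:: s; s'] ->
    all (fun t : R => (0 <= t <= 1) && (`|t0 - t| < d)) [:: t; t'] ->
    safe_cell (g s) (g s') (g' t) (g' t').
Proof.
move=> cg cg' Hs0 Ht0 Hne.
set u := (g' t0).1 - (g s0).1; set v := (g' t0).2 - (g s0).2.
have [r r0 Hr] : exists2 r : R, 0 < r & [\/ u = 2 * r, u = - (2 * r), v = 2 * r | v = - (2 * r)].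
  case: (ltgtP u 0) => Hu.
  - by exists (- u / 2); [rewrite divr_gt0 ?oppr_gt0 | apply: Or42; lra].
  - by exists (u / 2); [rewrite divr_gt0 | apply: Or41; lra].
  case: (ltgtP v 0) => Hv.
  - by exists (- v / 2); [rewrite divr_gt0 ?oppr_gt0 | apply: Or44; lra].
  - by exists (v / 2); [rewrite divr_gt0 | apply: Or43; lra].
  case: Hne; move: Hu Hv; rewrite /u /v; case: (g s0) => [a b]; case: (g' t0) => [a' b'] /=.
  by move=> /eqP; rewrite subr_eq0 => /eqP-> /eqP; rewrite subr_eq0 => /eqP->.
have [d1 d10 H1] := within_continuous_eps cg Hs0 r0.
have [d2 d20 H2] := within_continuous_eps cg' Ht0 r0.
exists (Num.min d1 d2); first by rewrite lt_min d10.
have E (s t : R) : (0 <= s <= 1) && (`|s0 - s| < Num.min d1 d2) ->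
    (0 <= t <= 1) && (`|t0 - t| < Num.min d1 d2) ->
    `|(psub (g' t) (g s)).1 - u| < 2 * r /\ `|(psub (g' t) (g s)).2 - v| < 2 * r.
  rewrite !lt_min => /andP[s01 /andP[Hs _]] /andP[t01 /andP[_ Ht]].
  have [A1 A2] := H1 s s01 Hs; have [B1 B2] := H2 t t01 Ht.
  rewrite /psub /u /v /=; move: A1 A2 B1 B2; rewrite !ltr_norml.
  by move=> /andP[? ?] /andP[? ?] /andP[? ?] /andP[? ?]; split; apply/andP; split; lra.
move=> s s' t t' /and3P[Hs Hs' _] /and3P[Ht Ht' _].
have [A1 A2] := E s t Hs Ht; have [B1 B2] := E s t' Hs Ht'.
have [C1 C2] := E s' t Hs' Ht; have [D1 D2] := E s' t' Hs' Ht'.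
have pos (x : R) : `|x - 2 * r| < 2 * r -> 0 < x.
  by rewrite ltr_norml => /andP[? _]; lra.
have neg (x : R) : `|x - (- (2 * r))| < 2 * r -> x < 0.
  by rewrite ltr_norml => /andP[_ ?]; lra.
rewrite /safe_cell /one_sided; apply/or4P; case: Hr => Hr;
  [apply: Or41|apply: Or42|apply: Or43|apply: Or44];
  rewrite ?Hr in A1 A2 B1 B2 C1 C2 D1 D2;
  by apply/and5P; split=> //; do ?[exact: pos | exact: neg].
Qed.

(** Compactness of the parameter rectangle turns the local radii of [disjoint_local] into a uniform
    one. *)
Lemma disjoint_mesh (g g' : R -> R * R) (a b a' b' : R) :
  {within `[0, 1], continuous g} -> {within `[0, 1], continuous g'} ->
  0 <= a -> b <= 1 -> 0 <= a' -> b' <= 1 ->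
  (forall s t : R, a <= s <= b -> a' <= t <= b' -> g s <> g' t) ->
  exists2 e : R, 0 < e & forall s s' t t' : R,
    all (fun s : R => a <= s <= b) [:: s; s'] -> all (fun t : R => a' <= t <= b') [:: t; t'] ->
    `|s - s'| < e -> `|t - t'| < e -> safe_cell (g s) (g s') (g' t) (g' t').
Proof.
move=> cg cg' a0 b1 a'0 b'1 Hd.
have K01 (s : R) : a <= s <= b -> 0 <= s <= 1.
  by move=> /andP[h1 h2]; rewrite (le_trans a0 h1) (le_trans h2 b1).
have K'01 (t : R) : a' <= t <= b' -> 0 <= t <= 1.
  by move=> /andP[h1 h2]; rewrite (le_trans a'0 h1) (le_trans h2 b'1).
pose P (e : R) (x : R * R) := a <= x.1 <= b -> a' <= x.2 <= b' -> forall s' t' : R,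
  a <= s' <= b -> a' <= t' <= b' -> `|x.1 - s'| < e -> `|x.2 - t'| < e ->
  safe_cell (g x.1) (g s') (g' x.2) (g' t').
have core (s0 s s' e d : R) : `|s0 - s| < d / 2 -> `|s - s'| < e -> e < d / 2 ->
    `|s0 - s| < d /\ `|s0 - s'| < d.
  by rewrite !ltr_norml => /andP[? ?] /andP[? ?] ?; split; apply/andP; split; lra.
have cK : compact (`[a, b] `*` `[a', b'] : set (R * R)).
  by apply: compact_setX; exact: segment_compact.
have := proj1 (compact_near_coveringP _) cK R (0 : R)^'+ P _.
case=> [[s0 t0] [/= ]|e' e'0 He'].
  rewrite in_itv /= => Hs0 Ht0.
  have [d d0 Hds] := disjoint_local cg cg' (K01 _ Hs0) (K'01 _ Ht0) (Hd _ _ Hs0 Ht0).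
  (* Half the radius for the first parameter and half for the step keep the second parameter within
     [d] of the centre. *)
  exists (ball (s0, t0) (d / 2), [set e | e < d / 2]) => /=.
    split; first by apply: nbhsx_ballx; rewrite divr_gt0.
    by apply: nbhs_right_lt; rewrite divr_gt0.
  move=> [[s t] e] /= [[Hs Ht] He] Has Hat s' t' Has' Hat' Hss Htt.
  have As : `|s0 - s| < d / 2 by [].
  have At : `|t0 - t| < d / 2 by [].
  have [E1 E2] := core _ _ _ _ _ As Hss He; have [E3 E4] := core _ _ _ _ _ At Htt He.
  apply: Hds; rewrite /= andbT; first by rewrite (K01 s Has) E1 (K01 s' Has') E2.
  by rewrite (K'01 t Hat) E3 (K'01 t' Hat') E4.
exists (e' / 2); first by rewrite divr_gt0.
move=> s s' t t' /and3P[Hs Hs' _] /and3P[Ht Ht' _] Hss Htt.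
have H2 : `|0 - e' / 2| < e'.
  by rewrite sub0r normrN ger0_norm ?divr_ge0 ?(ltW e'0) //; move: e'0 => /= ?; lra.
have H3 : 0 < e' / 2 by rewrite divr_gt0.
have Kst : (`[a, b] `*` `[a', b'] : set (R * R)) (s, t) by split; rewrite /= in_itv.
exact: (He' (e' / 2) H2 H3 (s, t) Kst).
Qed.
End Sampling.

Section Apart.
Import Order.TTheory GRing.Theory Num.Theory numFieldNormedType.Exports.
Variable R : realType.
Local Notation point := (R * R)%type.

Lemma apart_catl (p : point) s1 s2 q t : apart p s1 q t -> apart (last p s1) s2 q t ->
  apart p (s1 ++ s2) q t.
Proof.
elim: s1 p => [|p' s1 IH] p //; rewrite /apart => /andP[H1 H] H2.
by apply/andP; split; [exact: H1 | exact: (IH p' H H2)].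
Qed.

Lemma apart_catr (p : point) s q t1 t2 : apart p s q t1 -> apart p s (last q t1) t2 ->
  apart p s q (t1 ++ t2).
Proof.
elim: t1 q => [|q' t1 IH] q //; rewrite /apart [zip _ (q' :: _)]/= [zip _ ((q' :: _) ++ _)]/=.
rewrite !allrel_consr => /andP[H1 H] H2.
by apply/andP; split; [exact: H1 | exact: (IH q' H H2)].
Qed.

Definition trace (f : nat -> point) i n := [seq f k | k <- iota i.+1 n].

Lemma last_trace f i n : last (f i) (trace f i n) = f (i + n).
Proof. by elim: n i => [|n IH] i /=; rewrite ?addn0 // IH addnS. Qed.

Lemma trace_steps f i n a : a \in zip (f i :: trace f i n) (trace f i n) ->
  exists2 k, i <= k < i + n & a = (f k, f k.+1).
Proof.
elim: n i => [|n IH] i //=; rewrite inE => /orP[/eqP->|/IH[k Hk ->]].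
  by exists i => //; lia.
by exists k => //; lia.
Qed.
End Apart.

(** * Interleaving chords of a cycle in a crossing-free drawing *)

Section Drawing.
Import Order.TTheory GRing.Theory Num.Theory numFieldNormedType.Exports.
Variables (R : realType) (T : finType) (e : rel T).
Local Notation point := (R * R)%type.
Variables (pos : T -> point) (arc : T -> T -> set point).
Hypothesis pos_inj : injective pos.
Hypothesis arcP : forall x y, e x y -> is_arc (arc x y) (pos x) (pos y).
Hypothesis arc_vertex : forall x y z, e x y -> arc x y (pos z) -> z = x \/ z = y.
Hypothesis arc_cross : forall x y x' y' p, e x y -> e x' y' -> arc x y p -> arc x' y' p ->
  [\/ x = x' /\ y = y', x = y' /\ y = x' | exists z, p = pos z].

Local Open Scope ring_scope.
Local Open Scope classical_set_scope.

Definition curve_of (x y : T) : R -> point :=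
  match pselect (e x y) with
  | left h => projT1 (cid (arcP h))
  | right _ => fun=> pos x
  end.

Lemma curve_ofP x y : e x y ->
  [/\ {within `[0, 1], continuous (curve_of x y)},
      {in `[0, 1]%R &, injective (curve_of x y)},
      forall t, 0 <= t <= 1 -> arc x y (curve_of x y t),
      curve_of x y 0 = pos x & curve_of x y 1 = pos y].
Proof.
move=> h; rewrite /curve_of; case: pselect => // h'.
case: (cid (arcP h')) => g [/= H1 H2 H3 H4 H5]; split=> //.
by move=> t Ht; rewrite -H3; exists t => //=; rewrite in_itv.
Qed.

(* A half edge (x, y, b): the first half of the arc from x to y if b is false. *)
Definition half := (T * T * bool)%type.
Definition hvertex (h : half) : T := if h.2 then h.1.2 else h.1.1.
Definition clear (h h' : half) : bool := hvertex h' \notin [:: h.1.1; h.1.2].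

(** Arcs of different edges meet only in vertices, and a half contains no vertex but its own;
    [clear] says that this vertex is not on the other edge. The edges themselves may share their
    remaining endpoints. *)
Lemma half_disjoint x y b x' y' b' : e x y -> e x' y' -> clear (x, y, b) (x', y', b') ->
  forall s t : R, b%:R / 2 <= s <= (b%:R + 1) / 2 -> b'%:R / 2 <= t <= (b'%:R + 1) / 2 ->
  curve_of x y s <> curve_of x' y' t.
Proof.
move=> h h' Hc s t Hs Ht E.
have [_ i1 a1 s1 e1] := curve_ofP h; have [_ i2 a2 s2 e2] := curve_ofP h'.
have Hs1 : 0 <= s <= 1.
  by case/andP: Hs => A B; apply/andP; split; move: A B; case: (b) => /= A B; lra.
have Ht1 : 0 <= t <= 1.
  by case/andP: Ht => A B; apply/andP; split; move: A B; case: (b') => /= A B; lra.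
have A1 := a1 _ Hs1; have A2 := a2 _ Ht1; rewrite -E in A2.
have in01 (u : R) : 0 <= u <= 1 -> u \in `[0, 1]%R by rewrite in_itv.
have H0 : (0 : R) \in `[0, 1]%R by rewrite in_itv /= lexx ler01.
have H1 : (1 : R) \in `[0, 1]%R by rewrite in_itv /= lexx ler01.
move: Hc; rewrite /clear /hvertex !inE negb_or => /andP[/= /eqP nx /eqP ny].
have [[xx yy]|[xx yy]|[z Hz]] := arc_cross h h' A1 A2.
- by case: (b') nx ny; congruence.
- by case: (b') nx ny; congruence.
rewrite Hz in A1 A2.
have zx := arc_vertex h A1; have zx' := arc_vertex h' A2.
case: b' Ht nx ny => /= Ht nx ny.
  case: zx' => zx'; last by case: zx; congruence.
  have : t = 0 by apply: i2; rewrite ?in01 // s2 -E Hz zx'.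
  by case/andP: Ht => A B ?; lra.
case: zx' => zx'; first by case: zx; congruence.
have : t = 1 by apply: i2; rewrite ?in01 // e2 -E Hz zx'.
by case/andP: Ht => A B ?; lra.
Qed.

Definition sample n x y (k : nat) : point := curve_of x y (k%:R / (n + n)%:R).
Definition hstart n (h : half) : point := sample n h.1.1 h.1.2 (if h.2 then n else 0).
Definition hend n (h : half) : point := sample n h.1.1 h.1.2 (if h.2 then n + n else n).
Definition hcurve n (h : half) : seq point :=
  trace (sample n h.1.1 h.1.2) (if h.2 then n else 0) n.

Lemma last_hcurve n h : last (hstart n h) (hcurve n h) = hend n h.
Proof. by rewrite /hstart /hcurve last_trace /hend; case: h.2. Qed.

(** There are finitely many pairs of halves, so one sampling rate serves them all. Each half takes
    [n] steps, so sample number [n] is the midpoint of an edge. *)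
Lemma uniform_mesh : exists2 n, (0 < n)%N & forall h h' : half,
  e h.1.1 h.1.2 -> e h'.1.1 h'.1.2 -> clear h h' ->
  apart (hstart n h) (hcurve n h) (hstart n h') (hcurve n h').
Proof.
pose I (h : half) (s : R) := h.2%:R / 2 <= s <= (h.2%:R + 1) / 2.
pose P (hh : half * half) (ep : R) := e hh.1.1.1 hh.1.1.2 -> e hh.2.1.1 hh.2.1.2 ->
  clear hh.1 hh.2 -> forall s s' t t' : R, all (I hh.1) [:: s; s'] -> all (I hh.2) [:: t; t'] ->
  `|s - s'| < ep -> `|t - t'| < ep ->
  safe_cell (curve_of hh.1.1.1 hh.1.1.2 s) (curve_of hh.1.1.1 hh.1.1.2 s')
            (curve_of hh.2.1.1 hh.2.1.2 t) (curve_of hh.2.1.1 hh.2.1.2 t').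
have HP hh : exists2 ep : R, 0 < ep & P hh ep.
  have [/andP[/andP[h1 h2] hc]|Hn] :=
      boolP (e hh.1.1.1 hh.1.1.2 && e hh.2.1.1 hh.2.1.2 && clear hh.1 hh.2); last first.
    by exists 1 => // h1 h2 h3; rewrite h1 h2 h3 in Hn.
  have [c1 _ _ _ _] := curve_ofP h1; have [c2 _ _ _ _] := curve_ofP h2.
  case: hh h1 h2 hc c1 c2 => [[[x y] b] [[x' y'] b']] /= h1 h2 hc c1 c2.
  have [|||||ep ep0 Hep] := disjoint_mesh (a := b%:R / 2) (b := (b%:R + 1) / 2)
     (a' := b'%:R / 2) (b' := (b'%:R + 1) / 2) c1 c2.
  - by case: (b) => /=; lra.
  - by case: (b) => /=; lra.
  - by case: (b') => /=; lra.
  - by case: (b') => /=; lra.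
  - exact: half_disjoint hc.
  by exists ep => // _ _ _; exact: Hep.
have [ep ep0 Hep] : exists2 ep : R, 0 < ep & forall hh, hh \in enum {: half * half} -> P hh ep.
  elim: (enum _) => [|hh l [ep ep0 IH]]; first by exists 1.
  have [ep' ep'0 H'] := HP hh; exists (Num.min ep ep'); first by rewrite lt_min ep0.
  move=> hh'; rewrite inE => /orP[/eqP->|/IH H] h1 h2 h3 s s' t t' Hs Ht;
    rewrite !lt_min => /andP[? ?] /andP[? ?]; [exact: H' | exact: H].
pose n := (Num.bound ep^-1).+1.
have n0 : 0 < (n + n)%:R :> R by rewrite ltr0n.
have Hn : 1 / (n + n)%:R < ep.
  rewrite ltr_pdivrMr // -ltr_pdivrMl // mulr1.
  apply: lt_le_trans (archi_boundP _) _; first by rewrite invr_ge0 ltW.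
  by rewrite ler_nat; apply: leq_trans (leqnSn _) (leq_addr _ _).
exists n => // h h' h1 h2 hc; apply/allrelP => a a'.
have Hstep (h0 : half) k : ((if h0.2 then n else 0) <= k < (if h0.2 then n else 0) + n)%N ->
    all (I h0) [:: k%:R / (n + n)%:R; k.+1%:R / (n + n)%:R] /\
    `|k%:R / (n + n)%:R - k.+1%:R / (n + n)%:R| < ep :> R.
  move=> Hk; split; last first.
    rewrite -mulrBl -natr1 opprD addrA subrr sub0r mulNr normrN.
    by rewrite ger0_norm ?divr_ge0 ?ler0n.
  have E2 (c : R) : c / 2 * (n + n)%:R = c * n%:R by rewrite natrD; lra.
  have n1 : 0 < n%:R :> R by rewrite ltr0n.
  have L1 (c : R) j : (c / 2 <= j%:R / (n + n)%:R) = (c * n%:R <= j%:R).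
    by rewrite ler_pdivlMr // E2.
  have L2 (c : R) j : (j%:R / (n + n)%:R <= c / 2) = (j%:R <= c * n%:R).
    by rewrite ler_pdivrMr // E2.
  rewrite /= andbT /I !L1 !L2.
  case: h0.2 Hk => /andP[k1 k2] /=; rewrite ?mul1r ?mul0r ?add0r ?mul1r ?ler0n ?mulrDl ?mul1r -?natrD !ler_nat;
    by apply/andP; split; lia.
move=> /trace_steps[k /Hstep[Hk1 Hk2] ->] /trace_steps[k' /Hstep[Hk1' Hk2'] ->].
by apply: (Hep (h, h')); rewrite ?mem_enum.
Qed.

Fixpoint linked n (p : point) (hs : seq half) : Prop :=
  if hs is h :: hs' then p = hstart n h /\ linked n (hend n h) hs' else True.

Definition pcurve n (hs : seq half) : seq point := flatten [seq hcurve n h | h <- hs].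

Definition is_half (h : half) : bool := e h.1.1 h.1.2.

Lemma pcurve_cat n hs hs' : pcurve n (hs ++ hs') = pcurve n hs ++ pcurve n hs'.
Proof. by rewrite /pcurve map_cat flatten_cat. Qed.

Lemma linked_cat n p hs hs' : linked n p hs -> linked n (last p (pcurve n hs)) hs' ->
  linked n p (hs ++ hs').
Proof.
elim: hs p => //= h hs IH p [-> Hl] H; split=> //; apply: IH => //.
by move: H; rewrite /pcurve /= last_cat last_hcurve.
Qed.

Lemma apart_pcurve n :
  (forall h h', is_half h -> is_half h' -> clear h h' ->
    apart (hstart n h) (hcurve n h) (hstart n h') (hcurve n h')) ->
  forall p q hs hs', linked n p hs -> linked n q hs' -> all is_half hs -> all is_half hs' ->
  allrel clear hs hs' -> apart p (pcurve n hs) q (pcurve n hs').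
Proof.
move=> Hn p q hs hs'; elim: hs p => [|h hs IH] p //= [-> Hl] Hl' /andP[eh ehs] ehs'.
rewrite allrel_consl => /andP[Hh Hr].
rewrite /pcurve /=; apply: apart_catl; last by rewrite last_hcurve; exact: IH.
elim: hs' q Hl' ehs' Hh {Hr IH} => [|h' hs' IH] q /=; first by rewrite /apart allrel0r.
move=> [-> Hl'] /andP[eh' ehs'] /andP[Hh Hr]; apply: apart_catr; first exact: Hn.
by rewrite last_hcurve; exact: IH.
Qed.

Variables (kap : nat -> T) (N : nat).
Hypothesis N0 : (0 < N)%N.
Hypothesis kap_edge : forall k, e (kap k) (kap k.+1).
Hypothesis kap_period : forall k, kap (k + N) = kap k.
Hypothesis kap_inj : forall i j, (i < N)%N -> (j < N)%N -> kap i = kap j -> i = j.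

Definition edge_halves x y : seq half := [:: (x, y, false); (x, y, true)].
Definition cyc i l : seq half := flatten [seq edge_halves (kap k) (kap k.+1) | k <- iota i l].

Lemma cycD i l l' : cyc i (l + l') = cyc i l ++ cyc (i + l) l'.
Proof. by rewrite /cyc iotaD map_cat flatten_cat. Qed.

Lemma cyc_period i l : cyc (i + N) l = cyc i l.
Proof.
by elim: l i => [|l IH] i //=; rewrite /cyc /= -!addSn !kap_period -/(cyc _ _) IH.
Qed.

Section Mesh.
Variable n : nat.
Hypothesis n0 : (0 < n)%N.
Hypothesis meshP : forall h h' : half, e h.1.1 h.1.2 -> e h'.1.1 h'.1.2 -> clear h h' ->
  apart (hstart n h) (hcurve n h) (hstart n h') (hcurve n h').

Lemma sample_start x y : e x y -> sample n x y 0 = pos x.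
Proof. by case/curve_ofP => _ _ _ H _; rewrite /sample mul0r. Qed.

Lemma sample_end x y : e x y -> sample n x y (n + n) = pos y.
Proof.
case/curve_ofP => _ _ _ _ H; rewrite /sample divff // pnatr_eq0; lia.
Qed.

Lemma linked_edge x y : e x y -> linked n (pos x) (edge_halves x y).
Proof. by move=> h; rewrite /= /hstart /= sample_start. Qed.

Lemma last_edge x y : e x y -> last (pos x) (pcurve n (edge_halves x y)) = pos y.
Proof.
move=> h; rewrite /pcurve /= cats0 last_cat -(sample_start h) (last_hcurve n (x, y, false)).
by rewrite (last_hcurve n (x, y, true)) /hend /= sample_end.
Qed.

Lemma last_cyc i l : last (pos (kap i)) (pcurve n (cyc i l)) = pos (kap (i + l)).
Proof.
elim: l i => [|l IH] i; first by rewrite addn0.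
rewrite -[l.+1]add1n cycD pcurve_cat last_cat {2}/cyc /= last_edge //.
by rewrite addn1 IH addSn addnS.
Qed.

Lemma linked_cyc i l : linked n (pos (kap i)) (cyc i l).
Proof.
elim: l i => [|l IH] i //.
rewrite -[l.+1]add1n cycD; apply: linked_cat; rewrite {1}/cyc /=.
  by have := linked_edge (kap_edge i).
by rewrite last_edge // addn1; exact: IH.
Qed.

Lemma mem_cyc i l h : h \in cyc i l -> exists2 k, (i <= k < i + l)%N &
  exists b, h = (kap k, kap k.+1, b).
Proof.
move=> /flatten_mapP[k]; rewrite mem_iota => Hk; rewrite !inE => H; exists k => //.
by case/orP: H => /eqP->; [exists false | exists true].
Qed.

Lemma cyc_half i l : all is_half (cyc i l).
Proof. by apply/allP => h /mem_cyc[k _ [b ->]]; exact: kap_edge. Qed.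

Lemma kap_neq i j : (i < j < i + N)%N -> kap i <> kap j.
Proof.
have red k : exists2 k', (k' < N)%N & exists c, k = (k' + c * N)%N /\ kap k = kap k'.
  exists (k %% N)%N; first by rewrite ltn_mod.
  exists (k %/ N)%N; split; first by rewrite addnC -divn_eq.
  rewrite {1}(divn_eq k N) addnC; elim: (k %/ N)%N => [|c IH]; first by rewrite mul0n addn0.
  by rewrite mulSn addnCA addnC kap_period.
have [i' Hi [ci [Ei ->]]] := red i; have [j' Hj [cj [Ej ->]]] := red j.
move=> /andP[+ +] /(kap_inj Hi Hj) E; rewrite Ei Ej E -addnA !ltn_add2l -mulSnr !ltn_pmul2r //.
by lia.
Qed.

Definition side x y : bool :=
  odd (turns (sample n x y n) (pos (kap 0)) (pcurve n (cyc 0 N))).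

(** The four paths between two interleaving chords start at an endpoint of a chord, while [side]
    counts from [kap 0]. *)
Lemma turns_rotate v i : (i <= N)%N ->
  turns v (pos (kap i)) (pcurve n (cyc i N)) = turns v (pos (kap 0)) (pcurve n (cyc 0 N)).
Proof.
move=> iN.
have -> : cyc i N = cyc i (N - i) ++ cyc (0 + N) i.
  by rewrite add0n -{3}(subnKC iN) -cycD subnK.
have -> : cyc 0 N = cyc 0 i ++ cyc i (N - i).
  by rewrite -{2}(add0n i) -cycD subnKC.
rewrite cyc_period !pcurve_cat !turns_cat !last_cyc subnKC // add0n addnC.
by rewrite -[in pos (kap N)](add0n N) kap_period.
Qed.

(** The four vertices cut the cycle into four paths, which together with the two chords form a
    drawing of K4. All the required separations reduce to inequalities between positions on the
    cycle. *)
Lemma side_crossing a u b w : (a < u)%N -> (u < b)%N -> (b < w)%N -> (w < N)%N ->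
  e (kap a) (kap b) -> e (kap u) (kap w) -> side (kap a) (kap b) <> side (kap u) (kap w).
Proof.
move=> au ub bw wN hc hd.
have nsym i j : (j < i < j + N)%N -> kap i <> kap j by move=> /kap_neq H /esym.
have aN : (a <= N)%N by lia.
have [aW lw lu lb] : [/\ (w <= a + N)%N, (0 < w - b)%N, (0 < a + N - w)%N & (a <= u)%N].
  by split; lia.
have D13 k k' : (a <= k <= a + (u - a))%N -> (b <= k' <= b + (w - b))%N -> kap k <> kap k'.
  by move=> ? ?; apply: kap_neq; lia.
have D24 k k' : (u <= k <= u + (b - u))%N -> (w <= k' <= w + (a + N - w))%N -> kap k <> kap k'.
  by move=> ? ?; apply: kap_neq; lia.
have W1 k : (a <= k <= a + (u - a))%N -> kap w <> kap k by move=> ?; apply: nsym; lia.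
have W2 k : (u <= k <= u + (b - u))%N -> kap w <> kap k by move=> ?; apply: nsym; lia.
have U3 k : (b <= k <= b + (w - b))%N -> kap u <> kap k by move=> ?; apply: kap_neq; lia.
have U4 k : (w <= k <= w + (a + N - w))%N -> kap u <> kap k by move=> ?; apply: kap_neq; lia.
have B4 k : (w <= k <= w + (a + N - w))%N -> kap b <> kap k by move=> ?; apply: kap_neq; lia.
have B1 k : (a <= k <= a + (u - a))%N -> kap b <> kap k by move=> ?; apply: nsym; lia.
have A2 k : (u <= k <= u + (b - u))%N -> kap a <> kap k by move=> ?; apply: kap_neq; lia.
have A3 k : (b <= k <= b + (w - b))%N -> kap a <> kap k by move=> ?; apply: kap_neq; lia.
have AU : kap a <> kap u by apply: kap_neq; lia.
have AB : kap a <> kap b by apply: kap_neq; lia.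
have UB : kap u <> kap b by apply: kap_neq; lia.
have AW : kap a <> kap w by apply: kap_neq; lia.
have UW : kap u <> kap w by apply: kap_neq; lia.
have BW : kap b <> kap w by apply: kap_neq; lia.
have cycC i l (h : half) : hvertex h \notin [seq kap k | k <- iota i l.+1] ->
    allrel clear (cyc i l) [:: h].
  move=> Hh; apply/allrelP => h1 h2 /mem_cyc[k Hk [b' ->]]; rewrite inE => /eqP->.
  rewrite /clear /= !inE; apply: contra Hh => /orP[] /eqP->; apply: map_f;
    by rewrite mem_iota; lia.
have cycCC i l i' l' : (forall k k', (i <= k <= i + l)%N -> (i' <= k' <= i' + l')%N ->
     kap k <> kap k') -> allrel clear (cyc i l) (cyc i' l').
  move=> H; apply/allrelP => h1 h2 /mem_cyc[k Hk [b1 ->]] /mem_cyc[k' Hk' [b2 ->]].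
  rewrite /clear /hvertex /= !inE negb_or.
  by apply/andP; split; apply/eqP => E; case: b2 E => E;
    [apply: (H k k'.+1) | apply: (H k k') | apply: (H k.+1 k'.+1) | apply: (H k.+1 k')] => //; lia.
have ntin j i l : (forall k, (i <= k <= i + l)%N -> kap j <> kap k) ->
    kap j \notin [seq kap k | k <- iota i l.+1].
  by move=> H; apply/negP => /mapP[k]; rewrite mem_iota => Hk; apply: H; lia.
have hz (h : half) : (0 < size (hcurve n h))%N by rewrite size_map size_iota.
have cz i l : (0 < l)%N -> (0 < size (pcurve n (cyc i l)))%N.
  by case: l => // l _; rewrite /pcurve /= size_cat; have := hz (kap i, kap i.+1, false); lia.
pose J1 := cyc a (u - a); pose J2 := cyc u (b - u); pose J3 := cyc b (w - b).
pose J4 := cyc w (a + N - w).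
have EJ : pcurve n J1 ++ pcurve n J2 ++ pcurve n J3 ++ pcurve n J4 = pcurve n (cyc a N).
  rewrite -!pcurve_cat /J1 /J2 /J3 /J4.
  rewrite (_ : cyc a N = cyc a ((u - a) + ((b - u) + ((w - b) + (a + N - w))))); last by congr cyc; clear -au ub bw wN; lia.
  by rewrite !cycD !subnKC ?(ltnW au) ?(ltnW ub) ?(ltnW bw).
set A := kap a in hc *; set U := kap u in hd *; set B := kap b in hc *; set W := kap w in hd *.
pose c1 : half := (A, B, false); pose c2 : half := (A, B, true).
pose d1 : half := (U, W, false); pose d2 : half := (U, W, true).
have pc h : pcurve n [:: h] = hcurve n h by rewrite /pcurve /= cats0.
have pcc h h' : pcurve n [:: h; h'] = hcurve n h ++ hcurve n h' by rewrite /pcurve /= cats0.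
have PP := apart_pcurve meshP.
have sc1 : hstart n c1 = pos A by rewrite /hstart /= sample_start.
have sd1 : hstart n d1 = pos U by rewrite /hstart /= sample_start.
have ec2 : hend n c2 = pos B by rewrite /hend /= sample_end.
have ed2 : hend n d2 = pos W by rewrite /hend /= sample_end.
have lc : linked n (pos A) [:: c1; c2] by apply: linked_edge.
have ld : linked n (pos U) [:: d1; d2] by apply: linked_edge.
have lc1 : linked n (pos A) [:: c1] by split.
have ld1 : linked n (pos U) [:: d1] by split.
have lc2 : linked n (sample n A B n) [:: c2] by split.
have ld2 : linked n (sample n U W n) [:: d2] by split.
have lJ1 : linked n (pos A) J1 by apply: linked_cyc.
have lJ2 : linked n (pos U) J2 by apply: linked_cyc.
have lJ3 : linked n (pos B) J3 by apply: linked_cyc.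
have lJ4 : linked n (pos W) J4 by apply: linked_cyc.
have hhc : all is_half [:: c1; c2] by rewrite /= /is_half hc.
have hhd : all is_half [:: d1; d2] by rewrite /= /is_half hd.
have hc1 : all is_half [:: c1] by rewrite /= /is_half hc.
have hc2 : all is_half [:: c2] by rewrite /= /is_half hc.
have hd1 : all is_half [:: d1] by rewrite /= /is_half hd.
have hd2 : all is_half [:: d2] by rewrite /= /is_half hd.
have chk (x y : T) : x <> y -> (x == y) = false by move=> /eqP/negPf.
have [[nUA nBA nBU] [nWA nWU nWB]] :
    [/\ U <> A, B <> A & B <> U] /\ [/\ W <> A, W <> U & W <> B].
  by split; split; apply/nesym.
have HH := @crossing_chords_sides R (pos A) (pos U) (pos B) (pos W) (sample n U W n) (sample n A B n)
  (pcurve n J1) (pcurve n J2) (pcurve n J3) (pcurve n J4)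
  (hcurve n c1) (hcurve n c2) (hcurve n d1) (hcurve n d2).
have /eqP : side U W != side A B; last by move=> H /esym.
rewrite /side -(turns_rotate (sample n U W n) aN) -(turns_rotate (sample n A B n) aN).
rewrite -EJ; apply: HH.
- by rewrite /J1 last_cyc subnKC // ltnW.
- by rewrite /J2 last_cyc subnKC // ltnW.
- by rewrite /J3 last_cyc subnKC // ltnW.
- by rewrite /J4 last_cyc subnKC ?kap_period.
- by rewrite -sc1 last_hcurve.
- by rewrite -ec2 -(last_hcurve n c2).
- by rewrite -sd1 last_hcurve.
- by rewrite -ed2 -(last_hcurve n d2).
- by rewrite /= !hz !cz.
- by rewrite (inj_eq pos_inj) chk.
- by rewrite (inj_eq pos_inj) chk.
- by rewrite (inj_eq pos_inj) chk.
- apply: PP; rewrite ?cyc_half //; exact: cycCC D13.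
- apply: PP; rewrite ?cyc_half //; exact: cycCC D24.
- rewrite -!pcc; apply: PP => //; rewrite /allrel /= /clear /hvertex /= !inE !chk //.
- rewrite -pc; apply: PP; rewrite ?cyc_half //; apply: cycC; exact: ntin W1.
- rewrite -pc; apply: PP; rewrite ?cyc_half //; apply: cycC; exact: ntin W2.
- rewrite -pcc -pc; apply: PP => //; rewrite /allrel /= /clear /hvertex /= !inE !chk //.
- rewrite -pc; apply: PP; rewrite ?cyc_half //; apply: cycC; exact: ntin U3.
- rewrite -pc; apply: PP; rewrite ?cyc_half //; apply: cycC; exact: ntin U4.
- rewrite -pcc -pc; apply: PP => //; rewrite /allrel /= /clear /hvertex /= !inE !chk //.
- rewrite -pc; apply: PP; rewrite ?cyc_half //; apply: cycC; exact: ntin B4.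
- rewrite -pc; apply: PP; rewrite ?cyc_half //; apply: cycC; exact: ntin B1.
- rewrite -pcc -pc; apply: PP => //; rewrite /allrel /= /clear /hvertex /= !inE !chk //.
- rewrite -pc; apply: PP; rewrite ?cyc_half //; apply: cycC; exact: ntin A2.
- rewrite -pc; apply: PP; rewrite ?cyc_half //; apply: cycC; exact: ntin A3.
- rewrite -pcc -pc; apply: PP => //; rewrite /allrel /= /clear /hvertex /= !inE !chk //.
Qed.
End Mesh.
End Drawing.

(** * Two-page drawings *)

Section Pages.
Import Order.TTheory GRing.Theory Num.Theory numFieldNormedType.Exports.
Variables (R : realType) (n m : nat) (phi : cnf n m).
Variables (s : seq 'I_m) (t : seq 'I_n).
Let kappa : seq (vertex n m) := map inl s ++ map inr t.
Hypothesis ham : hamiltonian_cycle kappa.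

(** Along the cycle every clause precedes every variable, so for [i] before [j] the two edges
    interleave exactly when [v] is before [w]. *)
Definition pages (color : 'I_m -> 'I_n -> bool) : Prop :=
  forall i j v w, occurs phi v i -> occurs phi w j ->
    index i s < index j s -> index v t < index w t -> color i v <> color j w.

Let N := size kappa.
Let kap_size : 2 < N. Proof. by case: ham. Qed.
Let kap_uniq : uniq kappa. Proof. by case: ham. Qed.
Let kap_all x : x \in kappa. Proof. by case: ham. Qed.

Let ix (x : vertex n m) := index x kappa.
Let ix_lt x : ix x < N. Proof. by rewrite index_mem. Qed.
Let ix_inj : injective ix.
Proof. by move=> x y E; rewrite -(nth_index x (kap_all x)) -/(ix x) E nth_index. Qed.

Let mem_s i : i \in s.
Proof.
have := kap_all (inl i); rewrite mem_cat => /orP[/mapP[j Hj [->]]//|/mapP[j _]].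
by [].
Qed.
Let mem_t v : v \in t.
Proof.
have := kap_all (inr v); rewrite mem_cat => /orP[/mapP[j _]//|/mapP[j Hj [->]]].
by [].
Qed.

Let ix_inl i : ix (inl i) = index i s.
Proof.
by rewrite /ix index_cat map_f ?mem_s // index_map // => x y [].
Qed.
Let ix_inr v : ix (inr v) = size s + index v t.
Proof.
rewrite /ix index_cat ifN; last by apply/negP => /mapP[j _].
by rewrite size_map index_map // => x y [].
Qed.
Let lt_s i : index i s < size s. Proof. by rewrite index_mem mem_s. Qed.
Let lt_t v : index v t < size t. Proof. by rewrite index_mem mem_t. Qed.
Let NE : N = size s + size t. Proof. by rewrite /N size_cat !size_map. Qed.

Let next_ix x : ix (next kappa x) = if (ix x).+1 < N then (ix x).+1 else 0.
Proof.
rewrite /ix next_nth kap_all; move: kap_uniq (ix_lt x); rewrite /ix /N.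
case: kappa => [|y p] // U; move: (index x (y :: p)) => k Hx.
case: ltnP => Hk; first by rewrite -[nth y p k]/(nth y (y :: p) k.+1) index_uniq.
by rewrite nth_default //= eqxx.
Qed.

Lemma planar_pages : planar R (union_graph phi kappa) -> exists color, pages color.
Proof.
case=> pos [arc [pos_inj arcP _ arc_vertex arc_cross]].
have x0 : vertex n m by move: kap_size; rewrite /N; case: kappa => [|y p].
pose kap k := nth x0 kappa (k %% N).
have N0 : 0 < N by lia.
have kap_ix x : kap (ix x) = x by rewrite /kap modn_small // nth_index.
have ix_kap k : ix (kap k) = k %% N by rewrite /ix /kap index_uniq // ltn_mod.
have kap_edge k : union_graph phi kappa (kap k) (kap k.+1).
  apply/orP; right; apply/orP; left; apply/eqP/ix_inj; rewrite next_ix !ix_kap.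
  have := divn_eq k N; have := ltn_pmod k N0; move: (k %% N) (k %/ N) => r c Hr Ek.
  have -> : k.+1 = c * N + r.+1 by lia.
  rewrite modnMDl; case: ltnP => H; first by rewrite modn_small.
  by rewrite (_ : r.+1 = N) ?modnn //; lia.
have kap_period k : kap (k + N) = kap k by rewrite /kap modnDr.
have kap_inj i j : i < N -> j < N -> kap i = kap j -> i = j.
  by move=> Hi Hj /(congr1 ix); rewrite !ix_kap !modn_small.
have [k k0 Hk] := uniform_mesh arcP arc_vertex arc_cross.
exists (fun i v => side arcP kap N k (inl i) (inr v)) => i j v w Hiv Hjw Hij Hvw.
have := side_crossing pos_inj N0 kap_edge kap_period kap_inj k0 Hk
  (a := ix (inl i)) (u := ix (inl j)) (b := ix (inr v)) (w := ix (inr w)).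
rewrite !kap_ix; apply; rewrite ?ix_inl ?ix_inr ?NE ?ltn_add2l //.
- exact: leq_trans (lt_s j) (leq_addr _ _).
- by rewrite /union_graph /incidence Hiv.
- by rewrite /union_graph /incidence Hjw.
Qed.

(** * Drawing a two-page layout with parabolas *)

Section Draw.
Variable color : 'I_m -> 'I_n -> bool.
Hypothesis colorP : pages color.
Local Open Scope ring_scope.
Local Open Scope classical_set_scope.

Let pr (x : vertex n m) : R := (ix x)%:R.
(** The vertices lie on the first axis in the order of the cycle. Neighbours are joined by segments,
    all other edges bend to one side. The closing edge of the cycle spans all vertices and
    interleaves with nothing, so it may always go on the page [true]. *)
Let far (x y : vertex n m) := (1 < maxn (ix x) (ix y) - minn (ix x) (ix y))%N.
Let outer (x y : vertex n m) := (maxn (ix x) (ix y) - minn (ix x) (ix y) == N.-1)%N.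
Let col (x y : vertex n m) : bool :=
  outer x y || match x, y with inl i, inr v | inr v, inl i => color i v | _, _ => true end.
Let bend x y : R := if far x y then (-1) ^+ (~~ col x y) else 0.

Let bendC x y : bend x y = bend y x.
Proof. by rewrite /bend /far /col /outer maxnC minnC; case: x; case: y. Qed.

(** All parabolas have leading coefficient 1 up to sign. On one page the arc over a nested interval
    is therefore strictly closer to the axis, and no radii have to be chosen. *)
Definition draw_arc x y : set (R * R) := [set p |
  [/\ Num.min (pr x) (pr y) <= p.1, p.1 <= Num.max (pr x) (pr y) &
      p.2 = bend x y * ((p.1 - pr x) * (pr y - p.1))]].

Lemma draw_arcC x y : draw_arc x y = draw_arc y x.
Proof.
suff H (x' y' : vertex n m) : draw_arc x' y' `<=` draw_arc y' x' by apply/seteqP; split; exact: H.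
move=> p [H1 H2 H3]; split; [by rewrite minC | by rewrite maxC | by rewrite H3 bendC; ring].
Qed.

Lemma draw_is_arc x y : pr x != pr y -> is_arc (draw_arc x y) (pr x, 0) (pr y, 0).
Proof.
move=> xy; pose X (u : R) := pr x + u * (pr y - pr x).
pose g (u : R) : R * R := (X u, bend x y * ((X u - pr x) * (pr y - X u))).
have d0 : pr y - pr x != 0 by rewrite subr_eq0 eq_sym.
have cX : continuous X.
  by move=> u; apply: cvgD; [exact: cvg_cst | apply: cvgMl; exact: cvg_id].
have Xb (u : R) : 0 <= u <= 1 -> Num.min (pr x) (pr y) <= X u <= Num.max (pr x) (pr y).
  move=> /andP[u0 u1]; rewrite ge_min le_max /X.
  case: (leP (pr x) (pr y)) => h; apply/andP; split; apply/orP.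
  - by left; nra.
  - by right; nra.
  - by right; nra.
  - by left; nra.
exists g; split.
- have cY : continuous (fun u => bend x y * ((X u - pr x) * (pr y - X u))).
    move=> u; apply: cvgMr; apply: cvgM; first by apply: cvgB; [exact: cX | exact: cvg_cst].
    by apply: cvgB; [exact: cvg_cst | exact: cX].
  by apply: continuous_subspaceT => u; exact: (cvg_pair (cX u) (cY u)).
- move=> u v _ _ [E _]; move: E; rewrite /X => /addrI/(mulIf d0); exact.
- apply/seteqP; split=> [p [u]|p [H1 H2 H3]] /=.
    by rewrite in_itv /= => /Xb/andP[? ?] <-; split.
  exists ((p.1 - pr x) / (pr y - pr x)).
    rewrite /= in_itv /=; move: H1 H2; rewrite ge_min le_max.
    case: (ltgtP (pr x) (pr y)) xy => // h _ H1 H2.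
      have dp : 0 < pr y - pr x by rewrite subr_gt0.
      rewrite ler_pdivlMr // mul0r ler_pdivrMr // mul1r.
      by apply/andP; split; [case/orP: H1 => ? | case/orP: H2 => ?]; lra.
    have dp : 0 < pr x - pr y by rewrite subr_gt0.
    have -> : (p.1 - pr x) / (pr y - pr x) = (pr x - p.1) / (pr x - pr y).
      by rewrite -(opprB (pr x) p.1) -(opprB (pr x) (pr y)) invrN mulrNN.
    rewrite ler_pdivlMr // mul0r ler_pdivrMr // mul1r.
    by apply/andP; split; [case/orP: H2 => ? | case/orP: H1 => ?]; lra.
  have EX : X ((p.1 - pr x) / (pr y - pr x)) = p.1 by rewrite /X divfK //; ring.
  by rewrite /g EX -H3; case: (p).
- by rewrite /g /X mul0r addr0 subrr mul0r mulr0.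
- by rewrite /g /X mul1r addrCA subrr addr0 subrr mulr0 mulr0.
Qed.

Let e := union_graph phi kappa.

Let edge_cases x y : e x y -> [/\ x <> y &
  [\/ far x y = false, outer x y | incidence phi x y]].
Proof.
have cyc u v : next kappa u = v -> u <> v /\ (far u v = false \/ outer u v).
  move=> /(congr1 ix); rewrite next_ix /far /outer; have := ix_lt u; have := kap_size.
  move=> h1 h2; case: ltnP => h3 E.
    split=> [E'|]; first by rewrite -E' in E; lia.
    by left; rewrite -E; lia.
  split=> [E'|]; first by rewrite -E' in E; lia.
  by right; rewrite -E; apply/eqP; lia.
case/orP=> [H|/orP[] /eqP/cyc[H1 H2]].
- by split; [move=> E; move: H; rewrite E; case: (y) | apply: Or33].
- by split=> //; case: H2 => H2; [apply: Or31 | apply: Or32].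
- split; first exact/nesym.
  by case: H2; rewrite /far /outer maxnC minnC => H2; [apply: Or31 | apply: Or32].
Qed.

Let pr_inj : injective pr.
Proof. by move=> x y /eqP; rewrite eqr_nat => /eqP/ix_inj. Qed.

Let pr_lt x y : (pr x < pr y) = (ix x < ix y)%N. Proof. exact: ltr_nat. Qed.

Let bend_far x y : bend x y != 0 -> far x y /\ bend x y = (-1) ^+ (~~ col x y).
Proof. by rewrite /bend; case: ifP => //; rewrite eqxx. Qed.

Let far_ix x y : far x y = false -> x <> y -> (ix x < ix y)%N -> ix y = (ix x).+1.
Proof. by rewrite /far => + xy lt; lia. Qed.

Let not_interleaved x y x' y' : e x y -> e x' y' -> bend x y != 0 -> bend x y = bend x' y' ->
  (ix x < ix x')%N -> (ix x' < ix y)%N -> (ix y < ix y')%N -> False.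
Proof.
move=> h h' b0 bb l1 l2 l3.
have b0' : bend x' y' != 0 by rewrite -bb.
have [f1 c1] := bend_far b0; have [f2 c2] := bend_far b0'.
have Ecol : col x y = col x' y'.
  have : ((-1) ^+ (~~ col x y) : R) = (-1) ^+ (~~ col x' y') by rewrite -c1 bb.
  by case: (col x y); case: (col x' y') => //=; rewrite expr0 expr1 => ?; lra.
have o1 : outer x y = false by rewrite /outer; have := ix_lt y'; lia.
have o2 : outer x' y' = false by rewrite /outer; have := ix_lt y'; lia.
have [_ [|o|I1]] := edge_cases h; [by rewrite f1 | by rewrite o1 in o |].
have [_ [|o|I2]] := edge_cases h'; [by rewrite f2 | by rewrite o2 in o |].
move: Ecol I1 I2; rewrite /col o1 o2 /=.
case: x y x' y' l1 l2 l3 {h h' b0 bb b0' f1 c1 f2 c2 o1 o2} => [i|v] [i'|v'] [j|w] [j'|w'] //=;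
  rewrite ?ix_inl ?ix_inr => l1 l2 l3 Ec I1 I2.
- apply: (colorP I1 I2 l1 _ Ec); lia.
- by have := lt_s j'; lia.
- by have := lt_s i'; lia.
- by have := lt_s j'; lia.
Qed.

(** At a common point off the axis both bends have the same sign, hence agree. Equality of the two
    products rules out nested intervals, and [not_interleaved] the overlapping ones. On the axis, a
    bent arc contains only its endpoints. *)
Let arcs_cross_lt x y x' y' p : e x y -> e x' y' -> (ix x < ix y)%N -> (ix x' < ix y')%N ->
  draw_arc x y p -> draw_arc x' y' p ->
  (x = x' /\ y = y') \/ exists z, p = (pr z, 0).
Proof.
move=> h h' l l' [A1 A2 A3] [B1 B2 B3].
have lr : pr x < pr y by rewrite pr_lt.
have lr' : pr x' < pr y' by rewrite pr_lt.
move: A1 A2 B1 B2; rewrite !min_l ?max_r ?(ltW lr) ?(ltW lr') // => A1 A2 B1 B2.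
have pE z : p.1 = pr z -> p.2 = 0 -> exists z, p = (pr z, 0).
  by move=> E1 E2; exists z; rewrite [p]surjective_pairing E1 E2.
have [p0|p0] := eqVneq p.2 0.
  have edge0 u v : bend u v != 0 -> p.2 = bend u v * ((p.1 - pr u) * (pr v - p.1)) ->
      exists z, p = (pr z, 0).
    move=> b0 /esym/eqP; rewrite p0 !mulf_eq0 (negPf b0) /= !subr_eq0.
    by move=> /orP[/eqP|/eqP/esym] /pE; exact.
  have [b0|/edge0/(_ A3)] := eqVneq (bend x y) 0; last by right.
  have [b0'|/edge0/(_ B3)] := eqVneq (bend x' y') 0; last by right.
  have nf u v : bend u v = 0 -> far u v = false.
    rewrite /bend; case: ifP => // _ /eqP; rewrite expf_eq0 oppr_eq0 oner_eq0 andbF //.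
  have [nxy _] := edge_cases h; have [nxy' _] := edge_cases h'.
  have Ey := far_ix (nf _ _ b0) nxy l; have Ey' := far_ix (nf _ _ b0') nxy' l'.
  have ry : pr y = pr x + 1 by rewrite /pr Ey -natr1.
  have ry' : pr y' = pr x' + 1 by rewrite /pr Ey' -natr1.
  case: (ltngtP (ix x) (ix x')) => [lt|gt|E].
  - have : pr x + 1 <= pr x' by rewrite /pr natr1 ler_nat.
    by move=> ?; right; apply: (pE y) => //; lra.
  - have : pr x' + 1 <= pr x by rewrite /pr natr1 ler_nat.
    by move=> ?; right; apply: (pE x) => //; lra.
  - by left; split; apply: ix_inj => //; rewrite Ey Ey' E.
have b0 : bend x y != 0 by apply: contraNneq p0 => b0; rewrite A3 b0 mul0r.
have b0' : bend x' y' != 0 by apply: contraNneq p0 => b'0; rewrite B3 b'0 mul0r.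
have ax : pr x < p.1 by rewrite lt_neqAle A1 andbT; apply: contraNneq p0 => E; rewrite A3 E subrr mul0r mulr0.
have ay : p.1 < pr y by rewrite lt_neqAle A2 andbT; apply: contraNneq p0 => E; rewrite A3 E subrr mulr0 mulr0.
have bx : pr x' < p.1 by rewrite lt_neqAle B1 andbT; apply: contraNneq p0 => E; rewrite B3 E subrr mul0r mulr0.
have by_ : p.1 < pr y' by rewrite lt_neqAle B2 andbT; apply: contraNneq p0 => E; rewrite B3 E subrr mulr0 mulr0.
have E : bend x y * ((p.1 - pr x) * (pr y - p.1)) = bend x' y' * ((p.1 - pr x') * (pr y' - p.1)).
  by rewrite -A3.
set P := (p.1 - pr x) * (pr y - p.1) in E; set Q := (p.1 - pr x') * (pr y' - p.1) in E.
have P0 : 0 < P by rewrite mulr_gt0 ?subr_gt0.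
have Q0 : 0 < Q by rewrite mulr_gt0 ?subr_gt0.
have bb : bend x y = bend x' y'.
  have [_ c1] := bend_far b0; have [_ c2] := bend_far b0'; move: E; rewrite c1 c2.
  by case: (col x y); case: (col x' y') => //=; rewrite expr0 expr1 => ?; lra.
have EPQ : P = Q by move: E; rewrite bb => /(mulfI b0').
case: (ltngtP (ix x) (ix x')) => [lx|lx|Ex]; case: (ltngtP (ix y) (ix y')) => [ly|ly|Ey].
- case: (not_interleaved h h' b0 bb lx _ ly).
  by rewrite -pr_lt; lra.
- have ? : pr x < pr x' by rewrite pr_lt.
  have ? : pr y' < pr y by rewrite pr_lt.
  have : Q < P by rewrite /P /Q; nra.
  by rewrite EPQ ltxx.
- have ? : pr x < pr x' by rewrite pr_lt.
  have Ey2 : pr y = pr y' by rewrite /pr Ey.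
  have : Q < P by rewrite /P /Q Ey2; nra.
  by rewrite EPQ ltxx.
- have ? : pr x' < pr x by rewrite pr_lt.
  have ? : pr y < pr y' by rewrite pr_lt.
  have : P < Q by rewrite /P /Q; nra.
  by rewrite EPQ ltxx.
- case: (not_interleaved h' h b0' (esym bb) lx _ ly).
  by rewrite -pr_lt; lra.
- have ? : pr x' < pr x by rewrite pr_lt.
  have Ey2 : pr y = pr y' by rewrite /pr Ey.
  have : P < Q by rewrite /P /Q Ey2; nra.
  by rewrite EPQ ltxx.
- have Ex2 : pr x = pr x' by rewrite /pr Ex.
  have ? : pr y < pr y' by rewrite pr_lt.
  have : P < Q by rewrite /P /Q Ex2; nra.
  by rewrite EPQ ltxx.
- have Ex2 : pr x = pr x' by rewrite /pr Ex.
  have ? : pr y' < pr y by rewrite pr_lt.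
  have : Q < P by rewrite /P /Q Ex2; nra.
  by rewrite EPQ ltxx.
- by left; split; exact: ix_inj.
Qed.

Let e_sym x y : e x y = e y x.
Proof.
rewrite /e /union_graph; congr orb; first by case: x; case: y.
by rewrite /cycle_edge orbC.
Qed.

Lemma pages_planar : planar R (union_graph phi kappa).
Proof.
have pxy x y : e x y -> pr x != pr y.
  by case/edge_cases => xy _; apply/eqP => /pr_inj.
exists (fun x => (pr x, 0)), draw_arc; split.
- by move=> x y [] /pr_inj.
- by move=> x y /pxy/draw_is_arc.
- by move=> x y _; exact: draw_arcC.
- suff H x y z : e x y -> (ix x < ix y)%N -> draw_arc x y (pr z, 0) -> z = x \/ z = y.
    move=> x y z h A; have [xy _] := edge_cases h.
    case: (ltngtP (ix x) (ix y)) => [lt|gt|/ix_inj //]; first exact: H h lt A.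
    rewrite draw_arcC in A; rewrite -/e e_sym in h.
    by case: (H _ _ _ h gt A); [right | left].
  move=> h lt [/= H1 H2 H3]; have lr : pr x < pr y by rewrite pr_lt.
  rewrite min_l ?(ltW lr) // /pr ler_nat in H1; rewrite max_r ?(ltW lr) // /pr ler_nat in H2.
  have [b0|b0] := eqVneq (bend x y) 0.
    have [nxy _] := edge_cases h.
    have nf : far x y = false.
      by move/eqP: b0; rewrite /bend; case: ifP => // _; rewrite expf_eq0 oppr_eq0 oner_eq0 andbF.
    have Ey := far_ix nf nxy lt.
    have [Ez|Ez] : ix z = ix x \/ ix z = ix y by lia.
      by left; exact: ix_inj.
    by right; exact: ix_inj.
  move/esym/eqP: H3; rewrite !mulf_eq0 (negPf b0) /= !subr_eq0.
  by move=> /orP[/eqP/pr_inj->|/eqP/pr_inj->]; [left | right].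
- move=> x y x' y' p h h' A B.
  have [xy _] := edge_cases h; have [xy' _] := edge_cases h'.
  have or3 (b b' : bool) (x1 y1 x2 y2 : vertex n m) :
      (x1, y1) = (if b then (x, y) else (y, x)) -> (x2, y2) = (if b' then (x', y') else (y', x')) ->
      (x1 = x2 /\ y1 = y2) \/ (exists z, p = (pr z, 0)) ->
      [\/ x = x' /\ y = y', x = y' /\ y = x' | exists z, p = (pr z, 0)].
    case: b; case: b' => -[-> ->] [-> ->] [[-> ->]|H]; do ?[by apply: Or33];
      by [apply: Or31 | apply: Or32].
  case: (ltngtP (ix x) (ix y)) => [l|l|/ix_inj //]; case: (ltngtP (ix x') (ix y')) => [l'|l'|/ix_inj //].
  + exact: (or3 true true _ _ _ _ erefl erefl (arcs_cross_lt h h' l l' A B)).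
  + rewrite draw_arcC in B; rewrite -/e e_sym in h'.
    exact: (or3 true false _ _ _ _ erefl erefl (arcs_cross_lt h h' l l' A B)).
  + rewrite draw_arcC in A; rewrite -/e e_sym in h.
    exact: (or3 false true _ _ _ _ erefl erefl (arcs_cross_lt h h' l l' A B)).
  + rewrite draw_arcC in A; rewrite draw_arcC in B.
    rewrite -/e e_sym in h; rewrite -/e e_sym in h'.
    exact: (or3 false false _ _ _ _ erefl erefl (arcs_cross_lt h h' l l' A B)).
Qed.
End Draw.
End Pages.

(** * Membership in NP *)

Fixpoint occurs_at (X : nat -> bool) p (y : seq bool) : bool :=
  if y is b :: y' then (X p == b) && occurs_at X p.+1 y' else true.

Lemma occurs_at_cat X p y1 y2 :
  occurs_at X p (y1 ++ y2) = occurs_at X p y1 && occurs_at X (p + size y1) y2.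
Proof.
elim: y1 p => [|b y1 IH] p /=; first by rewrite addn0.
by rewrite IH andbA addSnnS.
Qed.

Lemma nsumS n f : nsum n.+1 f = nsum n f + f n.
Proof. by rewrite /nsum big_ord_recr. Qed.

Lemma iota_rcons n : iota 0 n.+1 = rcons (iota 0 n) n.
Proof. by rewrite -addn1 iotaD cats1. Qed.

Lemma size_flatten_iota (f : nat -> seq bool) n :
  size (flatten [seq f i | i <- iota 0 n]) = nsum n (fun i => size (f i)).
Proof.
elim: n => [|n IH]; first by rewrite /nsum big_ord0.
by rewrite iota_rcons map_rcons flatten_rcons size_cat IH nsumS.
Qed.

Lemma occurs_at_flatten X p (f : nat -> seq bool) n :
  occurs_at X p (flatten [seq f i | i <- iota 0 n]) =
  all (fun i => occurs_at X (p + nsum i (fun i' => size (f i'))) (f i)) (iota 0 n).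
Proof.
elim: n => [|n IH] //.
by rewrite !iota_rcons map_rcons flatten_rcons occurs_at_cat IH all_rcons andbC size_flatten_iota.
Qed.

Lemma occurs_at_code_nat X p k :
  occurs_at X p (code_nat k) = all (fun q => X (p + q)) (iota 0 k) && ~~ X (p + k).
Proof.
rewrite /code_nat -cats1 occurs_at_cat size_nseq /= andbT eqbF_neg; congr andb.
elim: k p => [|k IH] p //=; rewrite IH addn0 eqb_id; congr andb.
rewrite (iotaDl 1 0 k) all_map; apply: eq_all => q /=.
by rewrite addSnnS.
Qed.

Lemma occurs_at_eq u x w y : size y = size x ->
  occurs_at (nth false (u ++ x ++ w)) (size u) y = (x == y).
Proof.
elim: y x u => [|b y IH] [|c x] u //= [/IH{}IH].
rewrite nth_cat ltnn subnn /= eqseq_cons; congr andb.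
by have := IH (rcons u c); rewrite size_rcons cat_rcons.
Qed.

(** The expression language cannot inspect a word that it produces. To compare the input with the
    code of an instance, that code is never built; its length and its occurrence at a given place
    are made definable instead. *)
Definition mdef (F : seq bool -> seq nat -> seq bool) :=
  def (fun x e => size (F x e)) /\
  forall P, def P -> bdef (fun x e => occurs_at (nth false x) (P x e) (F x e)).

Lemma mdef_bit P : bdef P -> mdef (fun x e => [:: P x e]).
Proof.
move=> HP; split=> [|Q HQ]; first exact: def_const.
have [ex He] := bdef_eqb (bdef_bit HQ) HP.
by exists ex => x e; rewrite He /= andbT.
Qed.

Lemma mdef_cat F G : mdef F -> mdef G -> mdef (fun x e => F x e ++ G x e).
Proof.
move=> [sF mF] [sG mG]; split=> [|Q HQ].
  by apply: def_ext (defD sF sG) => x e; rewrite size_cat.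
have [ex He] := bdef_and (mF _ HQ) (mG _ (defD HQ sF)).
by exists ex => x e; rewrite He occurs_at_cat.
Qed.

Lemma mdef_for F G : def F -> mdef (fun x e => G x (behead e) (head 0 e)) ->
  mdef (fun x e => flatten [seq G x e i | i <- iota 0 (F x e)]).
Proof.
move=> HF [sG mG]; split=> [|Q HQ].
  apply: def_ext (def_nsum (G := fun x e i => size (G x e i)) HF sG) => x e.
  by rewrite size_flatten_iota.
have sG' : def (fun x e => nsum (head 0 e) (fun i => size (G x (behead e) i))).
  apply: def_nsum; first exact: (def_head 0).
  exact: (def_skip sG).
have [ex He] := bdef_all (P := fun x e i =>
   occurs_at (nth false x) (Q x e + nsum i (fun i' => size (G x e i'))) (G x e i)) HF
   (mG _ (defD (def_behead HQ) sG')).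
by exists ex => x e; rewrite He occurs_at_flatten.
Qed.

Lemma mdef_code_nat F : def F -> mdef (fun x e => code_nat (F x e)).
Proof.
move=> HF; split=> [|Q HQ].
  by apply: def_ext (defS HF) => x e; rewrite /code_nat size_rcons size_nseq.
have [ex He] := bdef_and (bdef_all (P := fun x e q => nth false x (Q x e + q)) HF
  (bdef_bit (defD (def_behead HQ) (def_head 0)))) (bdef_neg (bdef_bit (defD HQ HF))).
by exists ex => x e; rewrite He occurs_at_code_nat.
Qed.

Ltac mdef_step :=
  lazymatch goal with
  | |- mdef (fun x e => @?A x e ++ @?B x e) => apply: (@mdef_cat A B)
  | |- mdef (fun x e => code_nat (@?A x e)) => apply: (@mdef_code_nat A)
  | |- mdef (fun x e => [:: @?A x e]) => apply: (@mdef_bit A)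
  | |- mdef (fun x e => flatten (map (@?G x e) (iota 0 (@?A x e)))) => apply: (@mdef_for A G)
  | |- _ => def_step
  end.
Ltac mdef_tac := cbv beta; repeat (mdef_step; cbv beta).

(* An instance and its certificate: clause i has the literals (lv i k, sg i k)
   for k < 3, the cycle visits the clauses cs 0, cs 1, ... and the variables
   vs 0, vs 1, ..., at the positions pc and pv; the edge from clause i to its
   k-th variable is drawn on the side cl i k. *)
Section Certificate.
Variables (n m : nat) (lv : nat -> nat -> nat) (sg cl : nat -> nat -> bool).
Variables (cs vs pc pv : nat -> nat) (asg : nat -> bool).

Definition cert_ok : bool :=
  [&& all (fun i => all (fun k => lv i k < n) (iota 0 3)) (iota 0 m),
      all (fun i => all (fun k => all (fun k' => ~~ (lv i k == lv i k')) (iota 0 k)) (iota 0 3))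
          (iota 0 m),
      all (fun i => all (fun i' => has (fun k => all (fun k' =>
             ~~ (lv i k == lv i' k') || ~~ (sg i k == sg i' k')) (iota 0 3)) (iota 0 3))
          (iota 0 i)) (iota 0 m),
      all (fun j => (cs j < m) && (pc (cs j) == j)) (iota 0 m),
      all (fun j => (vs j < n) && (pv (vs j) == j)) (iota 0 n),
      2 < m + n,
      all (fun i => all (fun i' => all (fun k => all (fun k' =>
        (pc i < pc i') && (pv (lv i k) < pv (lv i' k')) ==> ~~ (cl i k == cl i' k'))
        (iota 0 3)) (iota 0 3)) (iota 0 m)) (iota 0 m) &
      all (fun i => has (fun k => asg (lv i k) == sg i k) (iota 0 3)) (iota 0 m)].

Definition cert_code : seq bool :=
  code_nat n ++ code_nat m ++
  flatten [seq code_nat 3 ++ flatten [seq code_nat (lv i k) ++ [:: sg i k] | k <- iota 0 3]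
          | i <- iota 0 m] ++
  code_nat (m + n) ++
  flatten [seq [:: true] ++ code_nat (cs j) | j <- iota 0 m] ++
  flatten [seq [:: false] ++ code_nat (vs j) | j <- iota 0 n].
End Certificate.

(** * The certificate as a table of bits *)

Section Tables.
Variables (z : seq bool) (N : nat).
(** In [code_pair x w] with [N = size x], exactly [2 * N + 1] bits precede [w]; the rest is read as
    a stack of square matrices of side [N.+1]. *)
Definition tab r i j := nth false z (2 * N + 1 + ((r * N.+1 + i) * N.+1 + j)).
(** Counting the ones of a line makes every content of the table a number, so no format has to be
    verified. *)
Definition cnt r i := nsum N.+1 (fun j => nat_of_bool (tab r i j)).
Definition tn := cnt 0 0.
Definition tm := cnt 0 1.
Definition tlv i k := cnt 1 (3 * i + k).
Definition tsg i k := tab 2 (3 * i + k) 0.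
Definition tcs j := cnt 3 j.
Definition tvs j := cnt 4 j.
Definition tpc j := cnt 5 j.
Definition tpv j := cnt 6 j.
Definition tcl i k := tab 7 (3 * i + k) 0.
Definition tasg v := tab 8 v 0.
Definition tcode := cert_code tn tm tlv tsg tcs tvs.
Definition table_ok : bool :=
  cert_ok tn tm tlv tsg tcl tcs tvs tpc tpv tasg &&
  ((size tcode == N) && occurs_at (nth false z) N.+1 tcode).
End Tables.

(** Length of the initial run of ones. In a coded pair this recovers the length of the first
    component. *)
Definition ones (z : seq bool) n := nsum n (fun i => all (fun j => nth false z j) (iota 0 i.+1)).

(** The search with an equation is a let binding for [N] in the expression language. *)
Definition verify (z : seq bool) : bool :=
  has (fun N => (N == ones z (size z)) && table_ok z N) (iota 0 (size z).+1).

Lemma mdef_tcode : mdef (fun z e => tcode z (head 0 e)).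
Proof.
rewrite /tcode /cert_code /tn /tm /tlv /tsg /tcs /tvs /cnt /tab.
by mdef_tac.
Qed.

Lemma polytime_verify : polytime (fun z => [:: verify z]).
Proof.
pose F z n := [:: has (fun N => (N == ones z n) && table_ok z N) (iota 0 n.+1)].
apply: (@sdef_polytime F); rewrite /F; apply: sdef_bit; apply: bdef_has; first by def_tac.
cbv beta; apply: bdef_and; first by rewrite /ones; def_tac.
have H : bdef (fun z e => table_ok z (head 0 e)).
  rewrite /table_ok; apply: bdef_and; last first.
    have [sT mT] := mdef_tcode.
    apply: bdef_and; first by apply: bdef_eq sT (def_head 0).
    exact: mT (defS (def_head 0)).
  rewrite /cert_ok /tn /tm /tlv /tsg /tcl /tcs /tvs /tpc /tpv /tasg /cnt /tab.
  by def_tac.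
exact: H.
Qed.

Lemma map_enum_ord (T : Type) (g : nat -> T) m :
  [seq g (nat_of_ord i) | i <- enum 'I_m] = [seq g i | i <- iota 0 m].
Proof. by rewrite -val_enum_ord -map_comp. Qed.

Lemma all_iotaP (P : pred nat) n : reflect (forall i, i < n -> P i) (all P (iota 0 n)).
Proof.
apply: (iffP allP) => H i; last by rewrite mem_iota; exact: H.
by move=> Hi; apply: H; rewrite mem_iota.
Qed.

Lemma has_iotaP (P : pred nat) n : reflect (exists2 i, i < n & P i) (has P (iota 0 n)).
Proof.
apply: (iffP hasP) => -[i]; first by rewrite mem_iota => Hi Pi; exists i.
by move=> Hi Pi; exists i => //; rewrite mem_iota.
Qed.

(** The inverse tables [pc] and [pv] make [cs] and [vs] injective, hence permutations, so the cycle
    is Hamiltonian. The table [cl] is a two-page colouring, which [pages_planar] turns into a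
    drawing. *)
Lemma cert_sound (R : realType) n m lv sg cl cs vs pc pv asg :
  cert_ok n m lv sg cl cs vs pc pv asg ->
  linked_planar_3SAT R exactly_three_variables (cert_code n m lv sg cs vs).
Proof.
case/andP=> /all_iotaP V1 /andP[/all_iotaP V2] /andP[/all_iotaP V3] /andP[/all_iotaP V4].
case/andP=> /all_iotaP V5 /andP[V6] /andP[/all_iotaP V7 /all_iotaP V8].
have P1 (i : 'I_m) (k : 'I_3) : lv i k < n by have /all_iotaP := V1 i (ltn_ord i); apply.
have dist i k k' : i < m -> k < 3 -> k' < 3 -> lv i k = lv i k' -> k = k'.
  move=> Hi; wlog lt : k k' / k' < k.
    move=> H Hk Hk' E; case: (ltngtP k k') => // lt; last exact: H.
    by apply/esym; apply: H => //.
  move=> Hk Hk' E; have /all_iotaP/(_ k Hk)/all_iotaP/(_ k' lt) := V2 i Hi.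
  by rewrite E eqxx.
pose lit (i : 'I_m) (k : 'I_3) : literal n := (Ordinal (P1 i k), sg i k).
pose phi : cnf n m := mktuple (fun i => [seq lit i k | k <- enum 'I_3]).
have tphi i : tnth phi i = [seq lit i k | k <- enum 'I_3] by rewrite tnth_mktuple.
have P4 (j : 'I_m) : cs j < m by case/andP: (V4 j (ltn_ord j)).
have P5 (j : 'I_n) : vs j < n by case/andP: (V5 j (ltn_ord j)).
pose fs (j : 'I_m) := Ordinal (P4 j); pose ft (j : 'I_n) := Ordinal (P5 j).
have is_ : injective fs.
  move=> j j' /(congr1 val)/(congr1 pc) /=.
  by case/andP: (V4 j (ltn_ord j)) => _ /eqP->; case/andP: (V4 j' (ltn_ord j')) => _ /eqP-> /val_inj.
have it : injective ft.
  move=> j j' /(congr1 val)/(congr1 pv) /=.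
  by case/andP: (V5 j (ltn_ord j)) => _ /eqP->; case/andP: (V5 j' (ltn_ord j')) => _ /eqP-> /val_inj.
pose s := [seq fs j | j <- enum 'I_m]; pose t := [seq ft j | j <- enum 'I_n].
have Is i : index i s = pc i.
  rewrite -[i](f_invF is_) /s index_map // index_enum_ord.
  by case/andP: (V4 _ (ltn_ord (invF is_ i))) => _ /eqP /= ->.
have It v : index v t = pv v.
  rewrite -[v](f_invF it) /t index_map // index_enum_ord.
  by case/andP: (V5 _ (ltn_ord (invF it v))) => _ /eqP /= ->.
pose kappa : seq (vertex n m) := map inl s ++ map inr t.
have szk : size kappa = m + n.
  rewrite -[in RHS](size_enum_ord m) -[in RHS](size_enum_ord n).
  by rewrite -[in RHS](size_map fs) -[in RHS](size_map ft) /kappa size_cat !size_map.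
have Hham : hamiltonian_cycle kappa.
  split.
  - by rewrite szk.
  - rewrite cat_uniq /s /t !map_inj_uniq ?enum_uniq //=; last 2 first.
    + by move=> ? ? [].
    + by move=> ? ? [].
    rewrite -!enumT !enum_uniq /= andbT.
    by apply/hasPn => _ /mapP[v _ ->]; apply/negP => /mapP[].
  - case=> [i|v]; rewrite mem_cat; apply/orP.
      by left; rewrite map_f // -[i](f_invF is_) /s map_f // mem_enum.
    by right; rewrite map_f // -[v](f_invF it) /t map_f // mem_enum.
exists n, m, phi, kappa; split.
- rewrite /code_instance /code_seq size_tuple /cert_code -!catA.
  congr (_ ++ (_ ++ _)).
  have -> : tval phi = [seq [seq lit i k | k <- enum 'I_3] | i <- enum 'I_m].
    by rewrite -(map_tnth_enum phi); apply: eq_map => i; rewrite tphi.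
  rewrite szk /kappa /s /t -!map_comp map_cat flatten_cat -!map_comp -!enumT.
  rewrite -(map_enum_ord (fun i => code_nat 3 ++
     flatten [seq code_nat (lv i k) ++ [:: sg i k] | k <- iota 0 3])).
  rewrite -(map_enum_ord (fun j => [:: true] ++ code_nat (cs j))).
  rewrite -(map_enum_ord (fun j => [:: false] ++ code_nat (vs j))).
  congr (flatten _ ++ _); apply: eq_map => i.
  rewrite -[RHS]/(code_nat (size [seq lit i k | k <- enum 'I_3]) ++
    flatten [seq code_literal l | l <- [seq lit i k | k <- enum 'I_3]]).
  rewrite (size_map (lit i)) size_enum_ord; congr (_ ++ flatten _).
  by rewrite -(map_comp _ (lit i)) -(map_enum_ord (fun k => code_nat (lv i k) ++ [:: sg i k])).
- split=> //.
  + move=> i j; rewrite !tphi => E; apply/val_inj.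
    have key (i1 i2 : 'I_m) : i2 < i1 ->
        [seq lit i1 k | k <- enum 'I_3] =i [seq lit i2 k | k <- enum 'I_3] -> False.
      move=> lt E'; have /all_iotaP/(_ i2 lt)/has_iotaP[k Hk /all_iotaP Hk'] := V3 i1 (ltn_ord i1).
      have := E' (lit i1 (Ordinal Hk)); rewrite map_f ?mem_enum // => /esym/mapP[k' _ [E1 E2]].
      by have := Hk' k' (ltn_ord k'); rewrite /= E1 E2 !eqxx.
    by case: (ltngtP (val i) (val j)) => // lt; [case: (key j i lt) => l; rewrite E | case: (key i j lt)].
  + by move=> c /tnthP[i ->]; rewrite tphi size_map size_enum_ord.
  + by exists s, t.
  + apply: (@pages_planar R n m phi s t Hham
      (fun i v => has (fun k => (lv i k == v) && cl i k) (iota 0 3))).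
    have col (i : 'I_m) (k : 'I_3) :
        has (fun k' => (lv i k' == Ordinal (P1 i k)) && cl i k') (iota 0 3) = cl i k.
      apply/has_iotaP/idP => [[k' Hk' /andP[/eqP /= E]]|H].
        by rewrite (dist i k' k (ltn_ord i) Hk' (ltn_ord k) E).
      by exists k; rewrite ?ltn_ord //= eqxx.
    have occ i v : occurs phi v i -> exists k : 'I_3, v = Ordinal (P1 i k).
      by rewrite /occurs mem_undup tphi => /mapP[_ /mapP[k _ ->] ->]; exists k.
    move=> i j v w /occ[k ->] /occ[k' ->]; rewrite !Is !It => lt1 lt2; rewrite !col => E.
    have := V7 i (ltn_ord i) => /all_iotaP/(_ j (ltn_ord j))/all_iotaP/(_ k (ltn_ord k)).
    by move=> /all_iotaP/(_ k' (ltn_ord k')); rewrite lt1 lt2 E eqxx.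
- move=> c /tnthP[i ->]; rewrite tphi /clause_vars -(map_comp fst (lit i)) undup_id.
    by rewrite (size_map (fst \o lit i)) size_enum_ord.
  rewrite map_inj_uniq ?enum_uniq // => k k' [/(dist _ _ _ (ltn_ord i) (ltn_ord k) (ltn_ord k'))].
  exact: val_inj.
- exists (fun v => asg v) => c /tnthP[i ->]; rewrite tphi.
  have /has_iotaP[k Hk /eqP E] := V8 i (ltn_ord i).
  by exists (lit i (Ordinal Hk)); rewrite ?map_f ?mem_enum.
Qed.

Lemma cert_complete n m (phi : cnf n m) (s : seq 'I_m) (t : seq 'I_n) color (a : 'I_n -> bool)
    (lv : nat -> nat -> nat) (sg cl : nat -> nat -> bool) (cs vs pc pv : nat -> nat)
    (asg : nat -> bool) :
  clauses_distinct phi -> (forall c, c \in tval phi -> size c <= 3) ->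
  hamiltonian_cycle (map inl s ++ map inr t : seq (vertex n m)) ->
  exactly_three_variables phi -> pages phi s t color ->
  (forall c, c \in tval phi -> exists2 l, l \in c & a l.1 = l.2) ->
  (forall i : 'I_m, [seq (lv i k, sg i k) | k <- iota 0 3] =
                    [seq (nat_of_ord l.1, l.2) | l <- tnth phi i]) ->
  (forall i : 'I_m, [seq cl i k | k <- iota 0 3] = [seq color i l.1 | l <- tnth phi i]) ->
  [seq cs j | j <- iota 0 m] = map val s -> [seq vs j | j <- iota 0 n] = map val t ->
  (forall i : 'I_m, pc i = index i s) -> (forall v : 'I_n, pv v = index v t) ->
  (forall v : 'I_n, asg v = a v) ->
  cert_ok n m lv sg cl cs vs pc pv asg /\
  cert_code n m lv sg cs vs = code_instance phi (map inl s ++ map inr t).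
Proof.
move=> Hd Hs3 Hham Hex Hpg Ha Hlv Hcl Hcs Hvs Hpc Hpv Hasg.
have sz (i : 'I_m) : size (tnth phi i) = 3 by have := congr1 size (Hlv i); rewrite !size_map size_iota.
have L (i : 'I_m) k : k < 3 -> exists l, [/\ l \in tnth phi i, lv i k = l.1, sg i k = l.2,
    cl i k = color i l.1 & forall k', k' < 3 -> lv i k' = l.1 -> k' = k].
  move=> Hk; have Hk2 : k < size (tnth phi i) by rewrite sz.
  have l0 : literal n by case: (tnth phi i) Hk2.
  exists (nth l0 (tnth phi i) k).
  have E k1 : k1 < 3 -> (lv i k1, sg i k1) =
      (nat_of_ord (nth l0 (tnth phi i) k1).1, (nth l0 (tnth phi i) k1).2).
    move=> Hk1; have := congr1 (fun q => nth (0, false) q k1) (Hlv i).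
    by rewrite (nth_map 0) ?size_iota // nth_iota // add0n (nth_map l0) ?sz.
  have [E1 E2] := E k Hk; split=> //.
  - exact: mem_nth.
  - have := congr1 (fun q => nth false q k) (Hcl i).
    by rewrite (nth_map 0) ?size_iota // nth_iota // add0n (nth_map l0) ?sz.
  - move=> k' Hk'; have [-> _] := E k' Hk' => /val_inj Ev.
    have U : uniq (map fst (tnth phi i)).
      have := Hex _ (mem_tnth i phi); rewrite /clause_vars -{1}(sz i) -(size_map fst).
      by move=> Es; apply/negPn/negP; rewrite -ltn_size_undup Es ltnn.
    apply/eqP; rewrite -(nth_uniq l0.1 _ _ U) ?size_map ?sz //.
    by rewrite !(nth_map l0) ?sz // Ev.
have Ls (i : 'I_m) l : l \in tnth phi i -> exists2 k, k < 3 & lv i k = l.1 /\ sg i k = l.2.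
  move=> Hl; have : (nat_of_ord l.1, l.2) \in [seq (lv i k, sg i k) | k <- iota 0 3].
    by rewrite Hlv; apply/mapP; exists l.
  by case/mapP=> k; rewrite mem_iota => Hk [-> ->]; exists k.
have [Hsz Hu Hall] := Hham.
have ms i : i \in s.
  by have := Hall (inl i); rewrite mem_cat => /orP[/mapP[j Hj [->]]//|/mapP[]].
have mt v : v \in t.
  by have := Hall (inr v); rewrite mem_cat => /orP[/mapP[]|/mapP[j Hj [->]]].
have [us ut] : uniq s /\ uniq t.
  move: Hu; rewrite cat_uniq => /and3P[+ _ +]; rewrite !map_inj_uniq //; by move=> ? ? [].
have ss : size s = m by have := congr1 size Hcs; rewrite !size_map size_iota.
have st : size t = n by have := congr1 size Hvs; rewrite !size_map size_iota.
split.
- apply/andP; split.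
    apply/all_iotaP => i Hi; apply/all_iotaP => k Hk.
    by have [l [_ -> _ _ _]] := L (Ordinal Hi) k Hk.
  apply/andP; split.
    apply/all_iotaP => i Hi; apply/all_iotaP => k Hk; apply/all_iotaP => k' Hk'.
    have [l [_ E _ _ U]] := L (Ordinal Hi) k Hk.
    apply/eqP => E'; have := U k' (ltn_trans Hk' Hk); rewrite /= -E' E => /(_ erefl); lia.
  apply/andP; split.
    apply/all_iotaP => i Hi; apply/all_iotaP => i' Hi'.
    apply/negPn/negP; rewrite -all_predC => /all_iotaP Hno.
    have Hi2 := ltn_trans Hi' Hi.
    suff : Ordinal Hi = Ordinal Hi2 by move=> [E]; rewrite E ltnn in Hi'.
    have sub : {subset tnth phi (Ordinal Hi) <= tnth phi (Ordinal Hi2)}.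
      move=> l /Ls[k Hk [E1 E2]]; have /allPn[k'] := Hno k Hk; rewrite mem_iota => Hk'.
      rewrite negb_or !negbK => /andP[/eqP E3 /eqP E4].
      have [l' [Hl' E5 E6 _ _]] := L (Ordinal Hi2) k' Hk'.
      suff -> : l = l' by [].
      rewrite [l]surjective_pairing [l']surjective_pairing; congr (_, _).
        by apply/val_inj; rewrite /= -E1 E3 -E5.
      by rewrite -E2 E4 -E6.
    (* Both clauses consist of three different literals, so the inclusion is an equality. *)
    apply: Hd => l; apply/idP/idP; first exact: sub.
    have Ui (i0 : 'I_m) : uniq (tnth phi i0).
      have := Hex _ (mem_tnth i0 phi); rewrite /clause_vars -{1}(sz i0) => Es.
      by apply: (@map_uniq _ _ fst); apply/negPn/negP;
        rewrite -ltn_size_undup Es size_map ltnn.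
    have le : size (tnth phi (Ordinal Hi2)) <= size (tnth phi (Ordinal Hi)) by rewrite !sz.
    by have [_ ->] := uniq_min_size (Ui _) sub le.
  have cs_s j : j < m -> forall (Hj : j < m), exists2 i : 'I_m, cs j = i & index i s = j.
    move=> Hj _; have i0 : 'I_m := Ordinal Hj.
    exists (nth i0 s j); last by rewrite index_uniq ?ss.
    have := congr1 (fun q => nth 0 q j) Hcs.
    by rewrite (nth_map 0) ?size_iota // nth_iota // add0n (nth_map i0) ?ss.
  have vs_t j : j < n -> exists2 v : 'I_n, vs j = v & index v t = j.
    move=> Hj; have i0 : 'I_n := Ordinal Hj.
    exists (nth i0 t j); last by rewrite index_uniq ?st.
    have := congr1 (fun q => nth 0 q j) Hvs.
    by rewrite (nth_map 0) ?size_iota // nth_iota // add0n (nth_map i0) ?st.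
  apply/andP; split.
    by apply/all_iotaP => j Hj; have [i -> Ei] := cs_s j Hj Hj; rewrite ltn_ord Hpc Ei eqxx.
  apply/andP; split.
    by apply/all_iotaP => j Hj; have [i -> Ei] := vs_t j Hj; rewrite ltn_ord Hpv Ei eqxx.
  apply/andP; split; first by move: Hsz; rewrite size_cat !size_map ss st.
  apply/andP; split.
    apply/all_iotaP => i Hi; apply/all_iotaP => i' Hi'; apply/all_iotaP => k Hk.
    apply/all_iotaP => k' Hk'; apply/implyP.
    have [l [Hl -> _ -> _]] := L (Ordinal Hi) k Hk; have [l' [Hl' -> _ -> _]] := L (Ordinal Hi') k' Hk'.
    rewrite !Hpv -[pc i]/(pc (Ordinal Hi)) -[pc i']/(pc (Ordinal Hi')) !Hpc => /andP[lt1 lt2].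
    by apply/eqP; apply: Hpg lt1 lt2; rewrite /occurs mem_undup map_f.
  apply/all_iotaP => i Hi; have [l Hl Hal] := Ha _ (mem_tnth (Ordinal Hi) phi).
  have [k Hk [E1 E2]] := Ls _ _ Hl; apply/has_iotaP; exists k => //.
  by rewrite [lv i k]E1 [sg i k]E2 Hasg Hal.
- rewrite /cert_code /code_instance /code_seq size_tuple -!catA; congr (_ ++ (_ ++ _)).
  rewrite size_cat !size_map ss st map_cat flatten_cat -!map_comp.
  have -> : flatten [seq [:: true] ++ code_nat (cs j) | j <- iota 0 m] =
            flatten [seq (@code_vertex n m \o inl) i | i <- s].
    transitivity (flatten [seq true :: code_nat c | c <- [seq cs j | j <- iota 0 m]]).
      by rewrite -map_comp.
    by rewrite Hcs -map_comp.
  have -> : flatten [seq [:: false] ++ code_nat (vs j) | j <- iota 0 n] =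
            flatten [seq (@code_vertex n m \o inr) i | i <- t].
    transitivity (flatten [seq false :: code_nat c | c <- [seq vs j | j <- iota 0 n]]).
      by rewrite -map_comp.
    by rewrite Hvs -map_comp.
  congr (flatten _ ++ _).
  rewrite -(map_enum_ord (fun i => code_nat 3 ++
     flatten [seq code_nat (lv i k) ++ [:: sg i k] | k <- iota 0 3])).
  rewrite -[in RHS](map_tnth_enum phi) -(map_comp _ (tnth phi)); apply: eq_map => i.
  rewrite -[RHS]/(code_nat (size (tnth phi i)) ++ flatten [seq code_literal l | l <- tnth phi i]).
  rewrite sz; congr (_ ++ flatten _).
  transitivity [seq (fun q : nat * bool => code_nat q.1 ++ [:: q.2]) q |
     q <- [seq (lv i k, sg i k) | k <- iota 0 3]] => //.
  by rewrite Hlv -map_comp.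
Qed.

Lemma sum_ord_lt n k : k <= n -> \sum_(i < n) nat_of_bool (i < k) = k.
Proof.
elim: n => [|n IH] Hk; first by rewrite big_ord0; lia.
rewrite big_ord_recr /=; case: (ltngtP k n.+1) Hk => // [lt|->] _.
  by rewrite IH // addn0.
rewrite (eq_bigr (fun=> 1)) ?sum1_card ?card_ord ?addn1 // => i _.
by rewrite ltnS ltnW.
Qed.

Lemma ones_code_pair x w n : size x < n -> ones (code_pair x w) n = size x.
Proof.
rewrite /ones /code_pair /code_seq /code_nat -cats1 -!catA.
set z := _ ++ _ => lt.
have Hz j : j <= size x -> nth false z j = (j < size x).
  move=> Hj; rewrite /z nth_cat size_nseq nth_nseq; case: ltnP => // Hj2.
  have -> : j = size x by lia.
  by rewrite subnn.
have Hall i : all (fun j => nth false z j) (iota 0 i.+1) = (i < size x).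
  apply/all_iotaP/idP => [H|lti j Hj]; last by rewrite Hz; lia.
  by case: (leqP (size x) i) => // Hi; have := H (size x) Hi; rewrite Hz // ltnn.
rewrite /nsum; under eq_bigr => i _ do rewrite Hall.
exact: sum_ord_lt (ltnW lt).
Qed.

Lemma flatten_singletons (x : seq bool) : flatten [seq [:: b] | b <- x] = x.
Proof. by elim: x => //= b x ->. Qed.

Section TableWord.
Variables (B : nat) (tb0 : nat -> nat -> nat -> bool).
Definition table_word :=
  mkseq (fun q => tb0 (q %/ (B * B)) ((q %/ B) %% B) (q %% B)) (9 * (B * B)).

Lemma nth_table_word r i j : r < 9 -> i < B -> j < B ->
  nth false table_word ((r * B + i) * B + j) = tb0 r i j.
Proof.
move=> Hr Hi Hj; have B0 : 0 < B by apply: leq_trans Hj.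
have E1 : ((r * B + i) * B + j) %/ B = r * B + i by rewrite divnMDl // divn_small // addn0.
have E2 : ((r * B + i) * B + j) %% B = j by rewrite modnMDl modn_small.
rewrite nth_mkseq; last first.
  have : (r * B + i).+1 * B <= (9 * B) * B; last by rewrite mulnA; lia.
  rewrite leq_mul2r; apply/orP; right.
  have : r.+1 * B <= 9 * B by rewrite leq_mul2r; apply/orP; right.
  lia.
by rewrite divnMA E1 E2 divnMDl // modnMDl divn_small // addn0 modn_small.
Qed.
End TableWord.

Lemma cnt_table_word x tb0 r i k : r < 9 -> i <= size x -> k <= (size x).+1 ->
  (forall j, tb0 r i j = (j < k)) ->
  cnt (code_pair x (table_word (size x).+1 tb0)) (size x) r i = k.
Proof.
move=> Hr Hi Hk H; rewrite /cnt /nsum -[RHS](sum_ord_lt Hk); apply: eq_bigr => j _.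
rewrite /tab -H -(nth_table_word (B := (size x).+1)) //.
rewrite /code_pair /code_seq flatten_singletons nth_cat size_cat /code_nat size_rcons size_nseq.
case: ltnP; [lia|] => _; congr nat_of_bool; congr nth; lia.
Qed.

Lemma tab_table_word x tb0 r i : r < 9 -> i <= size x ->
  tab (code_pair x (table_word (size x).+1 tb0)) (size x) r i 0 = tb0 r i 0.
Proof.
move=> Hr Hi; rewrite /tab -(nth_table_word (B := (size x).+1)) //.
rewrite /code_pair /code_seq flatten_singletons nth_cat size_cat /code_nat size_rcons size_nseq.
case: ltnP; [lia|] => _; congr nth; lia.
Qed.

Lemma verify_sound (R : realType) x w :
  verify (code_pair x w) -> linked_planar_3SAT R exactly_three_variables x.
Proof.
case/has_iotaP=> N _ /andP[/eqP ->]; rewrite ones_code_pair; last first.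
  rewrite /code_pair /code_seq flatten_singletons !size_cat /code_nat size_rcons size_nseq; lia.
case/andP=> Hok /andP[/eqP Hs]; rewrite /code_pair /code_seq flatten_singletons -catA.
have {1}-> : (size x).+1 = size (code_nat (size x)) by rewrite /code_nat size_rcons size_nseq.
rewrite occurs_at_eq; last by rewrite -[RHS]Hs /code_pair /code_seq flatten_singletons -catA.
by move=> /eqP E; rewrite E; move: Hok; rewrite /code_pair /code_seq flatten_singletons -catA => /cert_sound; apply.
Qed.

Lemma linked_planar_3SAT_in_NP (R : realType) :
  in_NP (linked_planar_3SAT R exactly_three_variables).
Proof.
exists verify, 9, 2; split; first exact: polytime_verify.
move=> x; split; last by case=> w [_ /(verify_sound R)].
case=> n [m [phi [kappa [Ex [Hd H3 Hham [s [t Ek]] Hpl] Hex [a Ha]]]]].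
rewrite {}Ek in Ex Hham Hpl; have [color Hpg] := planar_pages Hham Hpl.
have Ui (i : 'I_m) : uniq (map fst (tnth phi i)) /\ size (tnth phi i) = 3.
  have h3 := H3 _ (mem_tnth i phi); have := Hex _ (mem_tnth i phi); rewrite /clause_vars => Es.
  have le := size_undup (map fst (tnth phi i)); rewrite size_map Es in le.
  have sz : size (tnth phi i) = 3 by apply/eqP; rewrite eqn_leq h3 le.
  by split=> //; apply/negPn/negP; rewrite -ltn_size_undup Es size_map sz.
have [Hsz Hu Hall] := Hham.
have ms i : i \in s by have := Hall (inl i); rewrite mem_cat => /orP[/mapP[j Hj [->]]//|/mapP[]].
have mt v : v \in t by have := Hall (inr v); rewrite mem_cat => /orP[/mapP[]//|/mapP[j Hj [->]]].
have [us ut] : uniq s /\ uniq t.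
  move: Hu; rewrite cat_uniq => /and3P[+ _ +]; rewrite !map_inj_uniq //; by move=> ? ? [].
have ss : size s = m by rewrite -(card_uniqP us) (eq_card (B := predT)) ?card_ord // => i; rewrite ms.
have st : size t = n by rewrite -(card_uniqP ut) (eq_card (B := predT)) ?card_ord // => i; rewrite mt.
(* Each clause occupies at least three bits of the code. Thus every line number [3 * i + k] with
   [i < m] and [k < 3] fits into the table. *)
have [nx mx] : n <= size x /\ 3 * m <= size x.
  rewrite Ex /code_instance /code_seq !size_cat size_tuple /code_nat !size_rcons !size_nseq.
  set f := (F in flatten (map F (tval phi))).
  have : 3 * size phi <= size (flatten (map f (tval phi))).
    apply: leq_trans (leqnn _).
    have : all (fun c => 3 <= size (f c)) (tval phi).
      apply/allP => c /tnthP[i ->]; rewrite /f size_cat /code_nat size_rcons size_nseq.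
      by rewrite (proj2 (Ui i)); lia.
    elim: (tval phi) => //= c l IH /andP[h1 /IH h2]; rewrite size_cat mulnS.
    exact: leq_add.
  by rewrite size_tuple; set q := size (flatten _) => h; split; rewrite ?size_tuple; lia.
have x1 : 0 < size x by move: Hsz; rewrite size_cat !size_map ss st; lia.
pose lit i k : nat * bool := if insub i is Some i' then
  nth (0, false) [seq (nat_of_ord l.1, l.2) | l <- tnth phi i'] k else (0, false).
pose cl0 i k : bool := if insub i is Some i' then
  nth false [seq color i' l.1 | l <- tnth phi i'] k else false.
pose pc0 i := if insub i is Some i' then index (i' : 'I_m) s else 0.
pose pv0 i := if insub i is Some i' then index (i' : 'I_n) t else 0.
pose asg0 i := if insub i is Some i' then a i' else false.
pose tb0 r i j : bool := match r with
  | 0 => if i == 0 then j < n else j < m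
  | 1 => j < (lit (i %/ 3) (i %% 3)).1
  | 2 => (lit (i %/ 3) (i %% 3)).2
  | 3 => j < nth 0 (map val s) i
  | 4 => j < nth 0 (map val t) i
  | 5 => j < pc0 i
  | 6 => j < pv0 i
  | 7 => cl0 (i %/ 3) (i %% 3)
  | _ => asg0 i end.
exists (table_word (size x).+1 tb0); split.
  by rewrite size_mkseq mulnn.
set z := code_pair _ _.
have zx : size x < size z.
  rewrite /z /code_pair /code_seq flatten_singletons !size_cat /code_nat size_rcons size_nseq; lia.
apply/has_iotaP; exists (size x); first exact: leq_trans zx _.
rewrite ones_code_pair // eqxx /=.
have litlt i k : (lit i k).1 <= n.
  rewrite /lit; case: insubP => [i' _ _|_] //=.
  case: (ltnP k (size (tnth phi i'))) => hk; last by rewrite nth_default ?size_map.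
  have l0 : literal n by case: (tnth phi i') hk.
  by rewrite (nth_map l0) //= ltnW.
have En : tn z (size x) = n by apply: cnt_table_word => //; lia.
have Em : tm z (size x) = m by apply: cnt_table_word => //; lia.
have d3 i k : k < 3 -> (3 * i + k) %/ 3 = i /\ (3 * i + k) %% 3 = k by lia.
have Elv i k : i < m -> k < 3 -> tlv z (size x) i k = (lit i k).1.
  move=> Hi Hk; have [e1 e2] := d3 i k Hk.
  by apply: cnt_table_word => // [||j]; rewrite /= ?e1 ?e2 //; [lia | apply: leq_trans (litlt _ _) _; lia].
have Esg i k : i < m -> k < 3 -> tsg z (size x) i k = (lit i k).2.
  move=> Hi Hk; have [e1 e2] := d3 i k Hk.
  by rewrite /tsg /z tab_table_word //= ?e1 ?e2 //; lia.
have Ecl i k : i < m -> k < 3 -> tcl z (size x) i k = cl0 i k.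
  move=> Hi Hk; have [e1 e2] := d3 i k Hk.
  by rewrite /tcl /z tab_table_word //= ?e1 ?e2 //; lia.
have nths i : nth 0 (map val s) i <= m.
  case: (ltnP i (size s)) => hi; last by rewrite nth_default ?size_map.
  by rewrite (nth_map (nth (Ordinal (leq_trans hi (eq_leq ss))) s i)) //= ltnW.
have ntht i : nth 0 (map val t) i <= n.
  case: (ltnP i (size t)) => hi; last by rewrite nth_default ?size_map.
  by rewrite (nth_map (nth (Ordinal (leq_trans hi (eq_leq st))) t i)) //= ltnW.
have Ecs i : i < m -> tcs z (size x) i = nth 0 (map val s) i.
  by move=> Hi; apply: cnt_table_word => //; [lia | apply: leq_trans (nths _) _; lia].
have Evs i : i < n -> tvs z (size x) i = nth 0 (map val t) i.
  by move=> Hi; apply: cnt_table_word => //; [lia | apply: leq_trans (ntht _) _; lia].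
have Epc (i : 'I_m) : tpc z (size x) i = index i s.
  apply: cnt_table_word => //; first by have := ltn_ord i; lia.
    by apply: leq_trans (index_size _ _) _; rewrite ss; lia.
  by move=> j; rewrite /= /pc0 valK.
have Epv (i : 'I_n) : tpv z (size x) i = index i t.
  apply: cnt_table_word => //; first by have := ltn_ord i; lia.
    by apply: leq_trans (index_size _ _) _; rewrite st; lia.
  by move=> j; rewrite /= /pv0 valK.
have Easg (i : 'I_n) : tasg z (size x) i = a i.
  by rewrite /tasg /z tab_table_word //= ?/asg0 ?valK //; have := ltn_ord i; lia.
have [] := @cert_complete n m phi s t color a (tlv z (size x)) (tsg z (size x)) (tcl z (size x))
  (tcs z (size x)) (tvs z (size x)) (tpc z (size x)) (tpv z (size x)) (tasg z (size x))
  Hd H3 Hham Hex Hpg Ha.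
- move=> i; apply: (@eq_from_nth _ (0, false)); first by rewrite !size_map size_iota (proj2 (Ui i)).
  move=> k; rewrite size_map size_iota => hk.
  by rewrite (nth_map 0) ?size_iota // nth_iota // add0n Elv // Esg // -surjective_pairing /lit valK.
- move=> i; apply: (@eq_from_nth _ false); first by rewrite !size_map size_iota (proj2 (Ui i)).
  move=> k; rewrite size_map size_iota => hk.
  by rewrite (nth_map 0) ?size_iota // nth_iota // add0n Ecl // /cl0 valK.
- apply: (@eq_from_nth _ 0); first by rewrite !size_map size_iota ss.
  move=> k; rewrite size_map size_iota => hk.
  by rewrite (nth_map 0) ?size_iota // nth_iota // add0n Ecs.
- apply: (@eq_from_nth _ 0); first by rewrite !size_map size_iota st.
  move=> k; rewrite size_map size_iota => hk.
  by rewrite (nth_map 0) ?size_iota // nth_iota // add0n Evs.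
- exact: Epc.
- exact: Epv.
- exact: Easg.
move=> Hok Hcode; rewrite /table_ok /tcode En Em Hok /= Hcode -Ex eqxx /=.
rewrite /z /code_pair /code_seq flatten_singletons -catA.
have E : (size x).+1 = size (code_nat (size x)) by rewrite /code_nat size_rcons size_nseq.
by rewrite [X in occurs_at _ X _]E occurs_at_eq.
Qed.

(** * Gadgets *)

(* A literal (side, variable, sign); the side is the page of its edge. *)
Definition slit := (bool * nat * bool)%type.
Definition sclause := seq slit.

Definition lsat (v : nat -> bool) (l : slit) := v l.1.2 == l.2.
Definition csat v (c : sclause) := has (lsat v) c.

(** Later clauses read later variables on each page. This becomes the non-interleaving condition
    once the variables are placed on the cycle in decreasing order. *)
Definition cmono (c c' : sclause) :=
  all (fun l : slit => all (fun l' : slit => (l.1.1 == l'.1.1) ==> (l.1.2 <= l'.1.2)) c') c.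

(* A gadget reads variables b, ..., b + inw of a row and variables a, ..., a + outw
   of the next row; (true, i, _) stands for a + i and (false, i, _) for b + i. *)
Record gadget := Gadget { inw : nat; outw : nat; gcl : seq sclause }.

Definition place a b (l : slit) : slit := (l.1.1, (if l.1.1 then a else b) + l.1.2, l.2).
Definition gclauses (K : gadget) a b : seq sclause := map (map (place a b)) (gcl K).

Definition gcat (K K' : gadget) : gadget :=
  Gadget (inw K + inw K') (outw K + outw K') (gcl K ++ gclauses K' (outw K) (inw K)).

Fixpoint stream a b (Ks : seq gadget) : seq sclause :=
  if Ks is K :: Ks' then gclauses K a b ++ stream (a + outw K) (b + inw K) Ks' else [::].

Definition A i s : slit := (true, i, s).
Definition B i s : slit := (false, i, s).

(** Passes the padding on: if the last two bits read, [B i] and [B i.+1], are false, so are the last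
    two bits written. *)
Definition closing i j := [:: [:: B i true; B i.+1 true; A j false];
                             [:: A j.+1 false; A j true; B i.+1 true]].

(** With [B 0] and [B 2] false, the first two clauses are the two implications between [A 1] and
    [B 1]. *)
Definition Copy := Gadget 3 3
  ([:: [:: B 0 true; B 1 true; A 1 false]; [:: B 1 false; B 2 true; A 1 true]] ++ closing 2 2).
(** The three splits in a row lead from [[x, 0, 0]] to [[p, 0, 0, q, 0, 0]] with [x <= p] and
    [q = ~~ x]. [Split1] produces [p] and [q] side by side; the other two insert zeros between
    them. *)
Definition Split1 := Gadget 3 4
  ([:: [:: A 0 true; A 1 true; B 1 false]; [:: A 1 false; A 2 false; B 1 false];
       [:: B 1 true; B 2 true; A 2 true]] ++ closing 2 3).
Definition Split2 := Gadget 4 5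
  ([:: [:: A 0 true; A 1 true; B 1 false]; [:: A 1 false; A 2 false; B 1 false];
       [:: B 1 true; B 2 false; A 2 false]; [:: A 2 true; A 3 false; B 2 true];
       [:: B 2 false; B 3 true; A 3 true]] ++ closing 3 4).
Definition Split3 := Gadget 5 6
  ([:: [:: A 0 true; A 1 true; B 1 false]; [:: A 1 false; A 2 false; B 1 false];
       [:: B 1 true; B 2 true; A 2 false]; [:: A 2 true; A 3 false; B 2 true];
       [:: B 2 true; B 3 true; A 4 false]; [:: B 3 false; B 4 true; A 4 true]] ++ closing 4 5).
(** With the neighbours [B 0] and [B 5] false, the clauses say that [A 1] lies between [B 1] and
    [~~ B 4]. *)
Definition Merge := Gadget 6 3
  ([:: [:: B 0 true; B 1 false; A 1 true]; [:: B 4 false; B 5 true; A 1 false]] ++ closing 5 2).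
(** The operands are [B 1] and [B 7]. No clause reads [B 4], the bit that is being overwritten. *)
Definition Nand := Gadget 9 3
  ([:: [:: B 0 true; B 1 true; A 1 true]; [:: B 1 false; B 7 false; A 1 false];
       [:: B 7 true; B 8 true; A 1 true]] ++ closing 8 2).
Definition Skip n := Gadget n 0 [::].
(** With [B 2] and [B 3] false the second clause makes [A 1] false, and then the first demands
    [B 1]. *)
Definition Assert := Gadget 3 1 [:: [:: B 1 true; B 2 true; A 1 true]; [:: B 2 true; B 3 true; A 1 false]].

(** Splitting [x] gives [p >= x] and [~~ x]; splitting the latter gives [q >= ~~ x] and [x] again.
    [Merge] asks for a bit between [p] and [~~ q], which can only be [x]. So two items [x]
    remain. *)
Definition Dup (s : nat) : gadget := match s with
  | 0 => Split1 | 1 => Split2 | 2 => Split3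
  | 3 => gcat Copy Split1 | 4 => gcat Copy Split2 | 5 => gcat Copy Split3
  | _ => gcat Merge Copy end.

Definition gadget_ok (K : gadget) : bool :=
  [&& all (fun c => [&& size c == 3, uniq [seq l.1 | l <- c], has (fun l : slit => l.1.1) c,
       has (fun l : slit => ~~ l.1.1) c &
       all (fun l : slit => l.1.2 <= if l.1.1 then outw K else inw K) c]) (gcl K),
      pairwise cmono (gcl K), inw K <= 10 & outw K <= 10].

(** The extra [false] in front of each word is the boundary variable shared with the preceding
    gadget. *)
Definition gsat (K : gadget) (bv av : seq bool) : bool :=
  all (has (fun l : slit => nth false (false :: if l.1.1 then av else bv) l.1.2 == l.2)) (gcl K).

Fixpoint strs n : seq (seq bool) :=
  if n is n'.+1 then [seq true :: w | w <- strs n'] ++ [seq false :: w | w <- strs n'] else [:: [::]].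

Definition post K (X : seq (seq bool)) :=
  [seq av <- strs (outw K) | has (fun bv => gsat K bv av) X].

Definition fits K (X Y : seq (seq bool)) : bool :=
  all (fun w => (size w == inw K) && ~~ last false w) X &&
  all (fun w => (size w == outw K) && ~~ last false w) Y.

(** [forces] is used to read a run off a satisfying assignment, [allows] to build an assignment from
    a run. For the intermediate stages of a duplication they hold for different sets of words. *)
Definition forces K (X Y : seq (seq bool)) : bool :=
  fits K X Y &&
  all (fun av => (has (fun bv => gsat K bv av) X) ==> (av \in Y)) (strs (outw K)).

Definition allows K (X Y : seq (seq bool)) : bool :=
  fits K X Y && all (fun bv => has (fun av => gsat K bv av) Y) X.

Definition item z := [:: z; false; false].

Fixpoint dup_set x (s : nat) : seq (seq bool) :=
  if s is s'.+1 then post (Dup s') (dup_set x s') else [:: item x].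

Lemma gadget_ok_Copy : gadget_ok Copy. Proof. by vm_compute. Qed.
Lemma gadget_ok_Nand : gadget_ok Nand. Proof. by vm_compute. Qed.
Lemma gadget_ok_Assert : gadget_ok Assert. Proof. by vm_compute. Qed.
Lemma gadget_ok_Skip n : n <= 10 -> gadget_ok (Skip n). Proof. by rewrite /gadget_ok /= => ->. Qed.

Lemma gadget_ok_Dup k : gadget_ok (Dup k).
Proof. by case: k => [|[|[|[|[|[|k]]]]]]; vm_compute. Qed.

(* On the other words of [dup_set x s] the duplication may get stuck in [Merge]. *)
Definition dup_word x s := last [::] (dup_set x s).

Lemma Copy_forces z : forces Copy [:: item z] [:: item z].
Proof. by case: z; vm_compute. Qed.

Lemma Copy_allows z : allows Copy [:: item z] [:: item z].
Proof. by case: z; vm_compute. Qed.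

Lemma dup_set_final x : dup_set x 7 = [:: item x ++ item x].
Proof. by case: x; vm_compute. Qed.

Lemma dup_checks : all (fun s => all (fun x => forces (Dup s) (dup_set x s) (dup_set x s.+1) &&
    allows (Dup s) [:: dup_word x s] [:: dup_word x s.+1])
  [:: true; false]) (iota 0 7).
Proof. by vm_compute. Qed.

Lemma Dup_ok x s : s < 7 -> forces (Dup s) (dup_set x s) (dup_set x s.+1) /\
  allows (Dup s) [:: dup_word x s] [:: dup_word x s.+1].
Proof.
move=> Hs; have Hs' : s \in iota 0 7 by rewrite mem_iota.
by have /allP H := allP dup_checks _ Hs'; apply/andP; apply: (H x); case: (x).
Qed.

Lemma Nand_ok p y q : forces Nand [:: item p ++ item y ++ item q] [:: item (~~ (p && q))] &&
  allows Nand [:: item p ++ item y ++ item q] [:: item (~~ (p && q))].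
Proof. by case: p; case: y; case: q; vm_compute. Qed.

Lemma Assert_ok z : forces Assert [:: item z] (if z then [:: [:: false]] else [::]) &&
  allows Assert [:: item true] [:: [:: false]].
Proof. by case: z; vm_compute. Qed.

Lemma Skip_ok n (X : seq (seq bool)) : all (fun w => (size w == n) && ~~ last false w) X ->
  forces (Skip n) X [:: [::]] && allows (Skip n) X [:: [::]].
Proof.
move=> H; rewrite /forces /allows /fits H /= andbT implybT /=.
by apply/allP.
Qed.

(** * Reading one row and writing the next *)

Definition rd (v : nat -> bool) b n := [seq v i | i <- iota b.+1 n].

Lemma rdD v b n1 n2 : rd v b (n1 + n2) = rd v b n1 ++ rd v (b + n1) n2.
Proof. by rewrite /rd iotaD map_cat addSn. Qed.

Lemma size_rd v b n : size (rd v b n) = n.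
Proof. by rewrite size_map size_iota. Qed.

Lemma eq_rd v v' b n : (forall i, b < i <= b + n -> v i = v' i) -> rd v b n = rd v' b n.
Proof. by move=> H; apply/eq_in_map => i; rewrite mem_iota => Hi; apply: H; lia. Qed.

Lemma nth_rd v b n i : i <= n -> nth false (v b :: rd v b n) i = v (b + i).
Proof.
case: i => [|i] Hi /=; first by rewrite addn0.
by rewrite (nth_map 0) ?size_iota // nth_iota // addSnnS.
Qed.

Lemma last_rd v b n w : v b = false -> rd v b n = w -> last false w = v (b + n).
Proof.
move=> Hb <-; rewrite -(@nth_rd v b n n) // Hb.
by have := nth_last false (false :: rd v b n); rewrite /= size_rd => <-.
Qed.

Lemma mem_strs n w : (w \in strs n) = (size w == n).
Proof.
elim: n w => [|n IH] [|b w] //=; rewrite mem_cat.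
  by apply/negbTE; rewrite negb_or; apply/andP; split; apply/mapP => -[].
rewrite eqSS -IH; apply/orP/idP => [[] /mapP[w' Hw' [_ ->]] //|Hw].
by case: b; [left | right]; apply: map_f.
Qed.

Definition fsat v (cs : seq sclause) := all (csat v) cs.

Lemma gsat_rd K v a b : gadget_ok K -> v a = false -> v b = false ->
  fsat v (gclauses K a b) = gsat K (rd v b (inw K)) (rd v a (outw K)).
Proof.
case/andP=> /allP H _ Ha Hb; rewrite /fsat /gclauses /gsat all_map; apply: eq_in_all => c Hc /=.
rewrite /csat has_map; apply: eq_in_has => l Hl /=.
have /and5P[_ _ _ _ /allP Hall] := H c Hc; have := Hall l Hl; rewrite /lsat /=.
by case: (l.1.1) => le; [rewrite -{2}Ha nth_rd | rewrite -{2}Hb nth_rd].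
Qed.

Fixpoint reads v b (ws : seq (nat * seq (seq bool))) : Prop :=
  if ws is (n, X) :: ws' then rd v b n \in X /\ reads v (b + n) ws' else True.

Lemma eq_reads v v' b ws : (forall i, b < i <= b + sumn [seq w.1 | w <- ws] -> v i = v' i) ->
  reads v b ws -> reads v' b ws.
Proof.
elim: ws b => [|[n X] ws IH] b //= H [H1 H2]; split.
  by rewrite -(eq_rd (v := v)) // => i Hi; apply: H; lia.
by apply: IH H2 => i Hi; apply: H; lia.
Qed.

(* A pass: gadgets with the sets of words they read and write. *)
Definition gadget_step := (gadget * seq (seq bool) * seq (seq bool))%type.
Definition gads (p : seq gadget_step) := [seq t.1.1 | t <- p].
Definition ins (p : seq gadget_step) := [seq (inw t.1.1, t.1.2) | t <- p].
Definition outs (p : seq gadget_step) := [seq (outw t.1.1, t.2) | t <- p].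
Definition pass_forces (p : seq gadget_step) :=
  all (fun t : gadget_step => gadget_ok t.1.1 && forces t.1.1 t.1.2 t.2) p.
Definition pass_allows (p : seq gadget_step) :=
  all (fun t : gadget_step => gadget_ok t.1.1 && allows t.1.1 t.1.2 t.2) p.

Lemma fsat_cat v c1 c2 : fsat v (c1 ++ c2) = fsat v c1 && fsat v c2.
Proof. exact: all_cat. Qed.

(** The invariant is that both current positions carry false: every word read or written ends in
    false, so the next gadget starts correctly. *)
Lemma pass_sound v p a b : pass_forces p -> v a = false -> v b = false ->
  reads v b (ins p) -> fsat v (stream a b (gads p)) ->
  reads v a (outs p) /\ v (a + sumn [seq w.1 | w <- outs p]) = false.
Proof.
elim: p a b => [|[[K X] Y] p IH] a b /=; first by rewrite addn0.
case/andP=> /andP[Kok /andP[/andP[/allP HX /allP HY] /allP Hs]] pok Ha Hb [HbX Hr].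
rewrite fsat_cat gsat_rd // => /andP[Hg Hst].
have HaY : rd v a (outw K) \in Y.
  have /Hs /implyP : rd v a (outw K) \in strs (outw K) by rewrite mem_strs size_rd.
  by apply; apply/hasP; exists (rd v b (inw K)).
have /andP[_ lX] := HX _ HbX; have /andP[_ lY] := HY _ HaY.
rewrite (last_rd Hb erefl) in lX; rewrite (last_rd Ha erefl) in lY.
have [h1 h2] := IH (a + outw K) (b + inw K) pok (negbTE lY) (negbTE lX) Hr Hst.
by rewrite addnA.
Qed.

Definition overwrite (v : nat -> bool) a (w : seq bool) i :=
  if a < i <= a + size w then nth false w (i - a.+1) else v i.

Lemma rd_overwrite v a w : rd (overwrite v a w) a (size w) = w.
Proof.
apply: (@eq_from_nth _ false) => [|i]; rewrite size_rd // => Hi.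
rewrite (nth_map 0) ?size_iota // nth_iota // /overwrite.
by case: ifP => [_|/negP[]]; [congr nth; lia | lia].
Qed.

Lemma eq_fsat v v' (cs : seq sclause) : (forall (c : sclause) (l : slit), c \in cs -> l \in c -> v l.1.2 = v' l.1.2) ->
  fsat v cs -> fsat v' cs.
Proof.
move=> H /allP Hs; apply/allP => c Hc; have /hasP[l Hl Hv] := Hs c Hc.
by apply/hasP; exists l; rewrite // /lsat -(H c).
Qed.

Lemma gclauses_bound K a b (c : sclause) (l : slit) : gadget_ok K -> c \in gclauses K a b -> l \in c ->
  if l.1.1 then a <= l.1.2 <= a + outw K else b <= l.1.2 <= b + inw K.
Proof.
case/andP=> /allP H _ /mapP[c0 Hc0 ->] /mapP[l0 Hl0 ->].
have /and5P[_ _ _ _ /allP /(_ l0 Hl0)] := H c0 Hc0; rewrite /place /=.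
by case: (l0.1.1); lia.
Qed.

(** The assignment is extended from left to right. Values change only beyond [a], and all words
    still to be read end at or before [a]. *)
Lemma pass_total v p a b : pass_allows p -> v a = false -> v b = false ->
  b + sumn [seq w.1 | w <- ins p] <= a -> reads v b (ins p) ->
  exists v', [/\ forall i, i <= a -> v' i = v i, fsat v' (stream a b (gads p)),
    reads v' a (outs p) & v' (a + sumn [seq w.1 | w <- outs p]) = false].
Proof.
elim: p v a b => [|[[K X] Y] p IH] v a b /=; first by move=> _ Ha; exists v; rewrite addn0.
case/andP=> /andP[Kok /andP[/andP[/allP HX /allP HY] /allP Ht]] pok Ha Hb le [HbX Hr].
have le1 : b + inw K <= a by apply: leq_trans le; rewrite addnA leq_addr.
have le0 : b <= a := leq_trans (leq_addr _ _) le1.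
have le2 : b + inw K + sumn [seq w.1 | w <- ins p] <= a + outw K.
  by rewrite -addnA; apply: leq_trans le (leq_addr _ _).
have /hasP[av HavY Hg] := Ht _ HbX.
have /andP[/eqP sav lav] := HY _ HavY; have /andP[_ lX] := HX _ HbX.
rewrite (last_rd Hb erefl) in lX.
pose v1 := overwrite v a av.
have v1v i : i <= a -> v1 i = v i by rewrite /v1 /overwrite ltnNge => ->.
have rav : rd v1 a (outw K) = av by rewrite -sav rd_overwrite.
have Ha1 : v1 (a + outw K) = false.
  by apply/negbTE; rewrite -(last_rd _ rav) // v1v.
have [|//||v' [E S1 S2 S3]] := IH v1 (a + outw K) (b + inw K) pok Ha1.
- by rewrite v1v ?(negbTE lX).
- apply: eq_reads Hr => i /andP[_ Hi]; rewrite v1v //.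
  by apply: leq_trans Hi _; rewrite -addnA.
have E2 i : i <= a -> v' i = v i by move=> Hi; rewrite E ?v1v //; apply: leq_trans Hi (leq_addr _ _).
have rav' : rd v' a (outw K) = av by rewrite -rav; apply: eq_rd => i /andP[_ Hi]; rewrite E.
exists v'; split=> //; last by rewrite addnA.
- rewrite fsat_cat S1 andbT gsat_rd ?E2 // rav'.
  have -> // : rd v' b (inw K) = rd v b (inw K).
  by apply: eq_rd => i /andP[_ Hi]; rewrite E2 // (leq_trans Hi).
- by split=> //; rewrite rav'.
Qed.

(** * Instructions that rewrite one cell of a row *)

Inductive op := KeepL | KeepR | NandOp.
Definition row_instr := (op * nat)%type.

Definition opval o (x w : bool) := match o with KeepL => x | KeepR => w | NandOp => ~~ (x && w) end.

Definition exec1 (s : nat -> bool) (I : row_instr) : nat -> bool :=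
  fun i => if i == I.2.+1 then opval I.1 (s I.2) (s I.2.+2) else s i.

(** Seven passes duplicate both neighbours of the cell. The eighth finds the items [x], [x], [y],
    [w], [w] and returns three: the outer copies survive, the inner ones are spent on the new middle
    item. *)
Definition window o k : seq gadget :=
  if k < 7 then [:: Dup k; Copy; Dup k] else match o with
  | KeepL => [:: Copy; Copy; Skip 6; Copy]
  | KeepR => [:: Copy; Skip 6; Copy; Copy]
  | NandOp => [:: Copy; Nand; Copy] end.

Definition pass L (I : row_instr) k := nseq I.2 Copy ++ window I.1 k ++ nseq (L - I.2 - 3) Copy.
Definition instr_gads L I := flatten [seq pass L I k | k <- iota 0 8].

Definition inws Ks := sumn [seq inw K | K <- Ks].
Definition outws Ks := sumn [seq outw K | K <- Ks].

Lemma inws_cons K Ks : inws (K :: Ks) = inw K + inws Ks. Proof. by []. Qed.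
Lemma outws_cons K Ks : outws (K :: Ks) = outw K + outws Ks. Proof. by []. Qed.
Lemma inws_cat Ks Ks' : inws (Ks ++ Ks') = inws Ks + inws Ks'.
Proof. by rewrite /inws map_cat sumn_cat. Qed.
Lemma outws_cat Ks Ks' : outws (Ks ++ Ks') = outws Ks + outws Ks'.
Proof. by rewrite /outws map_cat sumn_cat. Qed.

Lemma stream_cat a b Ks Ks' :
  stream a b (Ks ++ Ks') = stream a b Ks ++ stream (a + outws Ks) (b + inws Ks) Ks'.
Proof.
elim: Ks a b => [|K Ks IH] a b /=; first by rewrite !addn0.
by rewrite IH catA /outws /inws /= !addnA.
Qed.

Lemma stream_bound Ks a b (c : sclause) (l : slit) : all gadget_ok Ks -> c \in stream a b Ks -> l \in c ->
  if l.1.1 then a <= l.1.2 <= a + outws Ks else b <= l.1.2 <= b + inws Ks.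
Proof.
elim: Ks a b => [|K Ks IH] a b //= /andP[Kok Kss]; rewrite mem_cat outws_cons inws_cons.
case/orP=> Hc Hl; first by have := gclauses_bound Kok Hc Hl; case: (l.1.1); lia.
by have := IH _ _ Kss Hc Hl; case: (l.1.1); lia.
Qed.

Lemma inws_gads p : inws (gads p) = sumn [seq w.1 | w <- ins p].
Proof. by rewrite /inws /gads /ins -!map_comp. Qed.

Lemma outws_gads p : outws (gads p) = sumn [seq w.1 | w <- outs p].
Proof. by rewrite /outws /gads /outs -!map_comp. Qed.

Definition width (X : seq (nat * seq (seq bool))) := sumn [seq w.1 | w <- X].

Fixpoint chain (ok : pred (seq gadget_step)) X (ps : seq (seq gadget_step)) Y : Prop :=
  if ps is p :: ps' then [/\ ins p = X, ok p & chain ok (outs p) ps' Y] else X = Y.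

Lemma chain_sound v X ps Y b : chain pass_forces X ps Y -> v b = false ->
  v (b + width X) = false -> reads v b X ->
  fsat v (stream (b + width X) b (flatten (map gads ps))) ->
  let b' := b + inws (flatten (map gads ps)) in
  [/\ v b' = false, v (b' + width Y) = false & reads v b' Y].
Proof.
elim: ps X b => [|p ps IH] X b /=; first by move=> <- *; rewrite /inws /= addn0.
case=> <- pok Hc Hb Ha Hr; rewrite stream_cat fsat_cat inws_gads outws_gads => /andP[H1 H2].
have [R1 R2] := pass_sound pok Ha Hb Hr H1.
have := IH _ (b + width (ins p)) Hc Ha R2 R1 H2.
by rewrite inws_cat inws_gads addnA.
Qed.

Lemma chain_total v X ps Y b : chain pass_allows X ps Y -> v b = false ->
  v (b + width X) = false -> reads v b X ->
  let b' := b + inws (flatten (map gads ps)) in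
  exists v', [/\ forall i, i <= b + width X -> v' i = v i,
    fsat v' (stream (b + width X) b (flatten (map gads ps))) &
    [/\ v' b' = false, v' (b' + width Y) = false & reads v' b' Y]].
Proof.
elim: ps X v b => [|p ps IH] X v b /=; first by move=> <- *; exists v; rewrite /inws /= addn0.
case=> <- pok Hc Hb Ha Hr; rewrite stream_cat inws_gads outws_gads.
have [v1 [E1 S1 R1 R2]] := pass_total pok Ha Hb (leqnn _) Hr.
have Ha1 : v1 (b + width (ins p)) = false by rewrite E1.
have [v2 [E2 S2 R3]] := IH _ v1 (b + width (ins p)) Hc Ha1 R2 R1.
exists v2; split.
- by move=> i Hi; rewrite E2 ?E1 //; apply: leq_trans Hi (leq_addr _ _).
- rewrite fsat_cat S2 andbT; apply: eq_fsat S1 => c l Hc' Hl; rewrite E2 //.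
  have pg : all gadget_ok (gads p).
    by rewrite all_map; apply: sub_all pok => t /andP[].
  have := stream_bound pg Hc' Hl; rewrite inws_gads outws_gads /width.
  by case: (l.1.1); lia.
- by move: R3; rewrite inws_cat inws_gads addnA.
Qed.

Definition items (s : nat -> bool) l : seq gadget_step :=
  [seq (Copy, [:: item (s i)], [:: item (s i)]) | i <- l].

(** [D] is [dup_set] when assignments are analysed and the single [dup_word] when one is
    constructed. *)
Definition stage (D : bool -> nat -> seq (seq bool)) s c d k : seq gadget_step :=
  items s (iota 0 c) ++
  [:: (Dup k, D (s c) k, D (s c) k.+1); (Copy, [:: item (s c.+1)], [:: item (s c.+1)]);
      (Dup k, D (s c.+2) k, D (s c.+2) k.+1)] ++ items s (iota c.+3 d).

Definition last_window o x y w : seq gadget_step :=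
  let C z : gadget_step := (Copy, [:: item z], [:: item z]) in
  match o with
  | KeepL => [:: C x; C x; (Skip 6, [:: item y ++ item w], [:: [::]]); C w]
  | KeepR => [:: C x; (Skip 6, [:: item x ++ item y], [:: [::]]); C w; C w]
  | NandOp => [:: C x; (Nand, [:: item x ++ item y ++ item w], [:: item (~~ (x && w))]); C w]
  end.

Definition last_stage o s c d : seq gadget_step :=
  items s (iota 0 c) ++ last_window o (s c) (s c.+1) (s c.+2) ++ items s (iota c.+3 d).

Lemma gads_items s l : gads (items s l) = nseq (size l) Copy.
Proof. by rewrite /gads /items -map_comp; elim: l => //= i l ->. Qed.

Lemma instr_gads_stages D o s c d : instr_gads (c + d.+3) (o, c) =
  flatten [seq gads (stage D s c d k) | k <- iota 0 7] ++ gads (last_stage o s c d).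
Proof.
rewrite /instr_gads (iotaD 0 7 1) map_cat flatten_cat.
have E : c + d.+3 - c - 3 = d by lia.
congr cat.
  congr flatten; apply/eq_in_map => k; rewrite mem_iota add0n => /andP[_ Hk].
  rewrite /pass /window E Hk /stage /gads !map_cat -!/(gads _) !gads_items !size_iota.
  by [].
rewrite /= cats0 /pass /last_stage /gads !map_cat -!/(gads _) !gads_items !size_iota E.
by case: o.
Qed.

Lemma forces_items s l : pass_forces (items s l).
Proof.
by rewrite /pass_forces all_map; elim: l => [|i l IH] //; rewrite [all _ _]/= IH Copy_forces.
Qed.

Lemma allows_items s l : pass_allows (items s l).
Proof.
by rewrite /pass_allows all_map; elim: l => [|i l IH] //; rewrite [all _ _]/= IH Copy_allows.
Qed.

Definition dup_words (D : bool -> nat -> seq (seq bool)) s c d k :=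
  ins (items s (iota 0 c)) ++
  [:: (if k is k'.+1 then outw (Dup k') else 3, D (s c) k); (3, [:: item (s c.+1)]);
      (if k is k'.+1 then outw (Dup k') else 3, D (s c.+2) k)] ++ ins (items s (iota c.+3 d)).

Lemma ins_cat p q : ins (p ++ q) = ins p ++ ins q. Proof. exact: map_cat. Qed.
Lemma outs_cat p q : outs (p ++ q) = outs p ++ outs q. Proof. exact: map_cat. Qed.
Lemma outs_items s l : outs (items s l) = ins (items s l).
Proof. by rewrite /outs /ins -!map_comp. Qed.

Lemma chain_stages (ok : pred (seq gadget_step)) D s c d j : (forall k, k < 7 -> ok (stage D s c d k)) -> j <= 7 ->
  chain ok (dup_words D s c d (7 - j)) [seq stage D s c d k | k <- iota (7 - j) j]
    (dup_words D s c d 7).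
Proof.
move=> H; elim: j => [|j IH] Hj //=.
have E : (7 - j.+1).+1 = 7 - j by lia.
split.
- rewrite /stage !ins_cat /dup_words; congr (_ ++ (_ ++ _)).
  by case: j {IH E} Hj => [|[|[|[|[|[|[|j]]]]]]].
- by apply: H; lia.
- have -> : outs (stage D s c d (7 - j.+1)) = dup_words D s c d (7 - j).
    by rewrite /stage !outs_cat !outs_items /dup_words -E.
  by rewrite E; apply: IH; lia.
Qed.

Definition words_of (ws : seq (seq bool)) := [seq (size w, [:: w]) | w <- ws].

Lemma reads_words v b ws : reads v b (words_of ws) <-> rd v b (size (flatten ws)) = flatten ws.
Proof.
elim: ws b => [|w ws IH] b //=; rewrite IH inE size_cat rdD; split=> [[/eqP -> ->] //|E].
have := congr1 (take (size w)) E; rewrite !take_size_cat ?size_rd // => ->.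
by have := congr1 (drop (size w)) E; rewrite !drop_size_cat ?size_rd // => ->.
Qed.

Definition row (s : nat -> bool) L := flatten [seq item (s i) | i <- iota 0 L].

Lemma size_items (s : nat -> bool) l : size (flatten [seq item (s i) | i <- l]) = 3 * size l.
Proof. by elim: l => //= i l ->; lia. Qed.

Lemma size_row s L : size (row s L) = 3 * L.
Proof. by rewrite size_items size_iota. Qed.

Lemma ins_items s l : ins (items s l) = words_of [seq item (s i) | i <- l].
Proof. by rewrite /ins /words_of -!map_comp. Qed.

Lemma words_of_cat w1 w2 : words_of (w1 ++ w2) = words_of w1 ++ words_of w2.
Proof. exact: map_cat. Qed.

Lemma row_window s c d : row s (c + d.+3) =
  flatten [seq item (s i) | i <- iota 0 c] ++ (item (s c) ++ item (s c.+1) ++ item (s c.+2)) ++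
  flatten [seq item (s i) | i <- iota c.+3 d].
Proof. by rewrite /row iotaD map_cat flatten_cat. Qed.

Lemma row_exec1 s o c d : row (exec1 s (o, c)) (c + d.+3) =
  flatten [seq item (s i) | i <- iota 0 c] ++
  (item (s c) ++ item (opval o (s c) (s c.+2)) ++ item (s c.+2)) ++
  flatten [seq item (s i) | i <- iota c.+3 d].
Proof.
have E i : i != c.+1 -> exec1 s (o, c) i = s i by rewrite /exec1 /= => /negbTE ->.
rewrite row_window.
have -> : exec1 s (o, c) c.+1 = opval o (s c) (s c.+2) by rewrite /exec1 /= eqxx.
rewrite (E c) ?(E c.+2); try lia.
congr (_ ++ (_ ++ _)); congr flatten; apply/eq_in_map => i; rewrite mem_iota => Hi; rewrite E //;
  lia.
Qed.

Definition mid_words s c d : seq (seq bool) :=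
  [seq item (s i) | i <- iota 0 c] ++
  [:: item (s c) ++ item (s c); item (s c.+1); item (s c.+2) ++ item (s c.+2)] ++
  [seq item (s i) | i <- iota c.+3 d].

(** The gadgets of the last pass group the bits into words differently from the preceding stage, so
    only the concatenation of the words is compared. *)
Lemma ins_last_stage o s c d : exists ws, ins (last_stage o s c d) = words_of ws /\
  flatten ws = flatten (mid_words s c d).
Proof.
pose mid := [seq t.1.2 | t <- last_window o (s c) (s c.+1) (s c.+2)].
exists ([seq item (s i) | i <- iota 0 c] ++ [seq head [::] X | X <- mid] ++
  [seq item (s i) | i <- iota c.+3 d]); split.
  rewrite /last_stage !ins_cat !ins_items !words_of_cat; congr (_ ++ (_ ++ _)).
  by case: o @mid.
by rewrite /mid_words !flatten_cat; congr (_ ++ (_ ++ _)); case: o @mid.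
Qed.

Lemma outs_last_stage o s c d : exists ws, outs (last_stage o s c d) = words_of ws /\
  flatten ws = row (exec1 s (o, c)) (c + d.+3).
Proof.
pose mid := [seq t.2 | t <- last_window o (s c) (s c.+1) (s c.+2)].
exists ([seq item (s i) | i <- iota 0 c] ++ [seq head [::] X | X <- mid] ++
  [seq item (s i) | i <- iota c.+3 d]); split.
  rewrite /last_stage !outs_cat !outs_items !ins_items !words_of_cat; congr (_ ++ (_ ++ _)).
  by case: o @mid.
by rewrite row_exec1 !flatten_cat; congr (_ ++ (_ ++ _)); case: o @mid.
Qed.

Lemma last_window_ok o x y w : pass_forces (last_window o x y w) && pass_allows (last_window o x y w).
Proof.
have gC := gadget_ok_Copy; have gN := gadget_ok_Nand.
have gS : gadget_ok (Skip 6) by apply: gadget_ok_Skip.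
have sk z z' : forces (Skip 6) [:: item z ++ item z'] [:: [::]] &&
   allows (Skip 6) [:: item z ++ item z'] [:: [::]] by apply: Skip_ok.
have /andP[s1 s2] := sk y w; have /andP[s3 s4] := sk x y; have /andP[n1 n2] := Nand_ok x y w.
rewrite /pass_forces /pass_allows.
by case: o; rewrite ![all _ _]/= !Copy_forces !Copy_allows ?s1 ?s2 ?s3 ?s4 ?n1 ?n2 ?gC ?gS ?gN.
Qed.

Lemma size_words ws : width (words_of ws) = size (flatten ws).
Proof. by rewrite /width size_flatten /words_of -map_comp. Qed.

Definition row_at v b s L := [/\ v b = false, v (b + 3 * L) = false & rd v b (3 * L) = row s L].
(** Distance between a row and the row eight passes later: the duplication passes read [21 * L + 42]
    bits in all and the last pass [3 * L + 6]. *)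
Definition instr_vars L := 24 * L + 48.

Lemma inws_stages D s c d :
  inws (flatten [seq gads (stage D s c d k) | k <- iota 0 7]) = 21 * (c + d.+3) + 42.
Proof.
have H k : inws (gads (stage D s c d k)) = 3 * c + (2 * inw (Dup k) + 3) + 3 * d.
  rewrite /stage /gads !map_cat -!/(gads _) !gads_items !size_iota !inws_cat /inws !map_nseq /=.
  by rewrite !sumn_nseq; lia.
rewrite /= !inws_cat !H /inws /=; lia.
Qed.

Lemma dup_words0 (D : bool -> nat -> seq (seq bool)) s c d : (forall x, D x 0 = [:: item x]) ->
  dup_words D s c d 0 = words_of [seq item (s i) | i <- iota 0 (c + d.+3)].
Proof.
by move=> D0; rewrite /dup_words !D0 !ins_items iotaD map_cat words_of_cat.
Qed.

Lemma dup_words7 (D : bool -> nat -> seq (seq bool)) s c d :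
  (forall x, D x 7 = [:: item x ++ item x]) ->
  dup_words D s c d 7 = words_of (mid_words s c d).
Proof. by move=> D7; rewrite /dup_words !D7 !ins_items /mid_words !words_of_cat. Qed.

Lemma outws_stages D s c d :
  outws (flatten [seq gads (stage D s c d k) | k <- iota 0 7]) = 21 * (c + d.+3) + 48.
Proof.
have H k : outws (gads (stage D s c d k)) = 3 * c + (2 * outw (Dup k) + 3) + 3 * d.
  rewrite /stage /gads !map_cat -!/(gads _) !gads_items !size_iota !outws_cat /outws !map_nseq /=.
  by rewrite !sumn_nseq; lia.
rewrite /= !outws_cat !H /outws /=; lia.
Qed.

Lemma forces_stage s c d k : k < 7 -> pass_forces (stage dup_set s c d k).
Proof.
move=> Hk; rewrite /pass_forces /stage !all_cat -!/(pass_forces _) !forces_items andbT /=.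
by apply/and4P; split=> //; rewrite ?gadget_ok_Dup ?Copy_forces //; exact: (proj1 (Dup_ok _ Hk)).
Qed.

Lemma allows_stage s c d k : k < 7 -> pass_allows (stage (fun x k => [:: dup_word x k]) s c d k).
Proof.
move=> Hk; rewrite /pass_allows /stage !all_cat -!/(pass_allows _) !allows_items andbT /=.
by apply/and4P; split=> //; rewrite ?gadget_ok_Dup ?Copy_allows //; exact: (proj2 (Dup_ok _ Hk)).
Qed.

Lemma size_mid_words s c d : size (flatten (mid_words s c d)) = 3 * (c + d.+3) + 6.
Proof.
by rewrite /mid_words !flatten_cat !size_cat !size_items !size_iota /=; lia.
Qed.

Lemma instr_sound v b s L I : I.2.+2 < L -> row_at v b s L ->
  fsat v (stream (b + 3 * L) b (instr_gads L I)) -> row_at v (b + instr_vars L) (exec1 s I) L.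
Proof.
case: I => o c /= Hc [Hb Ha Hr].
have [d EL] : exists d, L = c + d.+3 by exists (L - c - 3); lia.
rewrite {}EL in Hc Ha Hr *; clear Hc.
rewrite (instr_gads_stages dup_set o s c d) stream_cat fsat_cat => /andP[H1 H2].
have Hch := @chain_stages pass_forces dup_set s c d 7 (@forces_stage s c d) isT.
rewrite subnn dup_words0 // dup_words7 in Hch; last exact: dup_set_final.
have w0 : width (words_of [seq item (s i) | i <- iota 0 (c + d.+3)]) = 3 * (c + d.+3).
  by rewrite size_words -[flatten _]/(row s (c + d.+3)) size_row.
have := @chain_sound v _ _ _ b Hch Hb; rewrite w0 -map_comp => /(_ Ha).
have Hr0 : reads v b (words_of [seq item (s i) | i <- iota 0 (c + d.+3)]).
  by apply/reads_words; rewrite -[flatten _]/(row s (c + d.+3)) size_row.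
move=> /(_ Hr0 H1); rewrite inws_stages size_words size_mid_words => -[B1 B2 /reads_words R].
rewrite inws_stages outws_stages in H2.
have [ws [E1 F1]] := ins_last_stage o s c d; have [ws' [E2 F2]] := outs_last_stage o s c d.
have lok : pass_forces (last_stage o s c d).
  rewrite /pass_forces /last_stage !all_cat -!/(pass_forces _) !forces_items andbT.
  by case/andP: (last_window_ok o (s c) (s c.+1) (s c.+2)).
set b7 := b + (21 * (c + d.+3) + 42) in B1 B2 R H2.
have Ea : b + 3 * (c + d.+3) + (21 * (c + d.+3) + 48) = b7 + (3 * (c + d.+3) + 6) by rewrite /b7; lia.
rewrite Ea in H2; have Rl : reads v b7 (ins (last_stage o s c d)).
  by rewrite E1; apply/reads_words; rewrite F1.
have [R1 R2] := pass_sound lok B2 B1 Rl H2.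
have Eb : b + instr_vars (c + d.+3) = b7 + (3 * (c + d.+3) + 6) by rewrite /b7 /instr_vars; lia.
rewrite Eb; split=> //.
  by move: R2; rewrite E2 -/(width _) size_words F2 size_row.
by move: R1; rewrite E2 => /reads_words; rewrite F2 size_row.
Qed.

Lemma instr_total v b s L I : I.2.+2 < L -> row_at v b s L ->
  exists v', [/\ forall i, i <= b + 3 * L -> v' i = v i,
    fsat v' (stream (b + 3 * L) b (instr_gads L I)) & row_at v' (b + instr_vars L) (exec1 s I) L].
Proof.
case: I => o c /= Hc [Hb Ha Hr].
have [d EL] : exists d, L = c + d.+3 by exists (L - c - 3); lia.
rewrite {}EL in Hc Ha Hr *; clear Hc.
pose D x k := [:: dup_word x k].
have Hch := @chain_stages pass_allows D s c d 7 (@allows_stage s c d) isT.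
rewrite subnn dup_words0 // dup_words7 in Hch; last by move=> x; rewrite /D /dup_word dup_set_final.
have w0 : width (words_of [seq item (s i) | i <- iota 0 (c + d.+3)]) = 3 * (c + d.+3).
  by rewrite size_words -[flatten _]/(row s (c + d.+3)) size_row.
have Hr0 : reads v b (words_of [seq item (s i) | i <- iota 0 (c + d.+3)]).
  by apply/reads_words; rewrite -[flatten _]/(row s (c + d.+3)) size_row.
have := @chain_total v _ _ _ b Hch Hb; rewrite w0 -map_comp => /(_ Ha Hr0).
rewrite inws_stages size_words size_mid_words => -[v1 [X1 S1 [B1 B2 /reads_words R]]].
have [ws [E1 F1]] := ins_last_stage o s c d; have [ws' [E2 F2]] := outs_last_stage o s c d.
have lok : pass_allows (last_stage o s c d).
  rewrite /pass_allows /last_stage !all_cat -!/(pass_allows _) !allows_items andbT.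
  by case/andP: (last_window_ok o (s c) (s c.+1) (s c.+2)).
set b7 := b + (21 * (c + d.+3) + 42) in B1 B2 R.
have Ea : b + 3 * (c + d.+3) + (21 * (c + d.+3) + 48) = b7 + (3 * (c + d.+3) + 6) by rewrite /b7; lia.
have Eb : b + instr_vars (c + d.+3) = b7 + (3 * (c + d.+3) + 6) by rewrite /b7 /instr_vars; lia.
have Rl : reads v1 b7 (ins (last_stage o s c d)).
  by rewrite E1; apply/reads_words; rewrite F1.
have le : b7 + sumn [seq w.1 | w <- ins (last_stage o s c d)] <= b7 + (3 * (c + d.+3) + 6).
  by rewrite E1 -/(width _) size_words F1 size_mid_words.
have [v2 [X2 S2 R1 R2]] := pass_total lok B2 B1 le Rl.
exists v2; split.
- move=> i Hi; rewrite X2 ?X1 //; apply: leq_trans Hi _; rewrite /b7; lia.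
- rewrite (instr_gads_stages D o s c d) stream_cat fsat_cat inws_stages outws_stages Ea S2 andbT.
  apply: eq_fsat S1 => cl l Hcl Hl; rewrite X2 //.
  have gok : all gadget_ok (flatten [seq gads (stage D s c d k) | k <- iota 0 7]).
    have H k : k < 7 -> all gadget_ok (gads (stage D s c d k)).
      by move=> Hk; rewrite all_map; apply: sub_all (allows_stage s c d Hk) => t /andP[].
    by rewrite /= !all_cat !H.
  have := stream_bound gok Hcl Hl; rewrite inws_stages outws_stages /b7.
  by clear; case: (l.1.1); lia.
- rewrite Eb; split=> //; first by rewrite X2.
    by move: R2; rewrite E2 -/(width _) size_words F2 size_row.
  by move: R1; rewrite E2 => /reads_words; rewrite F2 size_row.
Qed.

(** * The formula of a straight-line program *)

Arguments pass : simpl never.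
Arguments inws : simpl never.
Arguments outws : simpl never.

(* Found by computer search; every solution makes variable 6 true and variable 9 false. *)
Definition prelude : seq sclause :=
  [:: [:: B 0 true; B 1 true; A 3 true]; [:: B 1 false; A 3 true; A 4 true];
      [:: B 1 true; B 2 false; A 4 true]; [:: B 2 true; B 3 true; A 4 true];
      [:: B 3 false; A 4 true; A 5 true]; [:: B 3 false; B 4 true; A 5 false];
      [:: B 4 false; A 5 false; A 6 true]; [:: B 4 false; A 6 false; A 7 true];
      [:: B 4 false; B 5 true; A 7 false]; [:: B 5 true; B 6 true; A 7 true];
      [:: B 6 false; A 7 false; A 8 true]; [:: B 6 false; A 8 false; A 9 false]].

Definition init_item (o : option bool) f : seq sclause :=
  (if o is Some b then
     [:: [:: B 6 false; A f true; A f.+1 b]; [:: B 6 false; A f.+1 (~~ b); A f.+2 false]]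
   else [:: [:: B 6 false; A f true; A f.+2 false]]) ++
  [:: [:: B 6 false; A f.+2 true; A f.+3 false]].

Definition init_row (r : nat -> option bool) L : seq sclause :=
  flatten [seq init_item (r j) (9 + 3 * j) | j <- iota 0 L].

(** Only cell 1 of the last row is tested; the programs leave their verdict there. *)
Definition main_gads L (Is : seq row_instr) :=
  flatten [seq instr_gads L i | i <- Is] ++ [:: Skip 3; Assert].

Definition formula L r Is : seq sclause :=
  prelude ++ init_row r L ++ stream (9 + 3 * L) 9 (main_gads L Is).

Definition formula_vars L (Is : seq row_instr) := 9 + size Is * instr_vars L + 3 * L + 2.

Definition run (Is : seq row_instr) (s : nat -> bool) := foldl exec1 s Is.

Lemma init_rowS r L : init_row r L.+1 = init_row r L ++ init_item (r L) (9 + 3 * L).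
Proof. by rewrite /init_row -[in iota 0 L.+1]addn1 iotaD map_cat flatten_cat /= cats0. Qed.

Lemma inws_pass L I k : I.2.+2 < L -> inws (pass L I k) + 9 = 3 * L + inws (window I.1 k).
Proof.
move=> H; rewrite /pass !inws_cat; set w := inws (window _ _).
by rewrite /inws !map_nseq !sumn_nseq /=; lia.
Qed.

Lemma outws_pass L I k : I.2.+2 < L -> outws (pass L I k) + 9 = 3 * L + outws (window I.1 k).
Proof.
move=> H; rewrite /pass !outws_cat; set w := outws (window _ _).
by rewrite /outws !map_nseq !sumn_nseq /=; lia.
Qed.

Lemma inws_instr L I : I.2.+2 < L -> inws (instr_gads L I) = instr_vars L.
Proof.
move=> H; have E k : inws (pass L I k) = 3 * L + inws (window I.1 k) - 9.
  by rewrite -inws_pass // addnK.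
rewrite /instr_gads [flatten _]/=; do 8!rewrite inws_cat E.
have -> : inws (window I.1 7) = 15 by case: (I.1).
by rewrite /window /= /inws /= /instr_vars; clear E; lia.
Qed.

Lemma outws_instr L I : I.2.+2 < L -> outws (instr_gads L I) = instr_vars L.
Proof.
move=> H; have E k : outws (pass L I k) = 3 * L + outws (window I.1 k) - 9.
  by rewrite -outws_pass // addnK.
rewrite /instr_gads [flatten _]/=; do 8!rewrite outws_cat E.
have -> : outws (window I.1 7) = 9 by case: (I.1).
by rewrite /window /= /outws /= /instr_vars; clear E; lia.
Qed.

Definition fits_row L (Is : seq row_instr) := all (fun I : row_instr => I.2.+2 < L) Is.

Lemma widths_instrs L Is : fits_row L Is ->
  inws (flatten [seq instr_gads L i | i <- Is]) = size Is * instr_vars L /\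
  outws (flatten [seq instr_gads L i | i <- Is]) = size Is * instr_vars L.
Proof.
elim: Is => [|I Is IH] //= /andP[H /IH[E1 E2]].
by rewrite inws_cat outws_cat inws_instr // outws_instr // E1 E2 mulSn.
Qed.

Lemma window_ok o k : all gadget_ok (window o k).
Proof.
rewrite /window; case: ifP => _; first by rewrite [all _ _]/= !gadget_ok_Dup ?gadget_ok_Copy.
by case: o; rewrite [all _ _]/= ?gadget_ok_Copy ?gadget_ok_Nand ?gadget_ok_Skip.
Qed.

Lemma instr_gads_ok L I : all gadget_ok (instr_gads L I).
Proof.
have H k : all gadget_ok (pass L I k).
  by rewrite /pass !all_cat !all_nseq gadget_ok_Copy window_ok !orbT.
by rewrite /instr_gads [flatten _]/=; do 8!rewrite all_cat H.
Qed.

Lemma instrs_gads_ok L Is : all gadget_ok (flatten [seq instr_gads L i | i <- Is]).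
Proof. by elim: Is => //= I Is IH; rewrite all_cat instr_gads_ok. Qed.

Lemma run_sound v L Is b s : fits_row L Is -> row_at v b s L ->
  fsat v (stream (b + 3 * L) b (flatten [seq instr_gads L i | i <- Is])) ->
  row_at v (b + size Is * instr_vars L) (run Is s) L.
Proof.
elim: Is b s => [|I Is IH] b s /=; first by rewrite addn0.
case/andP=> HI HIs Hr; rewrite stream_cat fsat_cat => /andP[H1 H2].
have R1 := instr_sound HI Hr H1.
rewrite inws_instr // outws_instr // in H2.
rewrite mulSn addnA; apply: IH => //.
by rewrite addnAC.
Qed.

Lemma run_total v L Is b s : fits_row L Is -> row_at v b s L ->
  exists v', [/\ forall i, i <= b + 3 * L -> v' i = v i,
    fsat v' (stream (b + 3 * L) b (flatten [seq instr_gads L i | i <- Is])) &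
    row_at v' (b + size Is * instr_vars L) (run Is s) L].
Proof.
elim: Is v b s => [|I Is IH] v b s /=; first by exists v; rewrite addn0.
case/andP=> HI HIs Hr; have [v1 [E1 S1 R1]] := instr_total HI Hr.
have [v2 [E2 S2 R2]] := IH v1 _ _ HIs R1.
have le : b + 3 * L <= b + instr_vars L + 3 * L by rewrite addnAC leq_addr.
exists v2; split.
- by move=> i Hi; rewrite E2 ?E1 //; apply: leq_trans Hi le.
- rewrite stream_cat fsat_cat inws_instr // outws_instr // addnAC S2 andbT.
  apply: eq_fsat S1 => c l Hc Hl; rewrite E2 //.
  have := stream_bound (instr_gads_ok L I) Hc Hl; rewrite inws_instr // outws_instr //.
  by clear; case: (l.1.1) => /andP[_ H]; apply: leq_trans H _; lia.
- by rewrite mulSn addnA.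
Qed.

Lemma prelude_checks :
  all (fun w => fsat (nth false w) prelude ==> [&& nth false w 6 & ~~ nth false w 9]) (strs 10) &&
  has (fun w => fsat (nth false w) prelude) (strs 10).
Proof. by vm_compute. Qed.

Lemma prelude_bound (c : sclause) (l : slit) : c \in prelude -> l \in c ->
  l.1.2 <= if l.1.1 then 9 else 6.
Proof.
have H : all (all (fun l : slit => l.1.2 <= if l.1.1 then 9 else 6)) prelude by vm_compute.
by move=> Hc Hl; apply: (allP (allP H c Hc)).
Qed.

Lemma prelude_sound v : fsat v prelude -> v 6 = true /\ v 9 = false.
Proof.
move=> H; case/andP: prelude_checks => /allP Hall _.
have E i : i < 10 -> nth false [seq v i | i <- iota 0 10] i = v i.
  by move=> Hi; rewrite (nth_map 0) ?size_iota // nth_iota.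
have /Hall /implyP Himp : [seq v i | i <- iota 0 10] \in strs 10 by rewrite mem_strs.
suff /Himp/andP[h6 h9] : fsat (nth false [seq v i | i <- iota 0 10]) prelude.
  by rewrite !E // in h6 h9; split=> //; apply/negbTE.
apply: eq_fsat H => c l Hc Hl; rewrite E //.
by have := prelude_bound Hc Hl; case: (l.1.1); lia.
Qed.

Lemma init_row_sound v r L : v 6 = true -> v 9 = false -> fsat v (init_row r L) ->
  let s j := v (10 + 3 * j) in
  [/\ v (9 + 3 * L) = false, rd v 9 (3 * L) = row s L &
      forall j b, j < L -> r j = Some b -> s j = b].
Proof.
move=> h6 h9; elim: L => [|L IH] /=; first by rewrite addn0.
rewrite init_rowS fsat_cat => /andP[/IH[f1 R1 C1]] {IH}.
have -> : 9 + 3 * L.+1 = (9 + 3 * L).+3 by lia.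
set f := 9 + 3 * L in f1 *.
have Es : 10 + 3 * L = f.+1 by [].
move=> Hi; have [g1 g2 g3] : [/\ v f.+2 = false, v f.+3 = false &
    forall b, r L = Some b -> v f.+1 = b].
  move: Hi; rewrite /init_item /fsat /csat /lsat /=; case: (r L) => [b|] /=; rewrite h6 f1 /=.
    by case: (v f.+1) b => -[]; case: (v f.+2); case: (v f.+3) => //= _; split=> // b [].
  by case: (v f.+2); case: (v f.+3) => //= _; split.
split=> //; last first.
  move=> j b; rewrite ltnS leq_eqVlt => /orP[/eqP -> /g3|]; last exact: C1.
  by rewrite Es.
rewrite /row -[L.+1]addn1 iotaD map_cat flatten_cat -/(row _ _) -R1 mulnDr muln1 rdD; congr cat.
by rewrite /rd /= g2 g1 Es.
Qed.

Lemma init_row_bound r L (c : sclause) (l : slit) : c \in init_row r L -> l \in c ->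
  if l.1.1 then 9 <= l.1.2 <= 9 + 3 * L else l.1.2 == 6.
Proof.
elim: L => [|L IH] //; rewrite init_rowS mem_cat => /orP[/IH H /H|].
  by case: (l.1.1) => // /andP[->] /= H'; apply: leq_trans H' _; rewrite leq_add2l leq_mul2l leqnSn.
rewrite /init_item; case: (r L) => [b|] /=; rewrite !inE.
  by case/or3P=> /eqP ->; rewrite !inE => /or3P[] /eqP -> //=; lia.
by case/orP=> /eqP ->; rewrite !inE => /or3P[] /eqP -> //=; lia.
Qed.

Lemma init_bound r L (c : sclause) (l : slit) : c \in prelude ++ init_row r L -> l \in c ->
  l.1.2 <= 9 + 3 * L.
Proof.
rewrite mem_cat => /orP[/prelude_bound H /H|/init_row_bound H /H].
  by case: (l.1.1) => H'; apply: leq_trans H' _.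
by case: (l.1.1) => [/andP[]//|/eqP ->].
Qed.

Lemma assert_sound v b s L : 1 < L -> row_at v b s L ->
  fsat v (stream (b + 3 * L) b [:: Skip 3; Assert]) -> s 1.
Proof.
move=> HL [Hb Ha Hr] H.
pose p : seq gadget_step := [:: (Skip 3, [:: item (s 0)], [:: [::]]);
  (Assert, [:: item (s 1)], if s 1 then [:: [:: false]] else [::])].
have pok : pass_forces p.
  have /andP[h1 _] := @Skip_ok 3 [:: item (s 0)] isT.
  have /andP[h2 _] := Assert_ok (s 1).
  by apply/and3P; split.
have R : reads v b (ins p).
  have -> : ins p = words_of [:: item (s 0); item (s 1)] by [].
  apply/reads_words; have EL : 3 * L = 6 + 3 * (L - 2) by lia.
  have := congr1 (take 6) Hr; rewrite EL rdD take_size_cat ?size_rd // => ->.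
  by move: HL; clear; case: L => [|[|n]] //= _; rewrite take0.
have [[_ [/=]]] := pass_sound pok Ha Hb R H.
by case: (s 1).
Qed.

Lemma assert_total v b s L : 1 < L -> row_at v b s L -> s 1 ->
  exists v', (forall i, i <= b + 3 * L -> v' i = v i) /\
    fsat v' (stream (b + 3 * L) b [:: Skip 3; Assert]).
Proof.
move=> HL [Hb Ha Hr] s1.
pose p : seq gadget_step := [:: (Skip 3, [:: item (s 0)], [:: [::]]);
  (Assert, [:: item true], [:: [:: false]])].
have pok : pass_allows p.
  have /andP[_ h1] := @Skip_ok 3 [:: item (s 0)] isT.
  have /andP[_ h2] := Assert_ok (s 1).
  by apply/and3P; split.
have R : reads v b (ins p).
  have -> : ins p = words_of [:: item (s 0); item (s 1)] by rewrite s1.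
  apply/reads_words; have EL : 3 * L = 6 + 3 * (L - 2) by lia.
  have := congr1 (take 6) Hr; rewrite EL rdD take_size_cat ?size_rd // => ->.
  by move: HL; clear; case: L => [|[|n]] //= _; rewrite take0.
have le : b + sumn [seq w.1 | w <- ins p] <= b + 3 * L by rewrite /=; lia.
by have [v' [E S _ _]] := pass_total pok Ha Hb le R; exists v'.
Qed.

(** The cells that [r] leaves open are the only real choice: they turn satisfiability into an
    existential quantifier over initial rows. *)
Lemma formula_sat L r Is : 1 < L -> fits_row L Is ->
  (exists v, fsat v (formula L r Is)) <->
  exists s, (forall j b, j < L -> r j = Some b -> s j = b) /\ run Is s 1.
Proof.
move=> HL HIs; have [W1 W2] := widths_instrs HIs; split.
- case=> v; rewrite /formula !fsat_cat => /and3P[/prelude_sound[h6 h9] Hr].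
  have [f1 R1 C1] := init_row_sound h6 h9 Hr; rewrite /main_gads stream_cat fsat_cat W1 W2.
  case/andP=> H1 H2; exists (fun j => v (10 + 3 * j)); split=> //.
  have Hat : row_at v 9 (fun j => v (10 + 3 * j)) L by [].
  have := run_sound HIs Hat H1; rewrite addnAC in H2.
  by move/assert_sound; apply.
- case=> s [Hs Hacc]; case/andP: prelude_checks => _ /hasP[w Hw Hpre].
  have sw : size w = 10 by move: Hw; rewrite mem_strs => /eqP.
  have [w6 w9] := prelude_sound Hpre.
  pose v0 := overwrite (nth false w) 9 (row s L).
  have v0l i : i <= 9 -> v0 i = nth false w i by rewrite /v0 /overwrite ltnNge => ->.
  have R0 : rd v0 9 (3 * L) = row s L by rewrite -(size_row s L) rd_overwrite.
  have item_at j : j < L -> [/\ v0 (10 + 3 * j) = s j, v0 (11 + 3 * j) = false &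
      v0 (12 + 3 * j) = false].
    move=> Hj; have := congr1 (fun u => take 3 (drop (3 * j) u)) R0.
    have -> : 3 * L = 3 * j + (3 + 3 * (L - j - 1)) by lia.
    rewrite rdD drop_size_cat ?size_rd // rdD take_size_cat ?size_rd //.
    have -> : L = j + (1 + (L - j - 1)) by lia.
    rewrite /row iotaD map_cat flatten_cat drop_size_cat; last by rewrite size_items size_iota.
    by rewrite /rd /= add0n => -[-> e2 e3]; split.
  have S0 : fsat v0 (prelude ++ init_row r L).
    rewrite fsat_cat; apply/andP; split.
      apply: eq_fsat Hpre => c l Hc Hl; rewrite v0l //.
      by have := prelude_bound Hc Hl; case: (l.1.1); lia.
    have F j : j <= L -> v0 (9 + 3 * j) = false.
      case: j => [|j] Hj; first by rewrite addn0 v0l.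
      by have [_ _ <-] := item_at j Hj; congr v0; lia.
    have : forall n, n <= L -> fsat v0 (init_row r n); last by apply.
    elim=> [|n IH] Hn //; rewrite init_rowS fsat_cat IH ?(ltnW Hn) //=.
    have [e1 e2 e3] := item_at n Hn; have f0 := F n (ltnW Hn).
    rewrite /init_item /fsat /csat /lsat; case Er: (r n) => [b|] /=.
      rewrite -[(9 + 3 * n).+1]/(10 + 3 * n) -[(9 + 3 * n).+2]/(11 + 3 * n).
      rewrite -[(9 + 3 * n).+3]/(12 + 3 * n) e1 e2 e3 (Hs _ _ Hn Er) f0.
      by case: b {Er}; rewrite /= !orbT.
    rewrite -[(9 + 3 * n).+2]/(11 + 3 * n).
    by rewrite -[(9 + 3 * n).+3]/(12 + 3 * n) e2 e3 f0 /= !orbT.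
  have vL : v0 (9 + 3 * L) = false.
    have lt : L.-1 < L by clear -HL; lia.
    have [_ _ <-] := item_at _ lt; congr v0; clear -HL; lia.
  have Hat : row_at v0 9 s L by split=> //; rewrite v0l.
  have [v1 [E1 S1 R1]] := run_total HIs Hat.
  have [v2 [E2 S2]] := assert_total HL R1 Hacc.
  exists v2; rewrite /formula catA fsat_cat; apply/andP; split; last first.
    rewrite /main_gads stream_cat fsat_cat W1 W2 (addnAC 9 (3 * L)) S2 andbT.
    apply: eq_fsat S1 => c l Hc Hl; rewrite E2 //.
    have := stream_bound (instrs_gads_ok L Is) Hc Hl; rewrite W1 W2.
    by clear; case: (l.1.1) => /andP[_ H]; apply: leq_trans H _; lia.
  apply: eq_fsat S0 => c l Hc Hl; rewrite E2 ?E1 //.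
    exact: init_bound Hc Hl.
  by apply: leq_trans (init_bound Hc Hl) _; rewrite leq_add2r leq_addr.
Qed.

(** * The clauses are ordered, pairwise different and have three variables *)

Definition cvars (c : sclause) := [seq l.1.2 | l : slit <- c].

Definition fresh (c c' : sclause) :=
  has (fun l' : slit => all (fun l : slit => (l'.1.2 != l.1.2) || (l'.2 != l.2)) c) c'.

Definition three (c : sclause) := (size c == 3) && uniq (cvars c).

(** No gadget is wider than 10, so this margin separates the variables that a clause takes from the
    two rows, and even lets the page be recovered from the index. *)
Fixpoint gapped a b (Ks : seq gadget) : bool :=
  if Ks is K :: Ks' then (b + inw K + 10 < a) && gapped (a + outw K) (b + inw K) Ks' else true.

Lemma gapped_cat a b Ks Ks' :
  gapped a b (Ks ++ Ks') = gapped a b Ks && gapped (a + outws Ks) (b + inws Ks) Ks'.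
Proof.
elim: Ks a b => [|K Ks IH] a b /=; first by rewrite !addn0.
by rewrite IH outws_cons inws_cons !addnA andbA.
Qed.

Lemma gapped_short a b Ks : b + inws Ks + 10 < a -> gapped a b Ks.
Proof.
elim: Ks a b => [|K Ks IH] a b //=; rewrite inws_cons => H.
by apply/andP; split; [|apply: IH]; lia.
Qed.

Lemma gapped_nseq a b n : b + 13 < a -> gapped a b (nseq n Copy).
Proof. by elim: n a b => [|n IH] a b //= H; apply/andP; split; [|apply: IH]; lia. Qed.

Lemma gapped_pass a b L i k : k < 8 -> b + 50 < a -> gapped a b (pass L i k).
Proof.
move=> Hk H; rewrite /pass !gapped_cat.
have W : inws (window i.1 k) <= 21.
  by move: Hk; rewrite /window; do 7![case: k => [|k] //]; case: (i.1) k => [] [|k].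
have e1 n : inws (nseq n Copy) = 3 * n by rewrite /inws map_nseq sumn_nseq.
have e2 n : outws (nseq n Copy) = 3 * n by rewrite /outws map_nseq sumn_nseq.
rewrite !e1 !e2; apply/and3P; split; first by apply: gapped_nseq; lia.
  by apply: gapped_short; lia.
by apply: gapped_nseq; lia.
Qed.

(** Rows of more than 20 items keep the two positions more than 50 apart at the start of each of the
    eight passes, which absorbs the change of width inside a window. *)
Lemma gapped_instr a b L (i : row_instr) : 20 < L -> i.2.+2 < L -> a = b + 3 * L ->
  gapped a b (instr_gads L i).
Proof.
move=> HL Hi ->.
have E k : inws (pass L i k) = 3 * L + inws (window i.1 k) - 9 by rewrite -inws_pass // addnK.
have F k : outws (pass L i k) = 3 * L + outws (window i.1 k) - 9 by rewrite -outws_pass // addnK.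
rewrite /instr_gads [flatten _]/=.
do 7!rewrite gapped_cat E F.
rewrite cats0 /window /inws /outws /=.
by do 7?[apply/andP; split; first by (apply: gapped_pass => //; clear E F; lia)];
  apply: gapped_pass => //; clear E F; lia.
Qed.

Lemma gapped_main L Is : 20 < L -> fits_row L Is -> gapped (9 + 3 * L) 9 (main_gads L Is).
Proof.
move=> HL; suff H b : fits_row L Is ->
    gapped (b + 3 * L) b (flatten [seq instr_gads L i | i <- Is] ++ [:: Skip 3; Assert]) by apply: H.
elim: Is b => [|i Is IH] b /=.
  by move=> _; rewrite andbT; apply/andP; split; lia.
case/andP=> Hi HIs; rewrite -catA gapped_cat gapped_instr // inws_instr // outws_instr //=.
by rewrite addnAC; apply: IH.
Qed.

Definition spread (c : sclause) := [/\ size c = 3, uniq [seq l.1 | l : slit <- c],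
  forall l l' : slit, l \in c -> l' \in c -> l.1.1 = l'.1.1 -> l.1.2 <= l'.1.2 + 10,
  forall l l' : slit, l \in c -> l' \in c -> ~~ l.1.1 -> l'.1.1 -> l.1.2 + 10 < l'.1.2 &
  (exists2 l : slit, l \in c & l.1.1) /\ (exists2 l : slit, l \in c & ~~ l.1.1)].

Lemma spread_gclauses K a b c : gadget_ok K -> b + inw K + 10 < a -> c \in gclauses K a b -> spread c.
Proof.
move=> Kok Hg Hc; have Bd l := @gclauses_bound K a b c l Kok Hc.
case/mapP: Hc Bd => c0 Hc0 -> Bd; case/andP: Kok => /allP H /and3P[_ HI HO].
have /and5P[/eqP s3 u /hasP[l1 Hl1 A1] /hasP[l2 Hl2 B2] _] := H c0 Hc0.
split.
- by rewrite size_map.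
- rewrite -map_comp; rewrite -(map_inj_uniq (f := fun q : bool * nat =>
    (q.1, (if q.1 then a else b) + q.2))) -?map_comp in u; first exact: u.
  by move=> [x y] [x' y'] /= [<-] /addnI ->.
- move=> l l' /Bd h1 /Bd h2 E; move: h1 h2; rewrite E; case: (l'.1.1); clear -HI HO; lia.
- move=> l l' /Bd h1 /Bd h2 /negbTE E E'; move: h1 h2; rewrite E E'; clear -Hg; lia.
- by split; [exists (place a b l1) | exists (place a b l2)]; rewrite ?map_f.
Qed.

Lemma spread_stream Ks a b c : all gadget_ok Ks -> gapped a b Ks -> c \in stream a b Ks -> spread c.
Proof.
elim: Ks a b => [|K Ks IH] a b //= /andP[Kok Ksok] /andP[Hg Hgs]; rewrite mem_cat => /orP[|].
  exact: spread_gclauses.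
exact: IH.
Qed.

Lemma spread_three c : spread c -> three c.
Proof.
case=> s3 u h1 h2 _; rewrite /three s3 eqxx /= /cvars.
have -> : [seq l.1.2 | l : slit <- c] = map snd [seq l.1 | l : slit <- c] by rewrite -map_comp.
rewrite map_inj_in_uniq // => _ _ /mapP[l Hl ->] /mapP[l' Hl' ->] E.
rewrite [l.1]surjective_pairing [l'.1]surjective_pairing E; congr (_, _).
case E1: (l.1.1); case E2: (l'.1.1) => //.
  by have := h2 l' l Hl' Hl; rewrite E1 E2 E => /(_ isT isT); clear; lia.
by have := h2 l l' Hl Hl'; rewrite E1 E2 E => /(_ isT isT); clear; lia.
Qed.

Lemma not_fresh c c' : ~~ fresh c c' -> {subset cvars c' <= cvars c}.
Proof.
move=> H x /mapP[l' Hl' ->]; move: H; rewrite /fresh -all_predC => /allP/(_ l' Hl') /=.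
case/allPn=> l Hl; rewrite negb_or !negbK => /andP[/eqP -> _].
exact: map_f.
Qed.

Lemma three_not_fresh c c' : three c -> three c' -> ~~ fresh c c' -> cvars c =i cvars c'.
Proof.
move=> /andP[/eqP s3 u] /andP[/eqP s3' u'] /not_fresh sub.
have le : size (cvars c) <= size (cvars c') by rewrite !size_map s3 s3'.
by have [_ E] := uniq_min_size u' sub le; move=> x; rewrite E.
Qed.

(** Otherwise both clauses have the same variables. The gap between the rows puts each variable on
    the same page in both, and monotonicity then leaves one variable per page; but there are three
    variables and two pages. *)
Lemma spread_fresh c c' : spread c -> spread c' -> cmono c c' -> fresh c c'.
Proof.
move=> Sc Sc' Hm; apply/negPn/negP => nf.
have Ev := three_not_fresh (spread_three Sc) (spread_three Sc') nf.
case: Sc => s3 u h1 h2 [_ [pB HpB BB]]; case: Sc' => s3' u' h1' h2' [_ [pB' HpB' BB']].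
have sides (l l' : slit) : l \in c -> l' \in c' -> l.1.2 = l'.1.2 -> l.1.1 = l'.1.1.
  move=> Hl Hl' E; case E1: (l.1.1); case E2: (l'.1.1) => //; exfalso.
    have : pB.1.2 \in cvars c' by rewrite -Ev; exact: (map_f (fun l : slit => l.1.2) HpB).
    case/mapP=> q Hq Eq; have := h2 _ _ HpB Hl BB E1.
    case Eq1: (q.1.1).
      by have := h2' l' q Hl' Hq; rewrite E2 Eq1 -Eq -E => /(_ isT isT); clear; lia.
    by have := h1' l' q Hl' Hq; rewrite E2 Eq1 -Eq -E => /(_ erefl); clear; lia.
  have : pB'.1.2 \in cvars c by rewrite Ev; exact: (map_f (fun l : slit => l.1.2) HpB').
  case/mapP=> q Hq Eq; have := h2' _ _ HpB' Hl' BB' E2.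
  case Eq1: (q.1.1).
    by have := h2 l q Hl Hq; rewrite E1 Eq1 -Eq E => /(_ isT isT); clear; lia.
  by have := h1 l q Hl Hq; rewrite E1 Eq1 -Eq E => /(_ erefl); clear; lia.
have same (l1 l2 : slit) : l1 \in c -> l2 \in c -> l1.1.1 = l2.1.1 -> l1.1.2 <= l2.1.2.
  move=> H1 H2 E; have : l2.1.2 \in cvars c' by rewrite -Ev; exact: (map_f (fun l : slit => l.1.2) H2).
  case/mapP=> q Hq Eq; rewrite Eq.
  have /allP/(_ l1 H1)/allP/(_ q Hq)/implyP := Hm; apply.
  by apply/eqP; rewrite E; apply: sides.
have eq1 (l1 l2 : slit) : l1 \in c -> l2 \in c -> l1.1.1 = l2.1.1 -> l1.1 = l2.1.
  move=> H1 H2 E; rewrite [l1.1]surjective_pairing [l2.1]surjective_pairing E; congr (_, _).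
  by apply/eqP; rewrite eqn_leq !same.
case: c s3 u eq1 {Hm nf Ev h1 h2 HpB sides same} => [|x [|y [|z []]]] //= _ u eq1.
have e12 := eq1 x y; have e13 := eq1 x z; have e23 := eq1 y z; rewrite !inE !eqxx ?orbT in e12 e13 e23.
move: u; rewrite !inE negb_or => /and3P[/andP[n1 n2] n3 _].
have m1 : x.1.1 != y.1.1 by apply: contra n1 => /eqP/e12 ->.
have m2 : x.1.1 != z.1.1 by apply: contra n2 => /eqP/e13 ->.
have m3 : y.1.1 != z.1.1 by apply: contra n3 => /eqP/e23 ->.
by move: m1 m2 m3; case: (x.1.1); case: (y.1.1); case: (z.1.1).
Qed.

Lemma cmono_bounds (c c' : sclause) a b :
  (forall l : slit, l \in c -> l.1.2 <= if l.1.1 then a else b) ->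
  (forall l : slit, l \in c' -> (if l.1.1 then a else b) <= l.1.2) -> cmono c c'.
Proof.
move=> h h'; apply/allP => l Hl; apply/allP => l' Hl'; apply/implyP => /eqP E.
by apply: leq_trans (h l Hl) _; rewrite E; apply: h'.
Qed.

Lemma pairwise_catP (r : rel sclause) s1 s2 : pairwise r s1 -> pairwise r s2 ->
  (forall c c', c \in s1 -> c' \in s2 -> r c c') -> pairwise r (s1 ++ s2).
Proof.
move=> h1 h2 h; rewrite pairwise_cat h1 h2 !andbT; apply/allrelP => c c'; exact: h.
Qed.

Lemma cmono_place K a b : pairwise cmono (gcl K) -> pairwise cmono (gclauses K a b).
Proof.
rewrite /gclauses pairwise_map; apply: sub_pairwise => c c' /allP H.
apply/allP => _ /mapP[l Hl ->]; apply/allP => _ /mapP[l' Hl' ->]; apply/implyP => /=.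
move=> /eqP E; have /allP/(_ l' Hl')/implyP/(_ (introT eqP E)) := H l Hl.
by rewrite E leq_add2l.
Qed.

(** Consecutive gadgets share only their boundary variables, which are the last of one and the first
    of the next on either page. *)
Lemma pairwise_stream Ks a b : all gadget_ok Ks -> pairwise cmono (stream a b Ks).
Proof.
elim: Ks a b => [|K Ks IH] a b //= /andP[Kok Ksok]; apply: pairwise_catP.
- by apply: cmono_place; case/andP: Kok => _ /andP[].
- exact: IH.
- move=> c c' Hc Hc'; apply: (@cmono_bounds _ _ (a + outw K) (b + inw K)) => l Hl.
    by have := gclauses_bound Kok Hc Hl; case: (l.1.1) => /andP[].
  by have := stream_bound Ksok Hc' Hl; case: (l.1.1) => /andP[].
Qed.

Lemma pairwise_both (r1 r2 : rel sclause) s (P : sclause -> Prop) :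
  (forall c, c \in s -> P c) -> (forall c c', P c -> P c' -> r1 c c' -> r2 c c') ->
  pairwise r1 s -> pairwise r2 s.
Proof.
elim: s => //= c s IH HP H /andP[/allP h1 h2]; apply/andP; split.
  apply/allP => c' Hc'; apply: H; last exact: h1.
    by apply: HP; rewrite inE eqxx.
  by apply: HP; rewrite inE Hc' orbT.
by apply: IH h2 => // c' Hc'; apply: HP; rewrite inE Hc' orbT.
Qed.

Lemma main_gads_ok L Is : all gadget_ok (main_gads L Is).
Proof.
by rewrite /main_gads all_cat instrs_gads_ok [all _ _]/= ?gadget_ok_Assert ?gadget_ok_Skip.
Qed.

Lemma main_widths L Is : fits_row L Is ->
  inws (main_gads L Is) = size Is * instr_vars L + 6 /\
  outws (main_gads L Is) = size Is * instr_vars L + 1.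
Proof.
by move=> H; have [E1 E2] := widths_instrs H; rewrite /main_gads inws_cat outws_cat E1 E2.
Qed.

Definition main_stream L Is := stream (9 + 3 * L) 9 (main_gads L Is).

Lemma init_item_facts o f (c : sclause) : c \in init_item o f ->
  [/\ 9 <= f -> three c, forall l : slit, l \in c -> if l.1.1 then f <= l.1.2 <= f.+3 else l.1.2 == 6 &
      exists2 l : slit, l \in c & [/\ f < l.1.2, l.1.1 = true & B 6 false \in c]].
Proof.
rewrite /init_item; case: o => [b|] /=; rewrite !inE.
  case/or3P=> /eqP ->; split.
  1,4,7: by move=> Hf; rewrite /three /= !inE; lia.
  1,3,5: by move=> l; rewrite !inE => /or3P[] /eqP -> /=; lia.
  - by exists (A f.+1 b); rewrite !inE !eqxx ?orbT //=; split; rewrite ?inE ?eqxx //=; lia.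
  - by exists (A f.+2 false); rewrite !inE !eqxx ?orbT //=; split; rewrite ?inE ?eqxx //=; lia.
  - by exists (A f.+3 false); rewrite !inE !eqxx ?orbT //=; split; rewrite ?inE ?eqxx //=; lia.
case/orP=> /eqP ->; split.
1,4: by move=> Hf; rewrite /three /= !inE; lia.
1,3: by move=> l; rewrite !inE => /or3P[] /eqP -> /=; lia.
- by exists (A f.+2 false); rewrite !inE !eqxx ?orbT //=; split; rewrite ?inE ?eqxx //=; lia.
- by exists (A f.+3 false); rewrite !inE !eqxx ?orbT //=; split; rewrite ?inE ?eqxx //=; lia.
Qed.

Lemma init_item_pairwise o f : 9 <= f -> pairwise cmono (init_item o f) && pairwise fresh (init_item o f).
Proof.
move=> Hf; rewrite /init_item; case: o => [b|] /=; rewrite /cmono /fresh /=; clear -Hf; lia.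
Qed.

Lemma fresh_gt (c c' : sclause) m : (forall l : slit, l \in c -> l.1.2 <= m) ->
  (exists2 l : slit, l \in c' & m < l.1.2) -> fresh c c'.
Proof.
move=> h [l' Hl' lt]; apply/hasP; exists l' => //; apply/allP => l Hl.
by apply/orP; left; apply/eqP => E; move: lt; rewrite E ltnNge => /negP; apply; exact: h.
Qed.

Lemma init_row_facts r L (c : sclause) : c \in init_row r L ->
  [/\ three c, exists2 l : slit, l \in c & 9 < l.1.2 & B 6 false \in c].
Proof.
elim: L => [|L IH] //; rewrite init_rowS mem_cat => /orP[/IH //|].
case/init_item_facts=> H1 _ [l Hl [H2 _ H3]]; split=> //; first by apply: H1.
by exists l => //; apply: leq_trans H2; lia.
Qed.

Lemma init_row_pairwise r L : pairwise cmono (init_row r L) && pairwise fresh (init_row r L).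
Proof.
elim: L => [|L /andP[IH1 IH2]] //; rewrite init_rowS.
have /andP[P1 P2] := init_item_pairwise (r L) (leq_addr (3 * L) 9).
apply/andP; split; apply: pairwise_catP => // c c' Hc /init_item_facts[_ Bd [l' Hl' [lt _ _]]].
  apply: (@cmono_bounds _ _ (9 + 3 * L) 6) => l Hl.
    by have := init_row_bound Hc Hl; case: (l.1.1) => [/andP[]|/eqP ->].
  by have := Bd l Hl; case: (l.1.1) => [/andP[]|/eqP ->].
apply: (@fresh_gt _ _ (9 + 3 * L)); last by exists l'.
by move=> l Hl; have := init_row_bound Hc Hl; case: (l.1.1) => [/andP[]|/eqP ->].
Qed.

Lemma prelude_pairwise : [&& pairwise cmono prelude, pairwise fresh prelude & all three prelude].
Proof. by vm_compute. Qed.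

Lemma formula_structure L r Is : 20 < L -> fits_row L Is ->
  [/\ pairwise cmono (formula L r Is), pairwise fresh (formula L r Is), all three (formula L r Is) &
      forall (c : sclause) (l : slit), c \in formula L r Is -> l \in c -> l.1.2 < formula_vars L Is].
Proof.
move=> HL HIs; have [W1 W2] := main_widths HIs.
have gok := main_gads_ok L Is; have gap := gapped_main HL HIs.
have Msp c : c \in main_stream L Is -> spread c by exact: spread_stream.
have Mbd (c : sclause) (l : slit) : c \in main_stream L Is -> l \in c ->
    if l.1.1 then 9 + 3 * L <= l.1.2 <= 9 + 3 * L + (size Is * instr_vars L + 1)
    else 9 <= l.1.2 <= 9 + (size Is * instr_vars L + 6).
  by move=> Hc Hl; have := stream_bound gok Hc Hl; rewrite W1 W2.
have Mm := pairwise_stream (9 + 3 * L) 9 gok.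
have Mf : pairwise fresh (main_stream L Is).
  by apply: pairwise_both Msp _ Mm; exact: spread_fresh.
case/and3P: prelude_pairwise => Pm Pf P3.
case/andP: (init_row_pairwise r L) => Im If.
have bigA c : c \in main_stream L Is -> exists2 l : slit, l \in c & 9 + 3 * L <= l.1.2.
  move=> Hc; have [_ _ _ _ [[l Hl E] _]] := Msp c Hc; exists l => //.
  by have := Mbd c l Hc Hl; rewrite E => /andP[].
split.
- apply: pairwise_catP => //; first apply: pairwise_catP => //.
    move=> c c' Hc Hc'; apply: (@cmono_bounds _ _ (9 + 3 * L) 9) => l Hl.
      by have := init_row_bound Hc Hl; case: (l.1.1) => [/andP[]|/eqP ->].
    by have := Mbd c' l Hc' Hl; case: (l.1.1) => /andP[].
  move=> c c' Hc; rewrite mem_cat => Hc'; apply: (@cmono_bounds _ _ 9 6) => l Hl.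
    exact: prelude_bound Hc Hl.
  case/orP: Hc' => Hc'.
    by have := init_row_bound Hc' Hl; case: (l.1.1) => [/andP[]|/eqP ->].
  have := Mbd c' l Hc' Hl; clear; case: (l.1.1) => /andP[]; lia.
- apply: pairwise_catP => //; first apply: pairwise_catP => //.
    (* Every clause of the initial row contains variable 6, and no clause of the stream does. *)
    move=> c c' Hc Hc'; apply/negPn/negP => nf.
    have [c3 _ H6] := init_row_facts Hc.
    have E := three_not_fresh c3 (spread_three (Msp c' Hc')) nf.
    have : 6 \in cvars c' by rewrite -E; apply/mapP; exists (B 6 false).
    by case/mapP=> l Hl E6; have := Mbd c' l Hc' Hl; rewrite -E6; clear; case: (l.1.1); lia.
  move=> c c' Hc; rewrite mem_cat => Hc'; apply: (@fresh_gt _ _ 9) => [l Hl|].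
    by apply: leq_trans (prelude_bound Hc Hl) _; case: (l.1.1).
  case/orP: Hc' => [/init_row_facts[] //|/bigA[l Hl H]]; exists l => //.
  by apply: leq_trans H; clear -HL; lia.
- rewrite /formula !all_cat P3 /=; apply/andP; split; apply/allP => c.
    by case/init_row_facts.
  by move/Msp/spread_three.
- move=> c l; rewrite /formula catA mem_cat /formula_vars => /orP[/init_bound H /H|/Mbd H /H].
    by clear; lia.
  by clear -HL; case: (l.1.1) => /andP[]; lia.
Qed.

Definition clit (c : sclause) k : slit := nth (A 0 true) c k.

Lemma formula_cert (cs : seq sclause) n v (m := size cs)
    (lv := fun i k => (clit (nth [::] cs i) k).1.2) (sg := fun i k => (clit (nth [::] cs i) k).2)
    (cl := fun i k => (clit (nth [::] cs i) k).1.1) :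
  2 < n -> pairwise cmono cs -> pairwise fresh cs -> all three cs ->
  (forall (c : sclause) (l : slit), c \in cs -> l \in c -> l.1.2 < n) -> fsat v cs ->
  cert_ok n m lv sg cl id (fun j => n - j.+1) id (fun j => n - j.+1) v.
Proof.
move=> Hn /(pairwiseP [::]) Hm /(pairwiseP [::]) Hf /allP H3 Hb /allP Hs.
have in_cs i : i < m -> nth [::] cs i \in cs by move=> Hi; apply: mem_nth.
have s3 i : i < m -> size (nth [::] cs i) = 3 by move=> Hi; have /andP[/eqP] := H3 _ (in_cs i Hi).
have in_c i k : i < m -> k < 3 -> clit (nth [::] cs i) k \in nth [::] cs i.
  by move=> Hi Hk; apply: mem_nth; rewrite s3.
have lvn i k : i < m -> k < 3 -> lv i k < n by move=> Hi Hk; apply: Hb (in_cs i Hi) (in_c i k Hi Hk).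
apply/andP; split.
  by apply/all_iotaP => i Hi; apply/all_iotaP => k Hk; apply: lvn.
apply/andP; split.
  apply/all_iotaP => i Hi; apply/all_iotaP => k Hk; apply/all_iotaP => k' Hk'.
  have /andP[_ u] := H3 _ (in_cs i Hi).
  have Hk3 := ltn_trans Hk' Hk; rewrite /lv /clit.
  rewrite -!(nth_map (A 0 true) 0 (fun l : slit => l.1.2)) ?s3 // -/(cvars _).
  by rewrite nth_uniq ?size_map ?s3 //; rewrite gtn_eqF.
apply/andP; split.
  apply/all_iotaP => i Hi; apply/all_iotaP => i' Hi'.
  have /hasP[l Hl /allP Hall] := Hf i' i (ltn_trans Hi' Hi) Hi Hi'.
  apply/has_iotaP; exists (index l (nth [::] cs i)); first by rewrite -(s3 i Hi) index_mem.
  apply/all_iotaP => k' Hk'; rewrite /lv /sg /clit nth_index //.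
  by apply: Hall; apply: in_c => //; apply: ltn_trans Hi' Hi.
apply/andP; split; first by apply/all_iotaP => j Hj; rewrite Hj eqxx.
apply/andP; split; first by apply/all_iotaP => j Hj; clear -Hj; lia.
apply/andP; split; first by apply: leq_trans Hn (leq_addl _ _).
apply/andP; split.
  apply/all_iotaP => i Hi; apply/all_iotaP => i' Hi'; apply/all_iotaP => k Hk.
  apply/all_iotaP => k' Hk'; apply/implyP => /andP[lt1 lt2]; apply/negP => /eqP E.
  have /allP/(_ _ (in_c i k Hi Hk))/allP/(_ _ (in_c i' k' Hi' Hk'))/implyP := Hm i i' Hi Hi' lt1.
  rewrite -[(clit _ k).1.1]/(cl i k) -[(clit _ k').1.1]/(cl i' k') E eqxx => /(_ isT).
  by rewrite -/(lv i k) -/(lv i' k'); have := lvn i k Hi Hk; have := lvn i' k' Hi' Hk'; clear -lt2; lia.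
apply/all_iotaP => i Hi; have /hasP[l Hl Hv] := Hs _ (in_cs i Hi).
apply/has_iotaP; exists (index l (nth [::] cs i)); first by rewrite -(s3 i Hi) index_mem.
by rewrite /lv /sg /clit nth_index.
Qed.

Lemma code_nat_inj k k' u u' : code_nat k ++ u = code_nat k' ++ u' -> k = k' /\ u = u'.
Proof.
rewrite /code_nat; elim: k k' => [|k IH] [|k'] //=; first by case.
by case=> /IH[-> ->].
Qed.

(** Membership only provides some instance with the given code. The unary numbers in the code are
    self-delimiting, so the clauses of that instance can be read off. *)
Lemma cert_code_sat (R : realType) n m lv sg cs vs restr :
  linked_planar_3SAT R restr (cert_code n m lv sg cs vs) ->
  exists v : nat -> bool, forall i, i < m -> exists2 k, k < 3 & v (lv i k) = sg i k.
Proof.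
case=> n' [m' [phi [kappa [E _ _ [a Ha]]]]].
exists (fun x => if insub x is Some y then a (y : 'I_n') else false).
move: E; rewrite /cert_code /code_instance /code_seq size_tuple -!catA.
move=> /code_nat_inj[_ /code_nat_inj[E]].
move: (code_nat (m + n) ++ _) (code_nat (size kappa) ++ _) => u u' Eu i Hi.
have Hsz : size (tval phi) = m by rewrite size_tuple.
have : forall i0 (l : seq (clause n')), (forall c, c \in l -> c \in tval phi) -> forall w,
    flatten [seq code_nat 3 ++ flatten [seq code_nat (lv i k) ++ [:: sg i k] | k <- iota 0 3]
          | i <- iota i0 (size l)] ++ w =
    flatten [seq code_nat (size s) ++ flatten [seq code_literal j | j <- s] | s <- l] ++ u' ->
    forall j, i0 <= j < i0 + size l -> exists2 c, c \in tval phi &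
      exists l0 l1 l2, c = [:: l0; l1; l2] /\ [/\ (lv j 0, sg j 0) = (nat_of_ord l0.1, l0.2),
        (lv j 1, sg j 1) = (nat_of_ord l1.1, l1.2) & (lv j 2, sg j 2) = (nat_of_ord l2.1, l2.2)].
  move=> i0 l; elim: l i0 => [|c l IH] i0 Hl w /=; first by move=> _ j; rewrite addn0; clear; lia.
  rewrite -!catA -[X in X = _]/(code_nat 3 ++ _) => /code_nat_inj[sc].
  case: c sc Hl => [|l0 [|l1 [|l2 []]]] //= _ Hl; rewrite /code_literal -?catA.
  move=> /code_nat_inj[E0 [F0 /code_nat_inj[E1 [F1 /code_nat_inj[E2 [F2 Er]]]]]] j Hj.
  case: (j =P i0) => [->|nj].
    exists [:: l0; l1; l2]; first by apply: Hl; rewrite inE eqxx.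
    by exists l0, l1, l2; rewrite E0 E1 E2 F0 F1 F2.
  apply: (IH i0.+1 _ w Er); last by move: Hj nj; clear; lia.
  by move=> c Hc; apply: Hl; rewrite inE Hc orbT.
move/(_ 0 (tval phi) (fun c Hc => Hc) u); rewrite Hsz => /(_ Eu i Hi) {Eu}.
case=> c Hc [l0 [l1 [l2 [Ec [[e0 f0] [e1 f1] [e2 f2]]]]]].
have [l Hl Hal] := Ha c Hc; move: Hl; rewrite Ec !inE => /or3P[] /eqP El; rewrite El in Hal.
- by exists 0; rewrite // e0 f0 valK.
- by exists 1; rewrite // e1 f1 valK.
- by exists 2; rewrite // e2 f2 valK.
Qed.

Definition code_clause (c : sclause) : seq bool :=
  code_nat 3 ++ flatten [seq code_nat (clit c k).1.2 ++ [:: (clit c k).2] | k <- iota 0 3].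

Definition code_formula n (cs : seq sclause) : seq bool :=
  code_nat n ++ code_nat (size cs) ++ flatten [seq code_clause c | c <- cs] ++
  code_nat (size cs + n) ++
  flatten [seq [:: true] ++ code_nat j | j <- iota 0 (size cs)] ++
  flatten [seq [:: false] ++ code_nat (n - j.+1) | j <- iota 0 n].

Lemma code_formula_correct (R : realType) L r Is : 20 < L -> fits_row L Is ->
  linked_planar_3SAT R exactly_three_variables
    (code_formula (formula_vars L Is) (formula L r Is)) <->
  exists s, (forall j b, j < L -> r j = Some b -> s j = b) /\ run Is s 1.
Proof.
move=> HL HIs; have [Hm Hf H3 Hb] := formula_structure r HL HIs.
have HL1 : 1 < L by apply: leq_trans HL.
rewrite -formula_sat //; set cs := formula L r Is in Hm Hf H3 Hb *; set n := formula_vars L Is in Hb *.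
have E : code_formula n cs = cert_code n (size cs) (fun i k => (clit (nth [::] cs i) k).1.2)
    (fun i k => (clit (nth [::] cs i) k).2) id (fun j => n - j.+1).
  rewrite /code_formula /cert_code; congr (_ ++ (_ ++ (flatten _ ++ _))).
  by rewrite -{1}(mkseq_nth [::] cs) /mkseq -map_comp.
rewrite E; split.
- move/cert_code_sat=> [v Hv]; exists v; apply/allP => c Hc.
  have Hi : index c cs < size cs by rewrite index_mem.
  have [k Hk] := Hv _ Hi; rewrite nth_index // => Ev.
  apply/hasP; exists (clit c k); last by apply/eqP.
  by apply: mem_nth; have /andP[/eqP -> _] := allP H3 c Hc.
- case=> v Hv; apply: cert_sound; exact: formula_cert Hv.
Qed.

(** * Programs for Boolean functions *)

Definition shift c (Is : seq row_instr) : seq row_instr := [seq (i.1, c + i.2) | i : row_instr <- Is].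

Lemma run_cat Is Is' s : run (Is ++ Is') s = run Is' (run Is s).
Proof. exact: foldl_cat. Qed.

Lemma run_shift c Is s k : run (shift c Is) s (c + k) = run Is (fun k => s (c + k)) k.
Proof.
elim: Is s k => [|[q d] Is IH] s k //=; rewrite IH; congr (run Is _ k).
apply/funext => i; rewrite /exec1 /= -!addnS.
by rewrite eqn_add2l.
Qed.

Lemma run_out Is s k : all (fun i : row_instr => k != i.2.+1) Is -> run Is s k = s k.
Proof.
elim: Is s => [|i Is IH] s //= /andP[/negbTE H /IH ->].
by rewrite /exec1 H.
Qed.

Lemma run_below c Is s k : k <= c -> run (shift c Is) s k = s k.
Proof. by move=> H; apply: run_out; rewrite all_map; elim: Is => //= i Is ->; rewrite andbT; lia. Qed.

Lemma run_local n Is s s' : all (fun i : row_instr => i.2.+2 < n) Is -> (forall i, i < n -> s i = s' i) ->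
  forall k, k < n -> run Is s k = run Is s' k.
Proof.
elim: Is s s' => [|i Is IH] s s' /=; first by move=> _ E k /E.
case/andP=> Hi His E; apply: IH => // k Hk; rewrite /exec1.
by rewrite !E //; lia.
Qed.

Definition KL c : row_instr := (KeepL, c).
Definition KR c : row_instr := (KeepR, c).
Definition NA c : row_instr := (NandOp, c).

(** The classical circuit of four NAND gates: cell [c.+2] receives the exclusive or of the cells [c]
    and [c + 4], which keep their values. *)
Definition xor_code c := [:: KL c; KR c.+2; NA c.+1; NA c; NA c.+2; NA c.+1].
(** Wires cross by three exclusive ors. The bits of cells 1 and 9 are copied to cells 3 and 7 and
    combined in cell 5; combining cell 5 with cell 1 and with cell 9 yields each bit on the other
    side. The distance 8 between wires makes room for this. *)
Definition swap_code := [:: KL 1; KL 2; KR 7; KR 6] ++ xor_code 3 ++ xor_code 1 ++ xor_code 5 ++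
  [:: KR 1; KR 0; KL 7; KL 8].
(** The bit of cell 1 is copied to cell 3, so cell 2 has it on both sides and NAND negates it. In
    [set_code] cell 2 then gets the bit on one side and its negation on the other. *)
Definition not_code := [:: KL 1; KL 2; NA 1; KR 0].
Definition set_code := [:: KL 1; KL 2; NA 1; KL 2; NA 1; KR 0].
Definition nand_code := [:: KL 1; KL 2; KL 3; KL 4; KL 5; KL 6; NA 7; KL 8].

(** All contents of the eleven cells are tried, so the scratch cells may hold anything
    beforehand. *)
Definition code_check (Is : seq row_instr) (f g : bool -> bool -> bool) :=
  all (fun i : row_instr => i.2.+2 < 11) Is &&
  all (fun w => (run Is (nth false w) 1 == f (nth false w 1) (nth false w 9)) &&
                (run Is (nth false w) 9 == g (nth false w 1) (nth false w 9))) (strs 11).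

Lemma code_checks : [&& code_check swap_code (fun _ y => y) (fun x _ => x),
  code_check not_code (fun x _ => ~~ x) (fun _ y => y),
  code_check set_code (fun _ _ => true) (fun _ y => y) &
  code_check nand_code (fun x _ => x) (fun x y => ~~ (x && y))].
Proof. by vm_compute. Qed.

(* Wire j is the cell 8 j + 1; the cells between wires are scratch. *)
Definition wires (s : nat -> bool) j := s (8 * j + 1).

Lemma code_wires Is f g j s : code_check Is f g ->
  wires (run (shift (8 * j) Is) s) = fun i =>
    if i == j then f (wires s j) (wires s j.+1) else
    if i == j.+1 then g (wires s j) (wires s j.+1) else wires s i.
Proof.
case/andP=> Hb /allP Hc; apply/funext => i; rewrite /wires.
pose w := [seq s (8 * j + k) | k <- iota 0 11].
have Hw : w \in strs 11 by rewrite mem_strs size_map size_iota.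
have wE k : k < 11 -> s (8 * j + k) = nth false w k.
  by move=> Hk; rewrite (nth_map 0) ?size_iota // nth_iota.
have /andP[/eqP h1 /eqP h9] := Hc w Hw.
rewrite -!wE // in h1 h9.
have E9 : 8 * j.+1 + 1 = 8 * j + 9 by lia.
case: (ltnP i j) => [lt|ge].
  by rewrite run_below ?(ltn_eqF lt); [case: eqP => // E; lia | lia].
case: eqP => [->|n1].
  by rewrite run_shift (run_local Hb wE) // h1 E9.
case: eqP => [->|n2].
  by rewrite E9 run_shift (run_local Hb wE) // h9.
have [k [Ek Hk]] : exists k, 8 * i + 1 = 8 * j + k /\ 11 <= k by exists (8 * i + 1 - 8 * j); lia.
rewrite Ek run_shift run_out //; apply: sub_all Hb => I /=; lia.
Qed.

Definition realizes n (Is : seq row_instr) := all (fun i : row_instr => i.2.+2 < 8 * n + 3) Is.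

Definition real n (f : (nat -> bool) -> (nat -> bool)) :=
  exists2 Is, realizes n Is & forall s, wires (run Is s) = f (wires s).

Lemma real_id n : real n id.
Proof. by exists [::]. Qed.

Lemma real_comp n f g : real n f -> real n g -> real n (fun t => g (f t)).
Proof.
case=> I1 B1 H1 [I2 B2 H2]; exists (I1 ++ I2); first by rewrite /realizes all_cat; apply/andP.
by move=> s; rewrite run_cat H2 H1.
Qed.

Lemma real_code n Is f g j : j.+1 < n -> code_check Is f g ->
  real n (fun t i => if i == j then f (t j) (t j.+1) else
                     if i == j.+1 then g (t j) (t j.+1) else t i).
Proof.
move=> Hj Hc; exists (shift (8 * j) Is) => [|s]; last exact: code_wires.
case/andP: Hc => Hb _; rewrite /realizes all_map; apply: sub_all Hb => i /=; lia.
Qed.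

Lemma real_ext n f g : real n f -> (forall t i, f t i = g t i) -> real n g.
Proof. by case=> Is H1 H2 E; exists Is => // s; rewrite H2; apply/funext => i. Qed.

Definition tr (i j k : nat) := if k == i then j else if k == j then i else k.

(** A distant transposition is a shorter one conjugated by an adjacent transposition. *)
Lemma real_swap n i j : i < j < n -> real n (fun t k => t (tr i j k)).
Proof.
case/andP=> ij jn; have [d Ed] : exists d, j = i + d.+1 by exists (j - i.+1); lia.
rewrite {}Ed {j ij} in jn *; elim: d jn => [|d IH] jn.
  case/and4P: code_checks => C _ _ _; rewrite addn1 in jn *.
  by apply: real_ext (real_code jn C) _ => t k; rewrite /tr; do 2![case: eqP => //].
have j1 : (i + d.+1).+1 < n by lia.
case/and4P: code_checks => C _ _ _; have S := real_code j1 C.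
apply: real_ext (real_comp (real_comp S (IH (ltnW j1))) S) _ => t k; rewrite /tr /=.
set a := i + d.+1 in S j1 *; have -> : i + d.+2 = a.+1 by rewrite /a; lia.
have ia : i < a by rewrite /a; lia.
have e1 := ltn_eqF ia.
have e2 := ltn_eqF (leqW ia).
have e3 := gtn_eqF (ltnSn a).
have e4 := gtn_eqF (leqW ia).
have e5 := gtn_eqF ia.
have e6 := ltn_eqF (ltnSn a).
case: (eqVneq k a) => [Ek|ka]; first by rewrite ?Ek ?(eqxx, e1, e2, e3, e4, e5, e6).
case: (eqVneq k a.+1) => [Ek|ka1]; first by rewrite ?Ek ?(eqxx, e1, e2, e3, e4, e5, e6).
case: (eqVneq k i) => [Ek|ki]; first by rewrite ?Ek ?(eqxx, e1, e2, e3, e4, e5, e6).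
by rewrite ?(negbTE ka, negbTE ka1, negbTE ki).
Qed.

Definition set_wire (t : nat -> bool) j b i := if i == j then b else t i.

Lemma real_not n j : j.+1 < n -> real n (fun t => set_wire t j (~~ t j)).
Proof.
move=> Hj; case/and4P: code_checks => _ C _ _; apply: real_ext (real_code Hj C) _ => t i.
by rewrite /set_wire; do 2![case: eqP => // ?; subst].
Qed.

Lemma real_set n j : j.+1 < n -> real n (fun t => set_wire t j true).
Proof.
move=> Hj; case/and4P: code_checks => _ _ C _; apply: real_ext (real_code Hj C) _ => t i.
by rewrite /set_wire; do 2![case: eqP => // ?; subst].
Qed.

(** [nand_code] takes its other operand from the wire before [j] only. The operand is therefore
    exchanged with that wire first and exchanged back afterwards. *)
Lemma real_nand n i j : i != j -> 0 < i -> 0 < j -> i < n -> j < n ->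
  real n (fun t => set_wire t j (~~ (t i && t j))).
Proof.
move=> ij i0 j0 Hi; case: j j0 ij => // j _ ij Hj.
case/and4P: code_checks => _ _ _ C; have N := real_code Hj C.
case: (eqVneq i j) => [->|nij].
  apply: real_ext N _ => t k; rewrite /set_wire.
  case: eqP => [->|//]; by rewrite ltn_eqF.
have S : real n (fun t k => t (tr i j k)).
  case: (ltngtP i j) nij => // lt _; first by apply: real_swap; rewrite lt ltnW.
  apply: (real_ext (f := fun t k => t (tr j i k))); first by apply: real_swap; rewrite lt.
  by move=> t k; rewrite /tr; do 2![case: eqP => // ?; subst].
apply: real_ext (real_comp (real_comp S N) S) _ => t k; rewrite /tr /set_wire.
have e1 : (j.+1 == i) = false by rewrite eq_sym; apply/negbTE.
have e2 : (j.+1 == j) = false by rewrite gtn_eqF.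
have e3 : (i == j) = false by apply/negbTE.
have e4 : (j == i) = false by rewrite eq_sym.
have e5 : (i == j.+1) = false by apply/negbTE.
have e6 : (j == j.+1) = false by rewrite ltn_eqF.
case: (eqVneq k i) => [Ek|ki]; first by rewrite ?Ek ?(eqxx, e1, e2, e3, e4, e5, e6).
case: (eqVneq k j) => [Ek|kj]; first by rewrite ?Ek ?(eqxx, e1, e2, e3, e4, e5, e6).
by rewrite ?(negbTE kj, negbTE ki, e1, e2, e3, e4, e5, e6, eqxx).
Qed.

(** * Formulas evaluated on wires *)

Inductive bexp := BTrue | BVar of nat | BNand of bexp & bexp.
Fixpoint beval (t : nat -> bool) e := match e with
  | BTrue => true | BVar i => t i | BNand a b => ~~ (beval t a && beval t b) end.
Fixpoint bvars_lt n e := match e with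
  | BTrue => true | BVar i => i < n | BNand a b => bvars_lt n a && bvars_lt n b end.
(** Extra registers needed: while the second argument is evaluated, one register holds the value of
    the first. *)
Fixpoint bdepth e := match e with
  | BTrue | BVar _ => 0 | BNand a b => maxn (bdepth a) (bdepth b).+1 end.

Lemma bvars_ltW n m e : n <= m -> bvars_lt n e -> bvars_lt m e.
Proof.
move=> le; elim: e => //= [i|a IHa b IHb]; first by move/leq_trans; apply.
by case/andP=> /IHa -> /IHb ->.
Qed.

(** Case distinction on the last variable, written with NAND. *)
Lemma bexp_complete k (f : seq bool -> bool) :
  exists2 e, bvars_lt k e & forall t, beval t e = f [seq t i | i <- iota 0 k].
Proof.
elim: k f => [|k IH] f.
  by exists (if f [::] then BTrue else BNand BTrue BTrue) => [|t /=]; case: (f [::]).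
have [e1 V1 E1] := IH (fun w => f (rcons w true)); have [e0 V0 E0] := IH (fun w => f (rcons w false)).
pose c := BVar k.
exists (BNand (BNand c e1) (BNand (BNand c c) e0)) => [|t].
  by rewrite /= !ltnSn !(bvars_ltW (leqnSn k)).
rewrite -[in RHS]addn1 iotaD map_cat cats1 /= E1 E0.
by case: (t k); rewrite /= ?negbK ?andbT ?andbF //= ?negbK ?andbT.
Qed.

Section Circuits.
Variables (n V : nat) (al : nat -> nat).
Hypothesis alP : forall v, v < V -> 0 < al v /\ (al v).+1 < n.
Hypothesis al_inj : forall v w, v < V -> w < V -> al v = al w -> v = w.

Definition computes d e (f : (nat -> bool) -> (nat -> bool)) := forall t,
  f t (al d) = beval (fun v => t (al v)) e /\
  forall x, (forall v, d <= v < V -> x != al v) -> f t x = t x.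

Lemma beval_ext k e t t' : bvars_lt k e -> (forall i, i < k -> t i = t' i) -> beval t e = beval t' e.
Proof.
by move=> + E; elim: e => //= a IHa b IHb /andP[/IHa -> /IHb ->].
Qed.

(** The value lands in register [d], and only registers from [d] on are touched, so the variables
    survive. A variable is copied by negating twice: register [d] is set to true, joined with the
    variable by NAND, and negated. *)
Lemma real_bexp e d : bvars_lt d e -> d + bdepth e < V ->
  exists2 f, real n f & computes d e f.
Proof.
elim: e d => [|i|a IHa b IHb] d /= Hv Hd.
- have dV : d < V by lia.
  exists (fun t => set_wire t (al d) true); first by apply: real_set; case: (alP dV).
  move=> t; rewrite /set_wire eqxx; split=> // x Hx.
  by rewrite (negbTE (Hx d _)) // leqnn.
- have dV : d < V by lia.
  have iV : i < V by lia.
  have [d0 d1] := alP dV; have [i0 i1] := alP iV.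
  have ne : al i != al d by apply/eqP => /(al_inj iV dV) E; lia.
  exists (fun t => let t2 := set_wire (set_wire t (al d) true) (al d)
     (~~ (set_wire t (al d) true (al i) && set_wire t (al d) true (al d))) in
     set_wire t2 (al d) (~~ t2 (al d))).
    apply: (@real_comp _ _ (fun t => set_wire t (al d) (~~ t (al d)))); last exact: real_not.
    apply: (@real_comp _ _ (fun t => set_wire t (al d) (~~ (t (al i) && t (al d)))));
      first exact: real_set.
    by apply: real_nand => //; apply: ltnW.
  move=> t; rewrite /= /set_wire !eqxx (negbTE ne) negbK andbT; split=> // x Hx.
  by rewrite (negbTE (Hx d _)) // leqnn.
- case/andP: Hv => Va Vb.
  have da : d + bdepth a < V by lia.
  have db : d.+1 + bdepth b < V by lia.
  have dV : d < V by lia.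
  have d1V : d.+1 < V by lia.
  have [f1 R1 C1] := IHa d Va da; have [f2 R2 C2] := IHb d.+1 (bvars_ltW (leqnSn d) Vb) db.
  have [d0 d1] := alP dV; have [i0 i1] := alP d1V.
  have ne : al d.+1 != al d by apply/eqP => /(al_inj d1V dV) E; lia.
  exists (fun t => set_wire (f2 (f1 t)) (al d) (~~ (f2 (f1 t) (al d.+1) && f2 (f1 t) (al d)))).
    apply: (@real_comp _ _ (fun t => set_wire t (al d) (~~ (t (al d.+1) && t (al d))))).
      exact: real_comp.
    by apply: real_nand => //; apply: ltnW.
  move=> t; have [E1 U1] := C1 t; have [E2 U2] := C2 (f1 t).
  rewrite /set_wire eqxx; split; last first.
    move=> x Hx; rewrite (negbTE (Hx d _)) ?leqnn // U2 ?U1 // => v /andP[Hv1 Hv2].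
    by apply: Hx; rewrite Hv2 ltnW.
  rewrite E2 U2 ?E1; last by move=> v Hv; apply/eqP => /al_inj E; have := E dV; lia.
  congr (~~ _); rewrite andbC; congr andb; apply: (beval_ext Vb) => v Hvd; apply: U1 => w Hw.
  by apply/eqP => /al_inj E; have := E; lia.
Qed.

(** Each result gets a register of its own, so all formulas see the original inputs; [real_swaps]
    then brings the results into the places of the inputs. *)
Lemma real_bexps k (es : seq bexp) (f0 : (nat -> bool) -> nat -> bool) d : real n f0 -> k <= d ->
  all (bvars_lt k) es -> all (fun e => d + size es + bdepth e < V) es ->
  (forall t v, v < k -> f0 t (al v) = t (al v)) ->
  exists2 f, real n f & forall t, [/\ forall j, j < size es ->
      f t (al (d + j)) = beval (fun v => t (al v)) (nth BTrue es j),
    forall v, v < d -> f t (al v) = f0 t (al v) &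
    forall x, (forall v, d <= v < V -> x != al v) -> f t x = f0 t x].
Proof.
elim: es f0 d => [|e es IH] f0 d Rf0 kd; first by exists f0.
rewrite [all _ _]/= => /andP[Ve Ves] /= /andP[De Des] H0.
have dV : d < V by lia.
have de : d + bdepth e < V by lia.
have [f1 R1 C1] := real_bexp (bvars_ltW kd Ve) de.
have U v : v < d -> forall t, f1 (f0 t) (al v) = f0 t (al v).
  move=> Hv t; have [_ U1] := C1 (f0 t); apply: U1 => w Hw; apply/eqP => /al_inj E.
  by have := E; lia.
have [||f Rf Hf] := IH (fun t => f1 (f0 t)) d.+1 (real_comp Rf0 R1) (leqW kd) Ves.
- by apply: sub_all Des => e' /=; lia.
- by move=> t v Hv; rewrite U ?H0 //; lia.
exists f => // t; have [F1 F2 F3] := Hf t; have [E1 U1] := C1 (f0 t); split.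
- case=> [|j] Hj; last by rewrite -F1 // addSnnS.
  rewrite addn0 F2 // E1; apply: (beval_ext Ve) => v Hv; exact: H0.
- by move=> v Hv; rewrite F2 ?U // ltnW.
- move=> x Hx; rewrite F3 ?U1 // => v /andP[Hv Hv']; apply: Hx.
  by rewrite Hv' ltnW.
Qed.

Lemma real_swaps k m : 2 * k <= V -> m <= k -> exists2 f, real n f & forall t,
  [/\ forall j, j < m -> f t (al j) = t (al (k + j)),
      forall j, m <= j < k -> f t (al j) = t (al j) /\ f t (al (k + j)) = t (al (k + j)) &
      forall x, (forall v, v < V -> x != al v) -> f t x = t x].
Proof.
move=> kV; elim: m => [|m IH] Hm; first by exists id; first exact: real_id.
have [f Rf Hf] := IH (ltnW Hm).
have [mV kmV] : m < V /\ k + m < V by split; lia.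
have ne : al m != al (k + m) by apply/eqP => /(al_inj mV kmV); lia.
have S : real n (fun t x => t (tr (al m) (al (k + m)) x)).
  have [[_ h1] [_ h2]] := (alP mV, alP kmV).
  case: (ltngtP (al m) (al (k + m))) ne => // lt _; first by apply: real_swap; rewrite lt ltnW.
  apply: (real_ext (f := fun t x => t (tr (al (k + m)) (al m) x))).
    by apply: real_swap; rewrite lt ltnW.
  move=> t x; rewrite /tr; case: (x =P al (k + m)) => [->|_]; last by case: eqP.
  by rewrite (ltn_eqF lt).
exists (fun t x => f t (tr (al m) (al (k + m)) x)); first exact: real_comp Rf S.
move=> t; have [F1 F2 F3] := Hf t; split.
- move=> j; rewrite ltnS leq_eqVlt => /orP[/eqP ->|Hj].
    by rewrite /tr eqxx; case: (F2 m); rewrite ?leqnn.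
  rewrite /tr; case: eqP => [/al_inj E|_]; first by have := E; lia.
  case: eqP => [/al_inj E|_]; first by have := E; lia.
  exact: F1.
- move=> j Hj; rewrite /tr; do 4![case: eqP => [/al_inj E|_]; first by have := E; lia].
  by apply: F2; lia.
- by move=> x Hx; rewrite /tr (negbTE (Hx _ mV)) (negbTE (Hx _ kmV)) F3.
Qed.
End Circuits.

(** The number of registers is fixed before their places, because the width of a block will be
    chosen from it. *)
Lemma real_function k (F : seq bool -> seq bool) : exists V, 2 * k <= V /\
  forall n al, (forall v, v < V -> 0 < al v /\ (al v).+1 < n) ->
  (forall v w, v < V -> w < V -> al v = al w -> v = w) ->
  exists2 f, real n f & forall t,
    (forall j, j < k -> f t (al j) = nth false (F [seq t (al v) | v <- iota 0 k]) j) /\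
    forall x, (forall v, v < V -> x != al v) -> f t x = t x.
Proof.
have [es [ses Ves Ees]] : exists es, [/\ size es = k, all (bvars_lt k) es &
    forall t j, j < k -> beval t (nth BTrue es j) = nth false (F [seq t i | i <- iota 0 k]) j].
  have H m : exists es, [/\ size es = m, all (bvars_lt k) es &
    forall t j, j < m -> beval t (nth BTrue es j) = nth false (F [seq t i | i <- iota 0 k]) j].
    elim: m => [|m [es [E1 E2 E3]]]; first by exists [::].
    have [e Ve Ee] := bexp_complete k (fun w => nth false (F w) m).
    exists (rcons es e); split; first by rewrite size_rcons E1.
      by rewrite all_rcons Ve.
    move=> t j; rewrite ltnS nth_rcons E1 => Hj; case: ltnP => Hj2; first exact: E3.
    have -> : j = m by lia.
    by rewrite eqxx.
  exact: H.
exists (2 * k + sumn (map bdepth es)).+1; split; first by lia.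
move=> n al alP al_inj; set V := (_).+1 in alP al_inj *.
have [||f1 R1 H1] := @real_bexps n V al alP al_inj k es id k (real_id n) (leqnn k) Ves.
- have sub e' (s' : seq bexp) : e' \in map bdepth s' -> e' <= sumn (map bdepth s').
    by elim: s' => //= x s' IH; rewrite inE => /orP[/eqP ->|/IH]; lia.
  have : forall s', (forall x, x \in map bdepth s' -> x <= sumn (map bdepth es)) ->
     all (fun e => k + size es + bdepth e < V) s'; last by apply=> x; exact: sub.
  elim=> //= e' s' IH Hx; rewrite IH ?andbT; last by move=> x Hx'; apply: Hx; rewrite inE Hx' orbT.
  by have := Hx (bdepth e') (mem_head _ _); rewrite ses /V; lia.
- by [].
have kV2 : 2 * k <= V by rewrite /V; clear; lia.
have [f2 R2 H2] := @real_swaps n V al alP al_inj k k kV2 (leqnn k).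
exists (fun t => f2 (f1 t)); first exact: real_comp.
move=> t; have [F1 F2 F3] := H1 t; have [G1 _ G3] := H2 (f1 t); split.
  by move=> j Hj; rewrite G1 // F1 ?ses // Ees.
move=> x Hx; rewrite G3 // F3 // => v /andP[_ Hv]; exact: Hx.
Qed.

(** * Functions acting on two adjacent blocks *)

Section Blocks.
Variables (k K : nat).
Definition bits (s : nat -> bool) b := [seq wires s (1 + K * b + i) | i <- iota 0 k].
End Blocks.

Definition block_prog k K (P : seq row_instr) (F : seq bool -> seq bool) :=
  realizes (2 * K + 3) P /\
  forall s h, let s' := run (shift (8 * (K * h)) P) s in
  (forall b, b != h -> b != h.+1 -> bits k K s' b = bits k K s b) /\
  bits k K s' h ++ bits k K s' h.+1 = F (bits k K s h ++ bits k K s h.+1).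

(** The largest number of registers needed by a function of the list serves as the common width. The
    data of the two blocks are the first [2 * k] registers; all others lie in the left block, behind
    its data. *)
Lemma block_prog_exists k (Fs : seq (seq bool -> seq bool)) :
  (forall j w, size (nth id Fs j w) = size w) ->
  exists K, k <= K /\ forall j, exists P, block_prog k K P (nth id Fs j).
Proof.
move=> sF.
have [V [kV HV]] : exists V, 2 * (2 * k) <= V /\ forall j, j < size Fs -> forall n al,
  (forall v, v < V -> 0 < al v /\ (al v).+1 < n) ->
  (forall v w, v < V -> w < V -> al v = al w -> v = w) ->
  exists2 f, real n f & forall t,
    (forall i, i < 2 * k -> f t (al i) = nth false (nth id Fs j [seq t (al v) | v <- iota 0 (2 * k)]) i) /\
    forall x, (forall v, v < V -> x != al v) -> f t x = t x.
  clear sF; elim: Fs => [|F Fs [V [kV IH]]]; first by exists (2 * (2 * k)).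
  have [V0 [kV0 H0]] := real_function (2 * k) F.
  exists (maxn V V0); split; first by lia.
  have w1 v : v < V -> v < maxn V V0 by lia.
  have w0 v : v < V0 -> v < maxn V V0 by lia.
  case=> [_|j Hj] n al alP al_inj.
    have [||f Rf Hf] := H0 n al; [by move=> v /w0/alP | by move=> v w /w0 h1 /w0 h2; apply: al_inj |].
    by exists f => // t; have [F1 F2] := Hf t; split=> // x Hx; apply: F2 => v /w0/Hx.
  have [||f Rf Hf] := IH j Hj n al; [by move=> v /w1/alP | by move=> v w /w1 h1 /w1 h2; apply: al_inj |].
  by exists f => // t; have [F1 F2] := Hf t; split=> // x Hx; apply: F2 => v /w1/Hx.
pose K := V; exists K; split; first by rewrite /K; lia.
move=> j; case: (ltnP j (size Fs)) => Hj; last first.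
  exists [::]; split=> // s h; rewrite nth_default //.
pose al v := if v < k then 1 + v else if v < 2 * k then 1 + K + (v - k) else 1 + k + (v - 2 * k).
have alP v : v < V -> 0 < al v /\ (al v).+1 < 2 * K + 3 by rewrite /al /K; clear -kV; case: ifP => ?; [|case: ifP => ?]; lia.
have alB v : v < V -> al v <= 2 * K.
  by rewrite /al /K; clear -kV; case: ifP => ?; [|case: ifP => ?]; lia.
have al_inj v w : v < V -> w < V -> al v = al w -> v = w.
  by rewrite /al /K; clear -kV; case: ifP => ?; [|case: ifP => ?]; (case: ifP => ?; [|case: ifP => ?]); lia.
have [f [P BP HP] Hf] := HV j Hj (2 * K + 3) al alP al_inj.
exists P; split=> // s h s'.
pose t0 := fun c => s (8 * (K * h) + c).
have W x : wires s' (K * h + x) = f (wires t0) x.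
  rewrite -HP /wires /s' -run_shift; congr (run _ _ _); clear; lia.
have W0 x : wires s (K * h + x) = wires t0 x by rewrite /wires /t0; congr s; clear; lia.
have Wl x : x <= K * h -> wires s' x = wires s x.
  move=> Hx; case: (ltnP x (K * h)) => H.
    by rewrite /wires /s' run_below //; clear -H; lia.
  have -> : x = K * h + 0 by clear -Hx H; lia.
  rewrite W W0; case: (Hf (wires t0)) => _ -> // v Hv.
  by case: (alP v Hv) => h0 _; rewrite (ltn_eqF h0).
have [F1 F2] := Hf (wires t0).
have al0 i : i < k -> al i = 1 + i by rewrite /al => ->.
have al1 i : i < k -> al (k + i) = 1 + K + i.
  by move=> Hi; rewrite /al; do 2![case: ifP; [lia|]] => // *; lia.
have Ein : bits k K s h ++ bits k K s h.+1 = [seq wires t0 (al v) | v <- iota 0 (2 * k)].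
  have -> : 2 * k = k + k by lia.
  rewrite iotaD map_cat /bits; congr cat.
    apply/eq_in_map => i; rewrite mem_iota add0n => /andP[_ Hi].
    by rewrite al0 // -W0; congr wires; lia.
  have Ek : iota k k = [seq k + i | i <- iota 0 k] by rewrite -iotaDl addn0.
  rewrite add0n Ek -map_comp.
  apply/eq_in_map => i; rewrite mem_iota add0n => /andP[_ Hi] /=.
  by rewrite al1 // -W0; congr wires; lia.
split.
  move=> b bh bh1; apply/eq_in_map => i; rewrite mem_iota add0n => /andP[_ Hi].
  have kK : 2 * (2 * k) <= K by [].
  case: (ltnP b h) => lt.
    have : K * b.+1 <= K * h by rewrite leq_mul2l lt orbT.
    by move=> le; apply: Wl; rewrite mulnS in le; clear -le Hi kK; lia.
  have lt2 : h.+2 <= b by clear -lt bh bh1; lia.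
  have [y Ey] : exists y, 1 + K * b + i = K * h + y /\ 1 + 2 * K <= y.
    have : K * h.+2 <= K * b by rewrite leq_mul2l lt2 orbT.
    rewrite !mulnS => le; exists (1 + K * b + i - K * h); clear -le; lia.
  case: Ey => -> Hy; rewrite W W0 F2 // => v /alB.
  by clear -Hy; lia.
rewrite Ein; apply: (@eq_from_nth _ false).
  by rewrite sF size_cat !size_map !size_iota; clear; lia.
move=> i; rewrite size_cat !size_map !size_iota => Hi.
rewrite -F1; last by clear -Hi; lia.
rewrite nth_cat size_map size_iota; case: ltnP => Hik.
  rewrite (nth_map 0) ?size_iota // nth_iota // add0n al0 // -W; congr wires; clear; lia.
have Hik2 : i - k < k by clear -Hi Hik; lia.
have Ei : i = k + (i - k) by clear -Hik; lia.
rewrite (nth_map 0) ?size_iota // nth_iota // add0n {2}Ei al1 // -W; congr wires; rewrite mulnS.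
by clear; lia.
Qed.

(** * Simulation of a Turing machine *)

Section Simulation.
Variable M : TM.
Local Notation tapes := 'I_(ntapes M).+1.

(* The control carries the state, a flag, and for every tape the symbol under
   the head with the direction (Some true = right) in which it has to move.
   Cell j holds the j-th symbols to the left and to the right of each head. *)
Definition sym := (option (bool + aux M))%type.
Definition Ctl := ((state M * bool) * {ffun tapes -> sym * option bool})%type.
Definition Cel := {ffun tapes -> sym * sym}.
Definition conf := (Ctl * (nat -> Cel))%type.

Definition stepat (G : Ctl * Cel -> Ctl * Cel) (x : conf) j : conf :=
  let g := G (x.1, x.2 j) in (g.1, fun k => if k == j then g.2 else x.2 k).
Definition LTR G n (x : conf) := foldl (stepat G) x (iota 0 n).
Definition RTL G n (x : conf) := foldl (stepat G) x (rev (iota 0 n)).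

Lemma LTRS G n x : LTR G n.+1 x = stepat G (LTR G n x) n.
Proof. by rewrite /LTR iota_rcons foldl_rcons. Qed.

Lemma RTLS G n x : RTL G n.+1 x = RTL G n (stepat G x n).
Proof. by rewrite /RTL iota_rcons rev_rcons. Qed.

Definition sel (b : bool) (p : sym * sym) := if b then p.1 else p.2.
Definition put (b : bool) (x : sym) (p : sym * sym) := if b then (x, p.2) else (p.1, x).

(** Each side of a tape is a shift register, and a sweep exchanges the carried symbol with the
    entries it passes. The outward sweep pushes the written symbol onto the side that the head
    leaves behind; the sweep back pulls in the other side and ends with the symbol now under the
    head. *)
Definition Gmove (fl : bool) (x : Ctl * Cel) : Ctl * Cel :=
  ((x.1.1, [ffun i => if (x.1.2 i).2 is Some b then (sel (b (+) fl) (x.2 i), Some b) else x.1.2 i]),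
   [ffun i => if (x.1.2 i).2 is Some b then put (b (+) fl) (x.1.2 i).1 (x.2 i) else x.2 i]).

Lemma Gmove_None fl (x : Ctl * Cel) i : (x.1.2 i).2 = None ->
  (Gmove fl x).1.2 i = x.1.2 i /\ (Gmove fl x).2 i = x.2 i.
Proof. by move=> E; rewrite !ffunE E. Qed.

Lemma Gmove_Some fl (x : Ctl * Cel) i b : (x.1.2 i).2 = Some b ->
  (Gmove fl x).1.2 i = (sel (b (+) fl) (x.2 i), Some b) /\
  (Gmove fl x).2 i = put (b (+) fl) (x.1.2 i).1 (x.2 i).
Proof. by move=> E; rewrite !ffunE E. Qed.

Lemma move_None fl (l : seq nat) (x : conf) i : (x.1.2 i).2 = None ->
  let y := foldl (stepat (Gmove fl)) x l in y.1.2 i = x.1.2 i /\ forall j, y.2 j i = x.2 j i.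
Proof.
elim: l x => [|k l IH] x E //=.
have [G1 G2] := @Gmove_None fl (x.1, x.2 k) i E.
have [|I1 I2] := IH (stepat (Gmove fl) x k); first by rewrite /stepat G1.
split; first by rewrite I1 /stepat G1.
by move=> j; rewrite I2 /stepat /=; case: (j =P k) => [->|//]; rewrite G2.
Qed.

Lemma move_state fl (l : seq nat) (x : conf) :
  (foldl (stepat (Gmove fl)) x l).1.1 = x.1.1.
Proof. by elim: l x => [|k l IH] x //=; rewrite IH. Qed.

Lemma LTR_Some fl n (x : conf) i b : (x.1.2 i).2 = Some b ->
  let y := LTR (Gmove fl) n x in let s := b (+) fl in
  y.1.2 i = (if n is n'.+1 then sel s (x.2 n' i) else (x.1.2 i).1, Some b) /\
  forall j, y.2 j i = if j < n then
    put s (if j is j'.+1 then sel s (x.2 j' i) else (x.1.2 i).1) (x.2 j i) else x.2 j i.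
Proof.
move=> E; elim: n => [|n [I1 I2]] /=.
  by split=> //; rewrite /LTR /=; case: (x.1.2 i) E => a d /= ->.
rewrite LTRS; set y := LTR _ n x in I1 I2 *.
have E' : (y.1.2 i).2 = Some b by rewrite I1.
have [G1 G2] := @Gmove_Some fl (y.1, y.2 n) i b E'.
rewrite /stepat; split; first by rewrite G1 /= I2 ltnn.
move=> j; rewrite /=; case: eqP => [->|/eqP nj].
  by rewrite G2 /= I2 ltnn ltnSn I1 /=; case: (n).
have -> : (j < n.+1) = (j < n) by rewrite ltnS leq_eqVlt (negbTE nj).
exact: I2.
Qed.

Lemma RTL_Some fl n (x : conf) i b : (x.1.2 i).2 = Some b ->
  let y := RTL (Gmove fl) n x in let s := b (+) fl in
  y.1.2 i = (if n is _.+1 then sel s (x.2 0 i) else (x.1.2 i).1, Some b) /\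
  forall j, y.2 j i = if j < n then
    put s (if j.+1 == n then (x.1.2 i).1 else sel s (x.2 j.+1 i)) (x.2 j i) else x.2 j i.
Proof.
elim: n x => [|n IH] x E /=.
  by split=> //; rewrite /RTL /=; case: (x.1.2 i) E => a d /= ->.
rewrite RTLS; have [G1 G2] := @Gmove_Some fl (x.1, x.2 n) i b E.
have E' : ((stepat (Gmove fl) x n).1.2 i).2 = Some b by rewrite /stepat G1.
have [I1 I2] := IH _ E'; split.
  by rewrite I1; case: n {IH I1 I2 E'} G1 G2 => [|n] G1 G2; rewrite /stepat ?G1.
have C1 j : (stepat (Gmove fl) x n).2 j i =
    if j == n then put (b (+) fl) (x.1.2 i).1 (x.2 n i) else x.2 j i.
  by rewrite /stepat /=; case: eqP => // _; rewrite G2.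
move=> j; rewrite I2 !C1 ltnS; case: (ltngtP j n) => [lt|//|->]; last by rewrite eqxx.
rewrite eqSS (ltn_eqF lt); congr put.
by case: eqP => [->|//]; rewrite /stepat G1.
Qed.

Definition Gdelta (q : Ctl) : Ctl :=
  if final q.1.1 then (q.1, [ffun i => ((q.2 i).1, None)]) else
  let d := delta q.1.1 [ffun i => (q.2 i).1] in
  ((d.1, q.1.2), [ffun i => ((d.2 i).1,
     match (d.2 i).2 with MoveL => Some false | MoveN => None | MoveR => Some true end)]).

Variable W : nat.
Definition round (x : conf) : conf := RTL (Gmove true) W (LTR (Gmove false) W (Gdelta x.1, x.2)).

Definition tm_represents (x : conf) (c : config M) : Prop :=
  x.1.1.1 = cstate c /\ forall i, (x.1.2 i).1 = tcur (ctapes c i) /\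
    forall j, j < W -> x.2 j i = (nth None (tleft (ctapes c i)) j, nth None (tright (ctapes c i)) j).

Definition tapes_le B (c : config M) :=
  forall i, size (tleft (ctapes c i)) <= B /\ size (tright (ctapes c i)) <= B.

Lemma step_le B c : tapes_le B c -> tapes_le B.+1 (step c).
Proof.
move=> H i; rewrite /step; case: ifP => _; first by have [] := H i; split; apply: leqW.
have [h1 h2] := H i; rewrite /= ffunE /tape_act; case: (_.2) => /=; rewrite ?size_behead; split; lia.
Qed.

(** As [B < W], the last cell is blank on both sides. So the symbol that drops out of the outward
    sweep, and enters the far end of the sweep back, is a blank. *)
Lemma round_represents B x c : tm_represents x c -> tapes_le B c -> B < W -> tm_represents (round x) (step c).
Proof.
move=> [Hst Ht] HB BW; have W0 : 0 < W by apply: leq_trans BW.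
have EW : W = W.-1.+1 by rewrite prednK.
have big i j : W.-1 <= j -> nth None (tleft (ctapes c i)) j = None /\
    nth None (tright (ctapes c i)) j = None.
  move=> Hj; have BW1 : B <= j by apply: leq_trans Hj; rewrite -ltnS -EW.
  by have [h1 h2] := HB i; split; apply: nth_default; [apply: leq_trans h1 _ | apply: leq_trans h2 _].
rewrite /round; set x1 : conf := (Gdelta x.1, x.2).
have cur : [ffun i => (x.1.2 i).1] = [ffun i => tcur (ctapes c i)] :> {ffun tapes -> sym}.
  by apply/ffunP => i; rewrite !ffunE; case: (Ht i).
split.
  rewrite /RTL /LTR !move_state /x1 /= /Gdelta /step Hst cur.
  by case: ifP.
move=> i; have [Hc Hcells] := Ht i.
case Ed: (x1.1.2 i) => [a [b|]]; last first.
  have E1 : (x1.1.2 i).2 = None by rewrite Ed.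
  have [L1 L2] := @move_None false (iota 0 W) x1 i E1.
  have E2 : ((LTR (Gmove false) W x1).1.2 i).2 = None by rewrite /LTR L1.
  have [R1 R2] := @move_None true (rev (iota 0 W)) _ i E2.
  have Z1 : ((RTL (Gmove true) W (LTR (Gmove false) W x1)).1.2 i).1 = a by rewrite /RTL R1 /LTR L1 Ed.
  have Z2 j : (RTL (Gmove true) W (LTR (Gmove false) W x1)).2 j i = x.2 j i by rewrite /RTL R2 /LTR L2.
  move: Z1 Z2; move: (RTL (Gmove true) W _) => z Z1 Z2; rewrite Z1.
  move: Ed; rewrite /x1 /= /Gdelta /step Hst cur; case: ifP => _; rewrite ffunE.
    by case=> <-; split=> // j Hj; rewrite Z2 Hcells.
  rewrite /= ffunE /tape_act; case: ((delta _ _).2 i) => w [] //= [<-].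
  by split=> // j Hj; rewrite Z2 Hcells.
have E1 : (x1.1.2 i).2 = Some b by rewrite Ed.
have [L1 L2] := @LTR_Some false W x1 i b E1.
set y := LTR (Gmove false) W x1 in L1 L2 *.
have E2 : (y.1.2 i).2 = Some b by rewrite L1.
have [R1 R2] := @RTL_Some true W y i b E2; set z := RTL _ W y in R1 R2 *.
rewrite addbF in L1 L2; rewrite addbT in R1 R2.
have Hyc : (y.1.2 i).1 = sel b (x.2 W.-1 i) by rewrite L1 /=; case: (W) W0.
have Hzc : (z.1.2 i).1 = sel (~~ b) (y.2 0 i) by rewrite R1 /=; case: (W) W0.
have Hy j : j < W -> y.2 j i = put b (if j is j'.+1 then sel b (x.2 j' i) else a) (x.2 j i).
  by move=> Hj; rewrite L2 Hj Ed.
have Hz j : j < W -> z.2 j i =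
    put (~~ b) (if j.+1 == W then sel b (x.2 W.-1 i) else sel (~~ b) (y.2 j.+1 i)) (y.2 j i).
  by move=> Hj; rewrite R2 Hj Hyc.
have lW : W.-1 < W by rewrite {2}EW.
have [bl br] := big i W.-1 (leqnn _).
have jW j : j < W -> (j.+1 == W) = false -> j.+1 < W by move=> h1 h2; rewrite ltn_neqAle h2.
have jW1 j : j.+1 < W -> j < W by exact: ltnW.
have nf : final (cstate c) = false.
  by move: Ed; rewrite /x1 /= /Gdelta Hst; case: ifP => //= _; rewrite ffunE.
move: Ed; rewrite /x1 /= /Gdelta /step Hst cur nf /= !ffunE /tape_act.
rewrite {}Hzc; case: ((delta _ _).2 i) => w mv /= [-> Eb].
case: b E1 L1 L2 E2 R1 R2 Hyc Hy Hz Eb => E1 L1 L2 E2 R1 R2 Hyc Hy Hz; case: mv => //= _.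
- split; first by rewrite (Hy 0 W0) /= (Hcells 0 W0) nth0.
  move=> j Hj; rewrite Hz // (Hy j Hj) /=; congr (_, _).
    case: j Hj => [|j] Hj; first exact: erefl.
    rewrite (Hcells j (jW1 j Hj)); exact: erefl.
  transitivity (nth None (tright (ctapes c i)) j.+1); last by case: (tright _) => //; case: (j).
  case: eqP => [Ej|/eqP/negbTE nj].
    by rewrite (Hcells _ lW) /= bl Ej; case: (big i W (leq_pred W)) => _ ->.
  rewrite (Hy _ (jW j Hj nj)) /= (Hcells _ (jW j Hj nj)); exact: erefl.
- split; first by rewrite (Hy 0 W0) /= (Hcells 0 W0) nth0.
  move=> j Hj; rewrite Hz // (Hy j Hj) /=; congr (_, _).
    transitivity (nth None (tleft (ctapes c i)) j.+1); last by case: (tleft _) => //; case: (j).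
    case: eqP => [Ej|/eqP/negbTE nj].
      by rewrite (Hcells _ lW) /= br Ej; case: (big i W (leq_pred W)) => ->.
    rewrite (Hy _ (jW j Hj nj)) /= (Hcells _ (jW j Hj nj)); exact: erefl.
  case: j Hj => [|j] Hj; first exact: erefl.
  rewrite (Hcells j (jW1 j Hj)); exact: erefl.
Qed.

Lemma rounds_represent B n x c : tm_represents x c -> tapes_le B c -> B + n <= W ->
  tm_represents (iter n round x) (iter n (@step M) c).
Proof.
move=> Hr HB; have : forall m, m <= n -> B + n <= W -> tm_represents (iter m round x) (iter m (@step M) c) /\
    tapes_le (B + m) (iter m (@step M) c); last by move=> /(_ n (leqnn n)) H /H[].
elim=> [|m IH] Hm HW /=; first by rewrite addn0.
have [R1 B1] := IH (ltnW Hm) HW; split; last by rewrite addnS; apply: step_le.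
by apply: round_represents R1 B1 _; apply: leq_trans HW; rewrite ltn_add2l.
Qed.

Definition isbit (x : sym) := if x is Some (inl _) then true else false.

(** The unconstrained cells may decode to any symbols on any tape. This sweep keeps only the leading
    bits on the right of tape 0; the flag records that a non-bit has been met. *)
Definition Gclean (x : Ctl * Cel) : Ctl * Cel :=
  let e := x.1.1.2 || ~~ isbit (x.2 ord0).2 in
  (((x.1.1.1, e), x.1.2), [ffun i => (None, if (i == ord0) && ~~ e then (x.2 i).2 else None)]).

Lemma LTR_clean n (x : conf) : x.1.1.2 = false ->
  let y := LTR Gclean n x in
  let ok m := all (fun j => isbit (x.2 j ord0).2) (iota 0 m) in
  [/\ y.1.1.1 = x.1.1.1, y.1.1.2 = ~~ ok n, y.1.2 = x.1.2 &
   forall j i, y.2 j i = if j < n then (None, if (i == ord0) && ok j.+1 then (x.2 j i).2 else None)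
                         else x.2 j i].
Proof.
move=> E; elim: n => [|n [I1 I2 I3 I4]] /=; first by split.
rewrite LTRS; set y := LTR _ n x in I1 I2 I3 I4 *.
have okS : ~~ all (fun j => isbit (x.2 j ord0).2) (iota 0 n) || ~~ isbit (y.2 n ord0).2 =
    ~~ all (fun j => isbit (x.2 j ord0).2) (iota 0 n.+1).
  by rewrite iota_rcons all_rcons I4 ltnn negb_and orbC.
split; rewrite /stepat /Gclean //=.
  by rewrite I2 okS.
move=> j i; case: eqP => [->|/eqP nj].
  by rewrite ffunE /= I2 okS ltnSn negbK I4 ltnn.
have -> : (j < n.+1) = (j < n) by rewrite ltnS leq_eqVlt (negbTE nj).
exact: I4.
Qed.

(** Tape 0 starts with a pending move to the right, so the sweep back after cleaning brings the
    first input symbol under the head. *)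
Definition start_ctl : Ctl :=
  ((start M, false), [ffun i => (None, if i == ord0 then Some true else None)]).

Definition word_of (c : nat -> Cel) : seq bool := leading_bits [seq (c j ord0).2 | j <- iota 0 W].

Lemma nth_leading_bits (u : seq sym) j : j < size u ->
  nth None [seq Some (inl b) | b <- leading_bits u] j =
  (if all isbit (take j.+1 u) then nth None u j else None) :> sym.
Proof.
elim: u j => [|x u IH] [|j] //=; case: x => [[b|a]|] //= Hj; rewrite ?take0 //.
exact: IH.
Qed.

Definition simulate T (c : nat -> Cel) : conf :=
  iter T round (RTL (Gmove true) W (LTR Gclean W (start_ctl, c))).

Lemma simulate_represents T c : size (word_of c) + T < W ->
  tm_represents (simulate T c) (iter T (@step M) (init M (word_of c))).
Proof.
move=> HW; have W0 : 0 < W by apply: leq_trans HW.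
have EW : W = W.-1.+1 by rewrite prednK.
apply: (@rounds_represent (size (word_of c))); last exact: ltnW; last first.
  move=> i; rewrite /init /= ffunE /tape_of /=; split=> //.
  by case: ifP => _; rewrite size_behead ?size_map ?leq_pred.
have [C1 C2 C3 C4] := @LTR_clean W (start_ctl, c) erefl.
set y := LTR _ W _ in C1 C2 C3 C4 *.
have C4' j i : j < W -> y.2 j i = (None,
    nth None (if i == ord0 then [seq Some (inl b) | b <- word_of c] else [::]) j).
  move=> Hj; rewrite C4 Hj; congr (_, _); case: eqP => [->|_] /=; last by rewrite nth_nil.
  rewrite nth_leading_bits ?size_map ?size_iota // -map_take take_iota (nth_map 0) ?size_iota //.
  rewrite nth_iota // add0n all_map; have -> : minn j.+1 W = j.+1 by apply/minn_idPl.
  by [].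
have y2 i : y.1.2 i = (None, if i == ord0 then Some true else None) by rewrite C3 /= ffunE.
split; first by rewrite /RTL move_state C1.
move=> i; rewrite /init /= ffunE /tape_of /=; case Ei: (i == ord0); last first.
  have E1 : (y.1.2 i).2 = None by rewrite y2 Ei.
  have [R1 R2] := @move_None true (rev (iota 0 W)) y i E1.
  rewrite /RTL R1 y2 /=; split=> // j Hj.
  by rewrite R2 C4' // Ei !nth_nil.
have E1 : (y.1.2 i).2 = Some true by rewrite y2 Ei.
have [R1 R2] := @RTL_Some true W y i true E1.
have -> : ((RTL (Gmove true) W y).1.2 i).1 = (y.2 0 i).2 by rewrite R1 /=; case: (W) W0.
split; first by rewrite C4' // Ei /= nth0.
move=> j Hj; rewrite R2 Hj /= C4' // nth_nil /= nth_behead; congr (_, _).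
case: eqP => [Ej|/eqP nj]; last by rewrite C4' ?Ei // ltn_neqAle nj.
rewrite y2 /= nth_default // size_map Ej; apply: ltnW; apply: leq_trans HW; rewrite ltnS leq_addr //.
Qed.
End Simulation.

(** * Control and cells as blocks of bits *)

Definition onehot k r : seq bool := mkseq (fun i => i == r) k.
Definition enc (T : finType) k (a : T) := onehot k (index a (enum T)).
(** Total on purpose: free blocks of the first row can hold words that are no codes. *)
Definition dec (T : finType) (a0 : T) (w : seq bool) := nth a0 (enum T) (index true w).

Lemma index_onehot k r : r < k -> index true (onehot k r) = r.
Proof.
move=> rk; have Hin : true \in onehot k r.
  by apply/mapP; exists r; rewrite ?mem_iota ?eqxx.
have := nth_index false Hin; rewrite nth_mkseq; first by move/eqP.
by have := Hin; rewrite -index_mem size_mkseq.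
Qed.

Lemma encK (T : finType) (a0 a : T) k : #|T| <= k -> dec a0 (enc k a) = a.
Proof.
move=> Hk; rewrite /dec /enc index_onehot ?nth_index ?mem_enum //.
by apply: leq_trans Hk; rewrite cardE index_mem mem_enum.
Qed.

Lemma size_enc (T : finType) k (a : T) : size (enc k a) = k.
Proof. exact: size_mkseq. Qed.

Fixpoint lead (u : seq (option bool)) : seq bool := if u is Some b :: u' then b :: lead u' else [::].

Section Programs.
Variables (K : nat) (P0 P1 P2 P3 P4 : seq row_instr).
Definition ltr_prog P n := flatten [seq shift (8 * (K * j)) P | j <- iota 0 n].
Definition rtl_prog P n := flatten [seq shift (8 * (K * (n - j.+1))) P | j <- iota 0 n].
(** Block 0 begins at wire 1, whereas the assertion reads wire 0; hence the final swap. *)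
Definition tm_prog W T :=
  ltr_prog P0 W ++ rtl_prog P2 W ++
  flatten [seq shift (8 * (K * 0)) P3 ++ ltr_prog P1 W ++ rtl_prog P2 W | _ <- iota 0 T] ++
  shift (8 * (K * 0)) P4 ++ shift (8 * 0) swap_code.

Lemma fits_shift P n L h : realizes (2 * K + 3) P -> h < n -> 8 * (K * (n + 2)) + 30 <= L ->
  fits_row L (shift (8 * (K * h)) P).
Proof.
move=> HP Hh HL; rewrite /fits_row all_map; apply: sub_all HP => i /=.
have : K * h.+1 <= K * n by rewrite leq_mul2l Hh orbT.
by rewrite mulnS mulnDr in HL *; clear -HL; lia.
Qed.

Lemma fits_cat L I1 I2 : fits_row L (I1 ++ I2) = fits_row L I1 && fits_row L I2.
Proof. exact: all_cat. Qed.

Lemma fits_flatten L (f : nat -> seq row_instr) l : (forall j, j \in l -> fits_row L (f j)) ->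
  fits_row L (flatten [seq f j | j <- l]).
Proof.
elim: l => //= j l IH H; rewrite fits_cat H ?inE ?eqxx //=; apply: IH => i Hi; apply: H.
by rewrite inE Hi orbT.
Qed.

Lemma fits_tm_prog W T L : 0 < W -> all (realizes (2 * K + 3)) [:: P0; P1; P2; P3; P4] ->
  8 * (K * (W + 2)) + 30 <= L -> fits_row L (tm_prog W T).
Proof.
move=> W0 /and5P[H0 H1 H2 H3 /andP[H4 _]] HL.
have FL P : realizes (2 * K + 3) P -> fits_row L (ltr_prog P W).
  by move=> HP; apply: fits_flatten => j; rewrite mem_iota => /andP[_ Hj]; apply: fits_shift HL.
have FR P : realizes (2 * K + 3) P -> fits_row L (rtl_prog P W).
  move=> HP; apply: fits_flatten => j; rewrite mem_iota => /andP[_ Hj]; apply: fits_shift HL => //.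
  by rewrite -subSn // subSS leq_subr.
have F0 P : realizes (2 * K + 3) P -> fits_row L (shift (8 * (K * 0)) P).
  by move=> HP; apply: fits_shift HL.
rewrite /tm_prog !fits_cat; apply/and5P; split; [exact: FL | exact: FR | | exact: F0 |].
  apply: (@fits_flatten L (fun=> shift (8 * (K * 0)) P3 ++ ltr_prog P1 W ++ rtl_prog P2 W)) => j _.
  by rewrite !fits_cat; apply/and3P; split; [exact: F0 | exact: FL | exact: FR].
have L30 : 30 <= L by apply: leq_trans HL; rewrite leq_addl.
rewrite /fits_row; apply: (@sub_all _ (fun i : row_instr => i.2.+2 < 11)) => [i /= Hi|//].
by apply: leq_trans Hi (leq_trans _ L30).
Qed.
End Programs.

Section Machine.
Variable M : TM.
Let k := #|{: Ctl M}| + #|{: Cel M}|.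
Let C0 : Ctl M := start_ctl M.
Let L0 : Cel M := [ffun=> (None, None)].
Let decC := @dec (Ctl M) C0.
Let decL := @dec (Cel M) L0.

Let encCK q : decC (enc k q) = q. Proof. by apply: encK; rewrite leq_addr. Qed.
Let encLK c : decL (enc k c) = c. Proof. by apply: encK; rewrite leq_addl. Qed.
Let k0 : 0 < k. Proof. by rewrite addn_gt0; apply/orP; left; apply/card_gt0P; exists C0. Qed.

(** Makes the functions below preserve the length of every word, as [block_prog_exists] demands. *)
Definition wrap (f : seq bool -> seq bool) w := if size w == 2 * k then f w else w.
(** Control and cell trade places, so the control walks along the row. *)
Definition FR (G : Ctl M * Cel M -> Ctl M * Cel M) := wrap (fun w => let g := G (decC (take k w), decL (drop k w)) in
  enc k g.2 ++ enc k g.1).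
Definition FL (G : Ctl M * Cel M -> Ctl M * Cel M) := wrap (fun w => let g := G (decC (drop k w), decL (take k w)) in
  enc k g.1 ++ enc k g.2).
Definition FD (f : Ctl M -> Ctl M) := wrap (fun w => enc k (f (decC (take k w))) ++ drop k w).
Definition accepts (q : Ctl M) := (q.2 ord0).1 == Some (inl true).
Definition FA := wrap (fun w => nseq k (accepts (decC (take k w))) ++ drop k w).
Definition Fs := [:: FR (@Gclean M); FR (Gmove false); FL (Gmove true); FD (@Gdelta M); FA].

Lemma size_Fs j w : size (nth id Fs j w) = size w.
Proof.
have H f : (size w = 2 * k -> size (f w) = 2 * k) -> size (wrap f w) = size w.
  by rewrite /wrap; case: eqP => // E; rewrite E; apply.
have mk : k + k = 2 * k by rewrite mul2n addnn.
case: j => [|[|[|[|[|j]]]]] /=; last by rewrite nth_nil.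
1-3: by apply: H => _; rewrite size_cat !size_enc mk.
  by apply: H => E; rewrite size_cat size_enc size_drop E -mk addnK.
by apply: H => E; rewrite size_cat size_nseq size_drop E -mk addnK.
Qed.

Variables (K : nat) (kK : k <= K).
Local Notation bits := (bits k K).

Lemma size_bits s b : size (bits s b) = k.
Proof. by rewrite size_map size_iota. Qed.

(** Cells to the right of the control sit one block further, hence the shifted index. *)
Definition view (s : nat -> bool) h : conf M :=
  (decC (bits s h), fun j => decL (bits s (if j < h then j else j.+1))).

Lemma block_cat P f s h X Y : block_prog k K P (wrap f) ->
  f (bits s h ++ bits s h.+1) = X ++ Y -> size X = k ->
  let s' := run (shift (8 * (K * h)) P) s in
  [/\ bits s' h = X, bits s' h.+1 = Y & forall b, b != h -> b != h.+1 -> bits s' b = bits s b].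
Proof.
case=> _ /(_ s h) /= [U E] Ef sX; move: E.
rewrite /wrap size_cat !size_bits addnn -mul2n eqxx Ef => /eqP.
by rewrite eqseq_cat ?size_bits // => /andP[/eqP -> /eqP ->].
Qed.

Lemma view_R P G s j : block_prog k K P (FR G) ->
  view (run (shift (8 * (K * j)) P) s) j.+1 = stepat G (view s j) j.
Proof.
move=> HP; set g := G (decC (bits s j), decL (bits s j.+1)).
have [] := @block_cat P _ s j (enc k g.2) (enc k g.1) HP.
- by rewrite take_size_cat ?drop_size_cat ?size_bits.
- exact: size_enc.
move=> B1 B2 U; have Eg : G ((view s j).1, (view s j).2 j) = g by rewrite /view /= ltnn.
rewrite /stepat Eg /view B2 encCK; congr (_, _); apply/funext => m /=.
case: (ltngtP m j) => [lt|gt|->]; last by rewrite ltnSn B1 encLK.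
  by rewrite (leqW lt) U //; [rewrite ltn_eqF | rewrite ltn_eqF // leqW].
rewrite ltnS leqNgt gt /= U //; first by rewrite gtn_eqF // ltnW.
by rewrite gtn_eqF.
Qed.

Lemma view_L P G s j : block_prog k K P (FL G) ->
  view (run (shift (8 * (K * j)) P) s) j = stepat G (view s j.+1) j.
Proof.
move=> HP; set g := G (decC (bits s j.+1), decL (bits s j)).
have [] := @block_cat P _ s j (enc k g.1) (enc k g.2) HP.
- by rewrite take_size_cat ?drop_size_cat ?size_bits.
- exact: size_enc.
move=> B1 B2 U; have Eg : G ((view s j.+1).1, (view s j.+1).2 j) = g by rewrite /view /= ltnSn.
rewrite /stepat Eg /view B1 encCK; congr (_, _); apply/funext => m /=.
case: (ltngtP m j) => [lt|gt|->]; last by rewrite B2 encLK.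
  by rewrite (leqW lt) U //; [rewrite ltn_eqF | rewrite ltn_eqF // leqW].
rewrite ltnS leqNgt gt /= U //; first by rewrite gtn_eqF // ltnW.
by rewrite gtn_eqF.
Qed.

Lemma view_D P f s : block_prog k K P (FD f) ->
  view (run (shift (8 * (K * 0)) P) s) 0 = (f (view s 0).1, (view s 0).2).
Proof.
move=> HP; have [] := @block_cat P _ s 0 (enc k (f (view s 0).1)) (bits s 1) HP.
- by rewrite take_size_cat ?drop_size_cat ?size_bits.
- exact: size_enc.
move=> B1 B2 U; rewrite /view B1 encCK; congr (_, _); apply/funext => m /=.
by case: m => [|m]; rewrite ?B2 // U.
Qed.

Lemma view_A P s : block_prog k K P FA ->
  wires (run (shift (8 * (K * 0)) P) s) 1 = accepts (view s 0).1.
Proof.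
move=> HP; have [] := @block_cat P _ s 0 (nseq k (accepts (view s 0).1)) (bits s 1) HP.
- by rewrite take_size_cat ?drop_size_cat ?size_bits.
- exact: size_nseq.
move=> B1 _ _; have := congr1 (fun w => nth false w 0) B1.
by rewrite (nth_map 0) ?size_iota // nth_iota // muln0 nth_nseq k0.
Qed.

Lemma view_ltr P G n s : block_prog k K P (FR G) ->
  view (run (ltr_prog K P n) s) n = LTR G n (view s 0).
Proof.
move=> HP; elim: n => [|n IH] //.
by rewrite /ltr_prog iota_rcons map_rcons flatten_rcons run_cat (view_R _ _ HP) LTRS -IH.
Qed.

Lemma view_rtl P G n s : block_prog k K P (FL G) ->
  view (run (rtl_prog K P n) s) 0 = RTL G n (view s n).
Proof.
move=> HP; elim: n s => [|n IH] s //.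
have -> : rtl_prog K P n.+1 = shift (8 * (K * n)) P ++ rtl_prog K P n.
  rewrite /rtl_prog /= subn1 /=; congr (_ ++ flatten _).
  by rewrite (iotaDl 1 0 n) -map_comp; apply: eq_map => j /=; rewrite subSS.
by rewrite run_cat IH RTLS (view_L _ _ HP).
Qed.

Variables (Q0 Q1 Q2 Q3 Q4 : seq row_instr).
Hypotheses (H0 : block_prog k K Q0 (FR (@Gclean M))) (H1 : block_prog k K Q1 (FR (Gmove false)))
  (H2 : block_prog k K Q2 (FL (Gmove true))) (H3 : block_prog k K Q3 (FD (@Gdelta M)))
  (H4 : block_prog k K Q4 FA).

Lemma run_tm_prog W T s : (view s 0).1 = C0 ->
  run (tm_prog K Q0 Q1 Q2 Q3 Q4 W T) s 1 = accepts (simulate W T (view s 0).2).1.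
Proof.
move=> E0; rewrite /tm_prog !run_cat.
set s1 := run (rtl_prog K Q2 W) _; set s2 := run _ s1.
have V1 : view s1 0 = RTL (Gmove true) W (LTR (@Gclean M) W (C0, (view s 0).2)).
  by rewrite /s1 (view_rtl _ _ H2) (view_ltr _ _ H0) -E0 -surjective_pairing.
have V2 : view s2 0 = simulate W T (view s 0).2.
  rewrite /simulate -V1 /s2; elim: T {s2} => [|n IH] //.
  rewrite iota_rcons map_rcons flatten_rcons !run_cat (view_rtl _ _ H2) (view_ltr _ _ H1).
  by rewrite (view_D _ H3) IH.
case/and4P: code_checks => Csw _ _ _.
rewrite -V2 -(view_A _ H4).
have := congr1 (fun t => t 0) (code_wires 0 (run (shift (8 * (K * 0)) Q4) s2) Csw).
by rewrite /wires.
Qed.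

Definition read_bit (w : seq bool) : option bool :=
  if (decL w ord0).2 is Some (inl b) then Some b else None.

Definition bit_cell b : Cel M := [ffun=> (None, Some (inl b))].

Lemma leading_bits_lead (u : seq (cell M)) :
  leading_bits u = lead [seq if x is Some (inl b) then Some b else None | x <- u].
Proof. by elim: u => [|[[b|a]|] u IH] //=; rewrite IH. Qed.

Lemma tm_prog_correct W T s t b : bits s 0 = onehot k (index C0 (enum {: Ctl M})) ->
  let z := lead [seq read_bit (bits s j.+1) | j <- iota 0 W] in
  size z + T < W -> t <= T -> computes_within M z [:: b] t ->
  run (tm_prog K Q0 Q1 Q2 Q3 Q4 W T) s 1 = b.
Proof.
move=> B0 z HW tT [Hf Ho].
have E0 : (view s 0).1 = C0 by rewrite /view B0; exact: encCK.
have Ez : word_of W (view s 0).2 = z by rewrite /word_of leading_bits_lead -map_comp.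
rewrite run_tm_prog //.
have [] := @simulate_represents M W T (view s 0).2; first by rewrite Ez.
rewrite Ez => _ /(_ ord0)[Hc _]; rewrite /accepts Hc.
have -> : iter T (@step M) (init M z) = iter t (@step M) (init M z).
  rewrite -(subnK tT) iterD; elim: (T - t) => //= n ->.
  by rewrite /step Hf.
move: Ho; rewrite /output; case: (tcur _) => [[x|x]|] //= [-> _].
by case: b.
Qed.

Lemma read_bit_cell b : read_bit (onehot k (index (bit_cell b) (enum {: Cel M}))) = Some b.
Proof. by rewrite /read_bit -/(enc k (bit_cell b)) encLK ffunE. Qed.

Lemma read_bit_blank : read_bit (onehot k (index L0 (enum {: Cel M}))) = None.
Proof. by rewrite /read_bit -/(enc k L0) encLK ffunE. Qed.
End Machine.

(** The interface of the simulation: [iq], [iN] and [ib] are the hot positions for the initial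
    control, a blank and a bit, and [rb] reads a block back, whatever it contains. *)
Lemma TM_program (M : TM) : exists k K iq iN (ib : bool -> nat) (rb : seq bool -> option bool)
    Q0 Q1 Q2 Q3 Q4,
  [/\ 0 < k <= K, all (realizes (2 * K + 3)) [:: Q0; Q1; Q2; Q3; Q4],
      forall b, rb (onehot k (ib b)) = Some b, rb (onehot k iN) = None &
      forall W T s t b, bits k K s 0 = onehot k iq ->
        let z := lead [seq rb (bits k K s j.+1) | j <- iota 0 W] in
        size z + T < W -> t <= T -> computes_within M z [:: b] t ->
        run (tm_prog K Q0 Q1 Q2 Q3 Q4 W T) s 1 = b].
Proof.
set k := #|{: Ctl M}| + #|{: Cel M}|.
have [K [kK HP]] := @block_prog_exists k (Fs M) (@size_Fs M).
have [Q0 H0] := HP 0; have [Q1 H1] := HP 1; have [Q2 H2] := HP 2; have [Q3 H3] := HP 3.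
have [Q4 H4] := HP 4.
exists k, K, (index (start_ctl M) (enum {: Ctl M})), (index ([ffun=> (None, None)] : Cel M) (enum {: Cel M})).
exists (fun b => index (bit_cell M b) (enum {: Cel M})), (@read_bit M), Q0, Q1, Q2, Q3, Q4; split.
- rewrite kK andbT /k addn_gt0; apply/orP; left; apply/card_gt0P; by exists (start_ctl M).
- by rewrite /= (proj1 H0) (proj1 H1) (proj1 H2) (proj1 H3) (proj1 H4).
- exact: read_bit_cell.
- exact: read_bit_blank.
- move=> W T s t b; exact: (tm_prog_correct H0 H1 H2 H3 H4).
Qed.

(** * The reduction *)

(** The code of an instance states the number of clauses before listing them, so both must be
    definable. *)
Definition cdef (F : seq bool -> seq nat -> seq sclause) :=
  def (fun x e => size (F x e)) /\ sdef (fun x e => flatten [seq code_clause c | c <- F x e]).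

Lemma cdef_ext F G : F =2 G -> cdef F -> cdef G.
Proof.
by move=> E [H1 H2]; split; [apply: def_ext H1 | apply: sdef_ext H2] => x e; rewrite E.
Qed.

Lemma cdef_nil : cdef (fun _ _ => [::]).
Proof. by split; [exact: def_const | exact: sdef_nil]. Qed.

Lemma cdef_cat F G : cdef F -> cdef G -> cdef (fun x e => F x e ++ G x e).
Proof.
move=> [F1 F2] [G1 G2]; split.
  by apply: def_ext (defD F1 G1) => x e; rewrite size_cat.
by apply: sdef_ext (sdef_cat F2 G2) => x e; rewrite map_cat flatten_cat.
Qed.

Lemma size_flatten_nsum (T : Type) (f : nat -> seq T) n :
  size (flatten [seq f i | i <- iota 0 n]) = nsum n (fun i => size (f i)).
Proof.
elim: n => [|n IH]; first by rewrite /nsum big_ord0.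
by rewrite iota_rcons map_rcons flatten_rcons size_cat IH nsumS.
Qed.

Lemma cdef_for F G : def F -> cdef (fun x e => G x (behead e) (head 0 e)) ->
  cdef (fun x e => flatten [seq G x e i | i <- iota 0 (F x e)]).
Proof.
move=> HF [G1 G2]; split.
  by apply: def_ext (def_nsum (G := fun x e i => size (G x e i)) HF G1) => x e; rewrite size_flatten_nsum.
apply: sdef_ext (sdef_for (G := fun x e i => flatten [seq code_clause c | c <- G x e i]) HF G2) => x e.
by elim: (iota 0 _) => //= i l ->; rewrite map_cat flatten_cat.
Qed.

Lemma cdef_if P F G : bdef P -> cdef F -> cdef G -> cdef (fun x e => if P x e then F x e else G x e).
Proof.
move=> HP [F1 F2] [G1 G2]; split.
  by apply: def_ext (def_if HP F1 G1) => x e; case: ifP.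
by apply: sdef_ext (sdef_if HP F2 G2) => x e; case: ifP.
Qed.

Lemma cdef_clause (c : seq bool -> seq nat -> sclause) :
  (forall k, k < 3 -> def (fun x e => (clit (c x e) k).1.2)) ->
  (forall k, k < 3 -> bdef (fun x e => (clit (c x e) k).2)) -> cdef (fun x e => [:: c x e]).
Proof.
move=> H1 H2; split; first exact: def_const.
have H k : k < 3 -> sdef (fun x e => code_nat (clit (c x e) k).1.2 ++ [:: (clit (c x e) k).2]).
  by move=> Hk; apply: sdef_cat; [apply: sdef_code_nat; apply: H1 | apply: sdef_bit; apply: H2].
have H3 : sdef (fun (x : seq bool) (e : seq nat) => code_nat 3) by apply: sdef_code_nat; exact: def_const.
apply: sdef_ext (sdef_cat H3 (sdef_cat (H 0 isT) (sdef_cat (H 1 isT) (H 2 isT)))) => x e.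
by rewrite /= cats0 /code_clause /= cats0.
Qed.

Lemma cdef_static (cs : seq sclause) a b : def a -> def b ->
  cdef (fun x e => map (map (place (a x e) (b x e))) cs).
Proof.
move=> Ha Hb; elim: cs => [|c cs IH]; first exact: cdef_nil.
apply: (cdef_cat (F := fun x e => [:: map (place (a x e) (b x e)) c])) IH.
apply: cdef_clause => k Hk; case: (ltnP k (size c)) => Hc.
- apply: (def_ext (F := fun x e => (if (clit c k).1.1 then a x e else b x e) + (clit c k).1.2)).
    by move=> x e; rewrite /clit (nth_map (A 0 true)).
  by apply: defD; [case: (clit c k).1.1 | exact: def_const].
- apply: (def_ext (F := fun x e => 0)); last exact: def_const.
  by move=> x e; rewrite /clit nth_default ?size_map.
- apply: (def_ext (F := fun x e => nat_of_bool (clit c k).2)); last exact: def_const.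
  by move=> x e; rewrite /clit (nth_map (A 0 true)).
- apply: (def_ext (F := fun x e => nat_of_bool true)); last exact: def_const.
  by move=> x e; rewrite /clit nth_default ?size_map.
Qed.

Lemma cdef_stream_static (Ks : seq gadget) a b : def a -> def b ->
  cdef (fun x e => stream (a x e) (b x e) Ks).
Proof.
elim: Ks a b => [|K Ks IH] a b Ha Hb; first exact: cdef_nil.
apply: (cdef_cat (F := fun x e => gclauses K (a x e) (b x e))); first exact: cdef_static.
by apply: IH; apply: defD => //; exact: def_const.
Qed.

Lemma stream_nseq a b n : stream a b (nseq n Copy) =
  flatten [seq gclauses Copy (a + 3 * j) (b + 3 * j) | j <- iota 0 n].
Proof.
elim: n a b => [|n IH] a b //.
rewrite -[RHS]/(gclauses Copy (a + 3 * 0) (b + 3 * 0) ++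
  flatten [seq gclauses Copy (a + 3 * j) (b + 3 * j) | j <- iota 1 n]).
rewrite -[LHS]/(gclauses Copy a b ++ stream (a + 3) (b + 3) (nseq n Copy)) !muln0 !addn0 IH.
congr (_ ++ _).
rewrite (iotaDl 1 0 n) -map_comp; congr flatten; apply: eq_map => j /=.
by rewrite mulnDr muln1 !addnA.
Qed.

Lemma widths_nseq n : inws (nseq n Copy) = 3 * n /\ outws (nseq n Copy) = 3 * n.
Proof. by rewrite /inws /outws !map_nseq !sumn_nseq. Qed.

Lemma cdef_stream_copies a b n : def a -> def b -> def n ->
  cdef (fun x e => stream (a x e) (b x e) (nseq (n x e) Copy)).
Proof.
move=> Ha Hb Hn.
apply: (cdef_ext (F := fun x e => flatten [seq gclauses Copy (a x e + 3 * j) (b x e + 3 * j)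
   | j <- iota 0 (n x e)])); first by move=> x e; rewrite stream_nseq.
apply: cdef_for => //; apply: cdef_static; (apply: defD; first exact: def_behead);
  apply: defM; [exact: def_const | exact: (def_head 0) | exact: def_const | exact: (def_head 0)].
Qed.

(** Gadget lists have no code of their own. What is definable is their widths, which give the
    positions of later gadgets, and the clauses from definable positions on. *)
Definition gdef (F : seq bool -> seq nat -> seq gadget) :=
  [/\ def (fun x e => inws (F x e)), def (fun x e => outws (F x e)) &
      forall a b, def a -> def b -> cdef (fun x e => stream (a x e) (b x e) (F x e))].

Lemma gdef_ext F G : F =2 G -> gdef F -> gdef G.
Proof.
move=> E [H1 H2 H3]; split; [apply: def_ext H1 | apply: def_ext H2 |] => [x e|x e|a b Ha Hb];
  rewrite ?E //.
by apply: cdef_ext (H3 a b Ha Hb) => x e; rewrite E.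
Qed.

Lemma gdef_static Ks : gdef (fun _ _ => Ks).
Proof. by split; [exact: def_const | exact: def_const | move=> a b; exact: cdef_stream_static]. Qed.

Lemma gdef_copies n : def n -> gdef (fun x e => nseq (n x e) Copy).
Proof.
move=> Hn; have H3 := defM (def_const 3) Hn; split; last by move=> a b Ha Hb; exact: cdef_stream_copies.
  by apply: def_ext H3 => x e; rewrite (proj1 (widths_nseq _)).
by apply: def_ext H3 => x e; rewrite (proj2 (widths_nseq _)).
Qed.

Lemma gdef_cat F G : gdef F -> gdef G -> gdef (fun x e => F x e ++ G x e).
Proof.
move=> [F1 F2 F3] [G1 G2 G3]; split.
- by apply: def_ext (defD F1 G1) => x e; rewrite inws_cat.
- by apply: def_ext (defD F2 G2) => x e; rewrite outws_cat.
- move=> a b Ha Hb.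
  have := cdef_cat (F3 a b Ha Hb) (G3 _ _ (defD Ha F2) (defD Hb F1)).
  by apply: cdef_ext => x e; rewrite stream_cat.
Qed.

Lemma widths_flatten (f : nat -> seq gadget) n :
  inws (flatten [seq f i | i <- iota 0 n]) = nsum n (fun i => inws (f i)) /\
  outws (flatten [seq f i | i <- iota 0 n]) = nsum n (fun i => outws (f i)).
Proof.
elim: n => [|n [I1 I2]]; first by rewrite /nsum !big_ord0.
by rewrite iota_rcons map_rcons flatten_rcons inws_cat outws_cat I1 I2 !nsumS.
Qed.

Lemma stream_flatten a b (f : nat -> seq gadget) n :
  stream a b (flatten [seq f i | i <- iota 0 n]) =
  flatten [seq stream (a + nsum i (fun i' => outws (f i'))) (b + nsum i (fun i' => inws (f i'))) (f i)
          | i <- iota 0 n].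
Proof.
elim: n => [|n IH] //; rewrite !iota_rcons !map_rcons !flatten_rcons stream_cat IH.
by have [-> ->] := widths_flatten f n.
Qed.

Lemma gdef_for F G : def F -> gdef (fun x e => G x (behead e) (head 0 e)) ->
  gdef (fun x e => flatten [seq G x e i | i <- iota 0 (F x e)]).
Proof.
move=> HF [G1 G2 G3]; split.
- apply: def_ext (def_nsum (G := fun x e i => inws (G x e i)) HF G1) => x e.
  by rewrite (proj1 (widths_flatten _ _)).
- apply: def_ext (def_nsum (G := fun x e i => outws (G x e i)) HF G2) => x e.
  by rewrite (proj2 (widths_flatten _ _)).
- move=> a b Ha Hb.
  have sum (w : seq gadget -> nat) : def (fun x e => w (G x (behead e) (head 0 e))) ->
      def (fun x e => nsum (head 0 e) (fun i => w (G x (behead e) i))).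
    by move=> Hw; apply: def_nsum; [exact: (def_head 0) | exact: (def_skip Hw)].
  have H := G3 _ _ (defD (def_behead Ha) (sum _ G2)) (defD (def_behead Hb) (sum _ G1)).
  apply: cdef_ext (cdef_for (G := fun x e i => stream (a x e + nsum i (fun i' => outws (G x e i')))
    (b x e + nsum i (fun i' => inws (G x e i'))) (G x e i)) HF H) => x e.
  by rewrite stream_flatten.
Qed.

Lemma gdef_instr o c L : def c -> def L -> gdef (fun x e => instr_gads (L x e) (o, c x e)).
Proof.
move=> Hc HL.
have Hp k : gdef (fun x e => pass (L x e) (o, c x e) k).
  apply: gdef_cat; first exact: gdef_copies.
  apply: (gdef_cat (F := fun _ _ => window o k) (G := fun x e => nseq (L x e - c x e - 3) Copy)).
    exact: gdef_static.
  apply: gdef_copies; apply: defB; last exact: def_const.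
  exact: defB.
have Hn : gdef (fun _ _ => [::]) by exact: gdef_static.
have H := gdef_cat (Hp 0) (gdef_cat (Hp 1) (gdef_cat (Hp 2) (gdef_cat (Hp 3) (gdef_cat (Hp 4)
  (gdef_cat (Hp 5) (gdef_cat (Hp 6) (gdef_cat (Hp 7) Hn))))))).
by apply: gdef_ext H.
Qed.

Definition idef (F : seq bool -> seq nat -> seq row_instr) :=
  def (fun x e => size (F x e)) /\
  forall L, def L -> gdef (fun x e => flatten [seq instr_gads (L x e) i | i <- F x e]).

Lemma idef_cat F G : idef F -> idef G -> idef (fun x e => F x e ++ G x e).
Proof.
move=> [F1 F2] [G1 G2]; split.
  by apply: def_ext (defD F1 G1) => x e; rewrite size_cat.
move=> L HL; apply: gdef_ext (gdef_cat (F2 L HL) (G2 L HL)) => x e.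
by rewrite map_cat flatten_cat.
Qed.

Lemma idef_for F G : def F -> idef (fun x e => G x (behead e) (head 0 e)) ->
  idef (fun x e => flatten [seq G x e i | i <- iota 0 (F x e)]).
Proof.
move=> HF [G1 G2]; split.
  by apply: def_ext (def_nsum (G := fun x e i => size (G x e i)) HF G1) => x e; rewrite size_flatten_nsum.
move=> L HL; have H := G2 _ (def_behead HL).
apply: gdef_ext (gdef_for (G := fun x e j => flatten [seq instr_gads (L x e) i | i <- G x e j]) HF H).
move=> x e; elim: (iota 0 _) => //= i l ->.
by rewrite map_cat flatten_cat.
Qed.

Lemma idef_shift c (P : seq row_instr) : def c -> idef (fun x e => shift (c x e) P).
Proof.
move=> Hc; elim: P => [|[q d] P IH].
  by split; [exact: def_const | move=> L _; exact: gdef_static].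
apply: (idef_cat (F := fun x e => [:: (q, c x e + d)])) IH; split; first exact: def_const.
move=> L HL; apply: gdef_ext (gdef_instr q (defD Hc (def_const d)) HL) => x e /=.
by rewrite cats0.
Qed.

Lemma idef_tm_prog K Q0 Q1 Q2 Q3 Q4 W T : def W -> def T ->
  idef (fun x e => tm_prog K Q0 Q1 Q2 Q3 Q4 (W x e) (T x e)).
Proof.
move=> HW HT.
have HL P V : def V -> idef (fun x e => ltr_prog K P (V x e)).
  move=> HV; apply: idef_for => //; apply: idef_shift.
  by do 2![apply: defM; first exact: def_const]; exact: (def_head 0).
have HR P V : def V -> idef (fun x e => rtl_prog K P (V x e)).
  move=> HV; apply: idef_for => //; apply: idef_shift.
  do 2![apply: defM; first exact: def_const]; apply: defB; first exact: def_behead.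
  by apply: defS; exact: (def_head 0).
have H0 P : idef (fun _ _ => shift (8 * (K * 0)) P) by apply: idef_shift; exact: def_const.
have Hsw : idef (fun _ _ => shift (8 * 0) swap_code) by apply: idef_shift; exact: def_const.
have HWb := def_behead HW.
have HI := idef_for (G := fun x e _ => shift (8 * (K * 0)) Q3 ++ ltr_prog K Q1 (W x e) ++
  rtl_prog K Q2 (W x e)) HT (idef_cat (H0 Q3) (idef_cat (HL Q1 _ HWb) (HR Q2 _ HWb))).
exact: (idef_cat (HL Q0 W HW) (idef_cat (HR Q2 W HW) (idef_cat HI (idef_cat (H0 Q4) Hsw)))).
Qed.

Lemma def_instr_vars L : def L -> def (fun x e => instr_vars (L x e)).
Proof. by move=> HL; apply: defD; [apply: defM => //|]; exact: def_const. Qed.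

Lemma sdef_code_formula L (c v : seq bool -> seq nat -> nat -> bool) Is : def L ->
  bdef (fun x e => c x (behead e) (head 0 e)) -> bdef (fun x e => v x (behead e) (head 0 e)) ->
  idef Is ->
  sdef (fun x e => code_formula (formula_vars (L x e) (Is x e))
    (formula (L x e) (fun p => if c x e p then Some (v x e p) else None) (Is x e))).
Proof.
move=> HL Hc Hv [Hs Hg].
set nv := fun x e => formula_vars (L x e) (Is x e).
set cs := fun x e => formula (L x e) (fun p => if c x e p then Some (v x e p) else None) (Is x e).
have Hnv : def nv.
  apply: defD; last exact: def_const.
  apply: defD; last by apply: defM => //; exact: def_const.
  apply: defD; first exact: def_const.
  by apply: defM => //; exact: def_instr_vars.
have Hf : def (fun x e => 9 + 3 * head 0 e) by def_tac.
have [cs1 cs2] : cdef cs.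
  apply: (cdef_cat (F := fun _ _ => prelude)).
    by apply: (cdef_ext _ (cdef_static prelude (def_const 0) (def_const 0))).
  apply: cdef_cat; last first.
    have [_ _ H] := gdef_cat (Hg L HL) (gdef_static [:: Skip 3; Assert]).
    apply: H; last exact: def_const.
    by apply: defD; [exact: def_const | apply: defM => //; exact: def_const].
  apply: (cdef_for (G := fun x e j => init_item (if c x e j then Some (v x e j) else None) (9 + 3 * j))) => //.
  pose c1 x e : sclause := let f := 9 + 3 * head 0 e in
    [:: B 6 false; A f true; A f.+1 (v x (behead e) (head 0 e))].
  pose c2 x e : sclause := let f := 9 + 3 * head 0 e in
    [:: B 6 false; A f.+1 (~~ v x (behead e) (head 0 e)); A f.+2 false].
  pose c3 (x : seq bool) e : sclause := let f := 9 + 3 * head 0 e in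
    [:: B 6 false; A f true; A f.+2 false].
  pose c4 (x : seq bool) e : sclause := let f := 9 + 3 * head 0 e in
    [:: B 6 false; A f.+2 true; A f.+3 false].
  have h1 : cdef (fun x e => [:: c1 x e]).
    by apply: cdef_clause => [] [|[|[|k]]] //= _; rewrite /clit /=; (exact: Hv || def_tac).
  have h2 : cdef (fun x e => [:: c2 x e]).
    by apply: cdef_clause => [] [|[|[|k]]] //= _; rewrite /clit /=; (exact: (bdef_neg Hv) || def_tac).
  have h3 : cdef (fun x e => [:: c3 x e]).
    by apply: cdef_clause => [] [|[|[|k]]] //= _; rewrite /clit /=; def_tac.
  have h4 : cdef (fun x e => [:: c4 x e]).
    by apply: cdef_clause => [] [|[|[|k]]] //= _; rewrite /clit /=; def_tac.
  apply: cdef_ext (cdef_cat (cdef_if Hc (cdef_cat h1 h2) h3) h4) => x e.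
  by rewrite /init_item; case: ifP.
have Ht : sdef (fun x e => flatten [seq [:: true] ++ code_nat j | j <- iota 0 (size (cs x e))]).
  apply: (sdef_for (G := fun _ _ j => [:: true] ++ code_nat j)) => //; apply: sdef_cat.
    by apply: sdef_bit; exact: (def_const 1).
  by apply: sdef_code_nat; exact: (def_head 0).
have Hn : sdef (fun x e => flatten [seq [:: false] ++ code_nat (nv x e - j.+1) | j <- iota 0 (nv x e)]).
  apply: (sdef_for (G := fun x e j => [:: false] ++ code_nat (nv x e - j.+1))) => //; apply: sdef_cat.
    by apply: sdef_bit; exact: (def_const 0).
  apply: sdef_code_nat; apply: defB; first exact: (def_behead Hnv).
  by apply: defS; exact: (def_head 0).
exact: (sdef_cat (sdef_code_nat Hnv) (sdef_cat (sdef_code_nat cs1) (sdef_cat cs2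
  (sdef_cat (sdef_code_nat (defD cs1 Hnv)) (sdef_cat Ht Hn))))).
Qed.

(** Division by counting multiples, as the expression language has no quotient. *)
Definition quo m d := nsum m (fun i => nat_of_bool (i.+1 * d <= m)).

Lemma quoE m d : 0 < d -> quo m d = m %/ d.
Proof.
move=> d0; rewrite /quo /nsum -[RHS](sum_ord_lt (leq_div m d)); apply: eq_bigr => i _.
by rewrite leq_divRL.
Qed.

Lemma lead_cat y u : lead ([seq Some b | b <- y] ++ u) = y ++ lead u.
Proof. by elim: y => //= b y ->. Qed.

Lemma size_lead u m : nth None u m = None -> size (lead u) <= m.
Proof. by elim: u m => [|[b|] u IH] [|m] //= /IH. Qed.

(** * The initial row, fixed except for the certificate *)

Section Reduction.
Variables (k K iq iN : nat) (ib : bool -> nat) (rb : seq bool -> option bool).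
Hypotheses (kK : 0 < k <= K) (rbS : forall b, rb (onehot k (ib b)) = Some b)
  (rbN : rb (onehot k iN) = None).
Variables (W Pw : nat) (x : seq bool).
Let n := size x.
Hypothesis HW : 2 * n + 1 + Pw < W.

(** Together with the next two, this inverts the address [8 * (1 + K * b + i) + 1] of bit [i] of
    block [b]: the clauses are generated cell by cell, so the prescribed value must be computed from
    [p]. *)
Definition wire_pos p := quo (p - 1) 8 - 1.
Definition wire_block p := quo (wire_pos p) K.
Definition wire_index p := wire_pos p - wire_block p * K.

Lemma wire_address b i : i < K ->
  let p := 8 * (1 + K * b + i) + 1 in wire_block p = b /\ wire_index p = i.
Proof.
move=> Hi p; have K0 : 0 < K by apply: leq_trans Hi.
have E : wire_pos p = b * K + i.
  rewrite /wire_pos quoE // /p addnK mulKn //; lia.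
have Eb : wire_block p = b by rewrite /wire_block E quoE // divnMDl // divn_small // addn0.
by rewrite /wire_index Eb E addKn.
Qed.

(* Bit b - 1 of code_pair x w, for 1 <= b <= 2 n + 1. *)
Definition input_bit b := (b <= n) || ((n.+1 < b) && nth false x (b - n - 2)).

(** The first test discards wire 0 and the cells between wires, for which the quotients mean
    nothing. The [Pw] blocks after block [2 * n + 1] stay free for the certificate. *)
Definition is_const p :=
  [&& p == 8 * (1 + K * wire_block p + wire_index p) + 1, wire_index p < k &
      (wire_block p <= 2 * n + 1) || (2 * n + 1 + Pw < wire_block p)].

Definition const_val p :=
  [|| (wire_block p == 0) && (wire_index p == iq),
      [&& 0 < wire_block p, wire_block p <= 2 * n + 1 &
         (input_bit (wire_block p) && (wire_index p == ib true)) ||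
         (~~ input_bit (wire_block p) && (wire_index p == ib false))] |
      (2 * n + 1 + Pw < wire_block p) && (wire_index p == iN)].

Definition start_row p := if is_const p then Some (const_val p) else None.

Definition block_val b : nat :=
  if b == 0 then iq else if b <= 2 * n + 1 then ib (input_bit b) else iN.

Lemma start_row_address b i : i < k -> (b <= 2 * n + 1) || (2 * n + 1 + Pw < b) ->
  start_row (8 * (1 + K * b + i) + 1) = Some (i == block_val b).
Proof.
move=> Hi Hb; have [|E1 E2] := @wire_address b i; first by case/andP: kK; lia.
rewrite /start_row /is_const /const_val E1 E2 eqxx Hi Hb /= /block_val; congr Some.
case: b Hb {E1 E2} => [|b] Hb /=; first by rewrite orbF.
case: (leqP b.+1 (2 * n + 1)) Hb => [le _|gt /= ->] //=.
have -> : (2 * n + 1 + Pw < b.+1) = false by clear -le; lia.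
by rewrite orbF; case: (input_bit _); rewrite /= ?orbF.
Qed.

Lemma start_row_inv p v : start_row p = Some v -> exists b i,
  [/\ i < k, (b <= 2 * n + 1) || (2 * n + 1 + Pw < b), p = 8 * (1 + K * b + i) + 1 & v = (i == block_val b)].
Proof.
rewrite {1}/start_row; case: ifP => // /and3P[/eqP Ep Hi Hb] [Ev].
exists (wire_block p), (wire_index p); split=> //.
have := start_row_address Hi Hb; rewrite -Ep /start_row /is_const -Ep eqxx Hi Hb /=.
by rewrite Ev => -[].
Qed.

Definition consistent L (s : nat -> bool) := forall p b, p < L -> start_row p = Some b -> s p = b.
Let L := 8 * (K * (W + 2)) + 30.

Lemma address_lt b i : b <= W -> i < k -> 8 * (1 + K * b + i) + 1 < L.
Proof.
move=> Hb Hi; have : K * b <= K * W by rewrite leq_mul2l Hb orbT.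
by case/andP: kK => _ le; rewrite /L mulnDr; clear HW; lia.
Qed.

Lemma bits_const s b : consistent L s -> b <= W -> (b <= 2 * n + 1) || (2 * n + 1 + Pw < b) ->
  bits k K s b = onehot k (block_val b).
Proof.
move=> Hs bW Hb; apply/eq_in_map => i; rewrite mem_iota add0n => /andP[_ Hi].
by apply: Hs (address_lt bW Hi) _; rewrite start_row_address.
Qed.

Lemma input_bits : [seq input_bit j.+1 | j <- iota 0 (2 * n + 1)] = code_nat n ++ x.
Proof.
have E : size (code_nat n) = n.+1 by rewrite /code_nat size_rcons size_nseq.
apply: (@eq_from_nth _ false); first by rewrite size_map size_iota size_cat E -/n; lia.
move=> j; rewrite size_map size_iota => Hj; rewrite (nth_map 0) ?size_iota // nth_iota // add0n.
rewrite nth_cat E /input_bit /code_nat nth_rcons size_nseq nth_nseq.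
case: (ltngtP j n) => [lt|gt|->].
- by rewrite (leqW lt).
- have -> : (j < n.+1) = false by rewrite ltnS leqNgt gt.
  by rewrite /= ltnS gt /=; congr nth; clear -gt; lia.
- by rewrite ltnSn ltnn.
Qed.

(** Whatever the free blocks contain, the word read ends at the first block that is no bit, and the
    block after the free ones is a fixed blank; this bounds the certificate. *)
Lemma consistent_word s : consistent L s -> bits k K s 0 = onehot k iq /\
  exists2 w, size w <= Pw & lead [seq rb (bits k K s j.+1) | j <- iota 0 W] = code_pair x w.
Proof.
move=> Hs; split; first exact: (bits_const Hs).
have -> : W = 2 * n + 1 + (W - (2 * n + 1)) by lia.
rewrite iotaD map_cat add0n; set u := map _ (iota (2 * n + 1) _).
have -> : [seq rb (bits k K s j.+1) | j <- iota 0 (2 * n + 1)] = [seq Some b | b <- code_nat n ++ x].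
  rewrite -input_bits -map_comp; apply/eq_in_map => j; rewrite mem_iota add0n => /andP[_ Hj].
  have Hj1 : j.+1 <= 2 * n + 1 by [].
  rewrite (bits_const Hs) ?Hj1 // /block_val /= ?Hj1 ?rbS //.
  by clear -Hj HW; lia.
rewrite lead_cat; exists (lead u); last by rewrite /code_pair /code_seq flatten_singletons.
apply: size_lead; rewrite /u (nth_map 0) ?size_iota ?nth_iota; [|clear -HW; lia|clear -HW; lia].
have h2 : ((2 * n + 1 + Pw).+1 <= 2 * n + 1) || (2 * n + 1 + Pw < (2 * n + 1 + Pw).+1).
  by rewrite ltnSn orbT.
rewrite (bits_const Hs HW h2).
have -> // : block_val (2 * n + 1 + Pw).+1 = iN.
by rewrite /block_val /=; case: ifP => //; clear; lia.
Qed.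

Lemma word_consistent w : size w <= Pw -> exists2 s, consistent L s &
  lead [seq rb (bits k K s j.+1) | j <- iota 0 W] = code_pair x w.
Proof.
move=> Hw; set z := code_pair x w.
have Ez : z = (code_nat n ++ x) ++ w by rewrite /z /code_pair /code_seq flatten_singletons.
have Sc : size (code_nat n ++ x) = 2 * n + 1.
  by rewrite size_cat /code_nat size_rcons size_nseq -/n; lia.
have Sz : size z = 2 * n + 1 + size w by rewrite Ez size_cat Sc.
pose bv b := if b == 0 then iq else if b.-1 < size z then ib (nth false z b.-1) else iN.
pose s p := wire_index p == bv (wire_block p).
have kK' i : i < k -> i < K by case/andP: kK => _ le Hi; apply: leq_trans le.
have sE b i : i < k -> s (8 * (1 + K * b + i) + 1) = (i == bv b).
  by move=> Hi; have [E1 E2] := @wire_address b i (kK' i Hi); rewrite /s E1 E2.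
have Bs b : bits k K s b = onehot k (bv b).
  by apply/eq_in_map => i; rewrite mem_iota add0n => /andP[_ Hi]; rewrite /wires sE.
exists s.
  move=> p v _ /start_row_inv[b [i [Hi Hb -> ->]]]; rewrite sE //; congr (_ == _).
  rewrite /bv /block_val; case: b Hb => [|b] //= Hb.
  case: (leqP b.+1 (2 * n + 1)) Hb => [le _|gt /= lt].
    have -> : b < size z by rewrite Sz; clear -le; lia.
    rewrite Ez nth_cat Sc le; congr ib; rewrite -input_bits (nth_map 0) ?size_iota //.
    by rewrite nth_iota.
  by have -> : (b < size z) = false by rewrite Sz; clear -lt Hw; lia.
have -> : W = size z + (W - size z) by rewrite Sz; clear -Hw HW; lia.
rewrite iotaD map_cat add0n.
have -> : [seq rb (bits k K s j.+1) | j <- iota 0 (size z)] = [seq Some b | b <- z].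
  rewrite -[in RHS](mkseq_nth false z) /mkseq -map_comp.
  apply/eq_in_map => j; rewrite mem_iota add0n => /andP[_ Hj] /=.
  by rewrite Bs /bv /= Hj rbS.
rewrite lead_cat; case: (W - size z) => [|m] /=; first by rewrite cats0.
by rewrite Bs /bv /= ltnn rbN cats0.
Qed.
End Reduction.

Lemma linked_planar_3SAT_NP_hard (R : realType) :
  NP_hard (linked_planar_3SAT R exactly_three_variables).
Proof.
move=> L' [V [a' [d' [[M [a [d HM]]] HL']]]].
have [k [K [iq [iN [ib [rb [Q0 [Q1 [Q2 [Q3 [Q4 [kK HQ rbS rbN Hrun]]]]]]]]]]]] := TM_program M.
pose Pw n := a' * n.+1 ^ d'.
pose Z n := 2 * n + 1 + Pw n.
pose T n := a * (Z n).+1 ^ d.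
(* The tape lists grow by at most one cell per step, so input length plus running time leaves the
   last cell blank throughout. *)
pose W n := Z n + T n + 1.
(* Room for the control, [W n] cells and the reach of the last window; the summand 30 covers the
   final swap and the bound 20 on row lengths. *)
pose Lr n := 8 * (K * (W n + 2)) + 30.
pose prog n := tm_prog K Q0 Q1 Q2 Q3 Q4 (W n) (T n).
(* [ic], [inb] and [cv] repeat [is_const], [input_bit] and [const_val] with the length as a separate
   argument, the form in which definability is stated. *)
pose ic (x : seq bool) n p := [&& p == 8 * (1 + K * wire_block K p + wire_index K p) + 1,
  wire_index K p < k &
  (wire_block K p <= 2 * n + 1) || (2 * n + 1 + Pw n < wire_block K p)].
pose inb (x : seq bool) n b := (b <= n) || ((n.+1 < b) && nth false x (b - n - 2)).
pose cv x n p := [|| (wire_block K p == 0) && (wire_index K p == iq),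
  [&& 0 < wire_block K p, wire_block K p <= 2 * n + 1 &
     (inb x n (wire_block K p) && (wire_index K p == ib true)) ||
     (~~ inb x n (wire_block K p) && (wire_index K p == ib false))] |
  (2 * n + 1 + Pw n < wire_block K p) && (wire_index K p == iN)].
pose F x n := code_formula (formula_vars (Lr n) (prog n))
  (formula (Lr n) (fun p => if ic x n p then Some (cv x n p) else None) (prog n)).
exists (fun x => F x (size x)); split.
  apply: (@sdef_polytime F).
  have HPw : def (fun x e => Pw (head 0 e)) by rewrite /Pw; def_tac.
  have HT : def (fun x e => T (head 0 e)) by rewrite /T /Z /Pw; def_tac.
  have HWd : def (fun x e => W (head 0 e)) by rewrite /W /T /Z /Pw; def_tac.
  have HLr : def (fun x e => Lr (head 0 e)) by rewrite /Lr /W /T /Z /Pw; def_tac.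
  apply: (@sdef_code_formula (fun x e => Lr (head 0 e)) (fun x e => ic x (head 0 e))
    (fun x e => cv x (head 0 e)) (fun x e => prog (head 0 e)) HLr).
  - by rewrite /ic /wire_index /wire_block /wire_pos /quo /Pw; def_tac.
  - by rewrite /cv /inb /wire_index /wire_block /wire_pos /quo /Pw; def_tac.
  - exact: idef_tm_prog.
move=> x; set n := size x.
have WZ : 2 * n + 1 + Pw n < W n by rewrite /W -/(Z n); clear; lia.
have W0 : 0 < W n by apply: leq_ltn_trans WZ.
have L20 : 20 < Lr n by rewrite /Lr; clear; lia.
rewrite /F (code_formula_correct R _ L20); last exact: (fits_tm_prog _ W0 HQ (leqnn _)).
have steps w : size w <= Pw n -> size (code_pair x w) <= Z n.
  move=> Hw; rewrite /code_pair /code_seq flatten_singletons !size_cat /code_nat size_rcons size_nseq.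
  by rewrite -/n /Z; move: Hw; move: (Pw n) (size w); clear; lia.
have key s w : size w <= Pw n -> bits k K s 0 = onehot k iq ->
    lead [seq rb (bits k K s j.+1) | j <- iota 0 (W n)] = code_pair x w ->
    run (prog n) s 1 = V (code_pair x w).
  move=> Hw B0 E; have := Hrun (W n) (T n) s (a * (size (code_pair x w)).+1 ^ d) (V (code_pair x w)) B0.
  rewrite E; apply; last exact: HM.
    by rewrite /W addn1 ltnS leq_add2r; apply: steps.
  rewrite /T leq_mul2l; apply/orP; right; case: (posnP d) => [->|d0]; first by rewrite !expn0.
  by rewrite leq_exp2r // ltnS; apply: steps.
rewrite HL'; split.
- case=> w [Hw HV]; have [s Hs E] := @word_consistent k K iq iN ib rb kK rbS rbN (W n) (Pw n) x WZ w Hw.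
  have [B0 _] := @consistent_word k K iq iN ib rb kK rbS rbN (W n) (Pw n) x WZ s Hs.
  by exists s; split; [exact: Hs | rewrite (key s w)].
- case=> s [Hs Hacc].
  have [B0 [w Hw E]] := @consistent_word k K iq iN ib rb kK rbS rbN (W n) (Pw n) x WZ s Hs.
  by exists w; split; [exact: Hw | rewrite -(key s w)].
Qed.

Theorem theorem6 (R : realType) : NP_complete (linked_planar_3SAT R exactly_three_variables).
Proof. by split; [exact: linked_planar_3SAT_in_NP | exact: linked_planar_3SAT_NP_hard]. Qed.
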